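(* Let $X$ be an oriented triangulated pseudo 3-manifold. The map $$\tilde\Omega_{X,r}\colon \tilde S_r(X)\to\mathbb R^{\Delta_1(X)}$$ is an affine $H^1(\partial N_0(X),\mathbb R)$-bundle. The space $\tilde S_r(X)$ carries a Poisson structure whose symplectic leaves are the fibers of $\tilde\Omega_{X,r}$ and which is identical to the Poisson structure induced by the $H^1(\partial N_0(X),\mathbb R)$-bundle structure. The natural projection map from $\widetilde{LS}_r(X)$ to $\tilde S_r(X)$ (forgetting the level) is an affine $\mathbb R$-bundle which restricts to the affine $\mathbb R$-bundle $LS_r(X)$ over $S_r(X)$. If $h\colon X\to Y$ is an isomorphism of cellular structures of oriented triangulated pseudo 3-manifolds, then there is an induced Poisson isomorphism $h^*\colon\tilde S_r(Y)\to\tilde S_r(X)$ which is an affine bundle isomorphism with respect to the induced group homomorphism $h^*\colon H^1(\partial N_0(Y),\mathbb R)\to H^1(\partial N_0(X),\mathbb R)$ and which maps $S_r(Y)$ to $S_r(X)$. Furthermore, $h$ induces an isomorphism $h^*\colon\widetilde{LS}_r(Y)\to\widetilde{LS}_r(X)$ of affine $\mathbb R$-bundles covering $h^*\colon\tilde S_r(Y)\to\tilde S_r(X)$, which also maps $LS_r(Y)$ to $LS_r(X)$.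
   Context: Oriented triangulated pseudo 3-manifold: take a disjoint union of finitely many standard 3-simplices in $\mathbb R^3$, each with totally ordered vertices, and identify some of the codimension-1 faces in pairs by vertex-order-preserving, orientation-reversing affine homeomorphisms; the quotient CW-complex is $X$. $\Delta_i(X)$ is the set of $i$-cells; $\Delta_3^1(X)=\{(T,e): T\in\Delta_3(X),\ e\in\Delta_1(T)\}$ is the set of (tetrahedron, edge of that tetrahedron) pairs, and $\phi^{3,1}\colon\Delta_3^1(X)\to\Delta_1(X)$ sends such a pair to the corresponding edge of $X$. $\partial X$ is the union of unidentified faces. $N_0(X)$ is a sufficiently small tubular neighbourhood of $\Delta_0(X)$; $\partial N_0(X)$ is a surface, possibly disconnected and possibly with boundary (if $\partial X\neq\varnothing$), with an induced triangulation. A shape structure on $X$ is a map $\alpha_X\colon\Delta_3^1(X)\to\mathbb R_{>0}$ (dihedral angles) such that the three angles at the edges from each vertex of each tetrahedron sum to $\pi$; a generalized shape structure is the same with values in $\mathbb R$. (Opposite edges of a tetrahedron then carry equal values.) $S(X)$, $\tilde S(X)$ denote the sets of shape structures and generalized shape structures. The weight function of $\alpha_X$ is $\omega_X\colon\Delta_1(X)\to\mathbb R$, $\omega_X(e)=\sum_{a\in(\phi^{3,1})^{-1}(e)}\alpha_X(a)$, and $\tilde\Omega_X\colon\tilde S(X)\to\mathbb R^{\Delta_1(X)}$ sends $\alpha_X$ to $\omega_X$. A leveled (generalized) shape structure is a pair $(\alpha_X,\ell_X)$ with $\alpha_X$ a (generalized) shape structure and $\ell_X\in\mathbb R$ (the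 level). $p\colon\Delta_3^1(X)\to\Delta_3^{1/p}(X)$ is the quotient identifying opposite edges of each tetrahedron. The orientation induces a cyclic order on the three edges at each vertex of a tetrahedron, hence on its three pairs of opposite edges. For $a,b\in\Delta_3^{1/p}(X)$, $\varepsilon_{a,b}=-\varepsilon_{b,a}\in\{0,\pm1\}$ is $0$ if the underlying tetrahedra are distinct, and $+1$ if they coincide and $b$ is cyclically preceded by $a$. Based gauge equivalence: $(\alpha_X,\ell_X)\sim(\alpha'_X,\ell'_X)$ if there is $g\colon\Delta_1(X)\to\mathbb R$ vanishing on $\Delta_1(\partial X)$ with $$\alpha'_X(a)=\alpha_X(a)+\pi\sum_{b\in\Delta_3^1(X)}\varepsilon_{p(a),p(b)}\,g(\phi^{3,1}(b))\ \ \forall a\in\Delta_3^1(X),$$ $$\ell'_X=\ell_X+\sum_{e\in\Delta_1(X)}g(e)\sum_{a\in(\phi^{3,1})^{-1}(e)}\Big(\tfrac13-\tfrac{\alpha_X(a)}\pi\Big);$$ forgetting levels gives based gauge equivalence of (generalized) shape structures. $S_r(X)$, $\tilde S_r(X)$, $LS_r(X)$, $\widetilde{LS}_r(X)$ denote the sets of based gauge equivalence classes of, respectively, shape structures, generalized shape structures, leveled shape structures and leveled generalized shape structures; $S_r(X)$ is an open convex subset of $\tilde S_r(X)$. Weights are gauge invariant, so $\tilde\Omega_X$ descends to $\tilde\Omega_{X,r}\colon\tilde S_r(X)\to\mathbb R^{\Delta_1(X)}$. Poisson structures: $\tilde S(X)$ carries the Neumann–Zagier symplectic structure, the unique symplectic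 structure with Poisson bracket $\{\alpha_a,\alpha_b\}=\varepsilon_{a,b}$, where for $a\in\Delta_3^{1/p}(X)$ the function $\alpha_a$ on $\tilde S(X)$ is the value at the pair of opposite edges $a$; the Poisson structure on $\tilde S_r(X)$ arises from it by symplectic reduction. The Poisson structure induced by the $H^1(\partial N_0(X),\mathbb R)$-bundle structure is the fiberwise one for which the linear functions on a fiber defined by classes $\gamma_1,\gamma_2\in H_1(\partial N_0(X),\mathbb R)$ have bracket equal to the intersection number $\gamma_1\cdot\gamma_2$.
   Formalization: With non-empty boundary the Poisson claim fails (cone over an annulus: 1-dimensional fibers), so ''reduced = bundle-induced bracket'' is stated only for closed X, and ''leaves = fibers'' only for X closed or with non-degenerate intersection form on H_1(∂N_0(X)). *)

(* Defs.v *)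
From HB Require Import structures.
From Stdlib Require Import Relation_Operators.
From mathcomp Require Import all_boot all_order all_algebra all_fingroup.
From mathcomp Require Import all_classical all_reals all_analysis.

Set Implicit Arguments.
Unset Strict Implicit.
Unset Printing Implicit Defensive.

Import Order.TTheory GRing.Theory Num.Theory.
Import numFieldNormedType.Exports.

Local Open Scope classical_set_scope.
Local Open Scope ring_scope.

(* Quotient of a finite set by the equivalence relation generated by the
   (symmetric) identifications r; its elements are the equivalence classes. *)
Section FinQuotient.
Variables (D : finType) (r : rel D).

Definition fclass (x : D) : {set D} := [set y | connect r x y]%SET.

Definition fquot := {C : {set D} | [exists x, C == fclass x]}.
HB.instance Definition _ := Finite.on fquot.

Fact fpi_subproof x : [exists y, fclass x == fclass y].
Proof. by apply/existsP; exists x. Qed.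

Definition fpi (x : D) : fquot := Sub (fclass x) (fpi_subproof x).
End FinQuotient.

(* Only used for equivalence relations r; then r x is the class of x. *)
Section ClassQuotient.
Variables (T : Type) (r : T -> T -> Prop).

Definition cquot := {C : set T | exists x, C = r x}.

Definition cpi (x : T) : cquot := exist _ (r x : set T) (ex_intro _ x erefl).

(* A chosen representative; maps out of cquot defined through it below are
   invariant under r. *)
Definition crepr (C : cquot) : T := projT1 (cid (proj2_sig C)).
End ClassQuotient.

(* Quotient of a vector space by a subspace: the additive quotient of the
   library, with the induced scaling. *)
Section VectorQuotient.
Variables (R : pzRingType) (V : lmodType R) (B : submodClosed V).
Local Open Scope quotient_scope.

Definition vsub (v : V) : bool := v \in B.

Fact vsub_zmod_closed : zmod_closed (vsub : {pred V}).
Proof.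
split=> [|u v uB vB]; first exact: (rpred0 B).
by rewrite -scaleN1r; apply: (rpredD (S := B)) => //; exact: (rpredZ (s := B)).
Qed.
HB.instance Definition _ := GRing.isZmodClosed.Build V vsub vsub_zmod_closed.

Definition vzmod : zmodClosed V := GRing.ZmodClosed.clone V vsub _.

Definition vquot := Quotient.quot vzmod.
HB.instance Definition _ := GRing.Zmodule.on vquot.
HB.instance Definition _ := Choice.on vquot.

Definition vpi (v : V) : vquot := \pi_(Quotient.quot vzmod) v.
Definition vrepr (q : vquot) : V := generic_quotient.repr (q : Quotient.quot vzmod).

Lemma vreprK q : vpi (vrepr q) = q.
Proof. exact: (@reprK V (Quotient.quot vzmod)). Qed.

Lemma vpi_eq u v : (vpi u = vpi v) <-> (u - v \in B).
Proof.
by rewrite (Quotient.idealrBE vzmod); split => [/eqP|/eqP].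
Qed.

Lemma vpiD u v : vpi (u + v) = vpi u + vpi v.
Proof. exact: (raddfD (\pi_(Quotient.quot vzmod))). Qed.

Definition vscale (a : R) (q : vquot) : vquot := vpi (a *: vrepr q).

Lemma vpiZ a u : vscale a (vpi u) = vpi (a *: u).
Proof.
apply/vpi_eq; rewrite -scalerBr rpredZ //.
by apply/vpi_eq; rewrite vreprK.
Qed.

Fact vscaleA a b q : vscale a (vscale b q) = vscale (a * b) q.
Proof. by rewrite -(vreprK q) !vpiZ scalerA. Qed.
Fact vscale1 : left_id 1 vscale.
Proof. by move=> q; rewrite -(vreprK q) vpiZ scale1r. Qed.
Fact vscaleDr : right_distributive vscale +%R.
Proof.
by move=> a p q; rewrite -(vreprK p) -(vreprK q) -vpiD !vpiZ scalerDr vpiD.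
Qed.
Fact vscaleDl q : {morph vscale^~ q : a b / a + b}.
Proof. by move=> a b; rewrite -(vreprK q) !vpiZ scalerDl vpiD. Qed.

HB.instance Definition _ := GRing.Zmodule_isLmodule.Build R vquot
  vscaleA vscale1 vscaleDr vscaleDl.
End VectorQuotient.

(* The vertices of every tetrahedron are 0 < 1 < 2 < 3, and (T, i) is the face
   of T opposite to the vertex i.  The face (T, i) may be identified with
   (T', j) by its vertex-order-preserving affine homeomorphism, which sends the
   vertex lift i k to lift j k for k : 'I_3.  neg T says that the vertex order
   of T is negatively oriented; the order-induced orientation of the face (T, i)
   is (-1)^(neg T + i) times the boundary one, so that the identification
   reverses the boundary orientations exactly when glue_orient holds.  In
   particular no face is identified with itself. *)
Record manifold := Manifold {
  tet : finType;
  neg : tet -> bool;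
  glue : tet * 'I_4 -> option (tet * 'I_4);
  glue_sym : forall f f', glue f = Some f' -> glue f' = Some f;
  glue_orient : forall f f', glue f = Some f' ->
    neg f.1 (+) odd f.2 != neg f'.1 (+) odd f'.2
}.

Definition edge := {e : {set 'I_4} | #|e| == 2%N}.
HB.instance Definition _ := Finite.on edge.

(* A flag (T, s) is the tetrahedron T with an enumeration s of its vertices.
   Composition in 'S_4 is (t * s) k = s (t k). *)
Definition flag (X : manifold) := (tet X * 'S_4)%type.
HB.instance Definition _ X := Finite.on (flag X).

Definition pos0 : 'I_4 := inord 0.
Definition pos1 : 'I_4 := inord 1.
Definition pos2 : 'I_4 := inord 2.
Definition pos3 : 'I_4 := inord 3.

Section Cells.
Variable X : manifold.

(* Delta_3^1(X) *)
Definition tedge := (tet X * edge)%type.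
HB.instance Definition _ := Finite.on tedge.

Definition tedge_glued : rel tedge := fun a b =>
  [exists i : 'I_4, exists j : 'I_4, exists g : {set 'I_3},
    [&& glue (a.1, i) == Some (b.1, j),
        val a.2 == lift i @: g & val b.2 == lift j @: g]].

(* Delta_1(X), and phi^{3,1} : Delta_3^1(X) -> Delta_1(X) *)
Definition cell1 := fquot tedge_glued.
HB.instance Definition _ := Finite.on cell1.
Definition phi31 : tedge -> cell1 := fpi tedge_glued.

(* membership in Delta_1(\partial X) *)
Definition bdry_cell1 (e : cell1) : Prop := exists (a : tedge) (i : 'I_4),
  [/\ phi31 a = e, glue (a.1, i) = None & i \notin val a.2].

Definition closed_manifold : Prop := forall f : tet X * 'I_4, glue f <> None.

(* Delta_3^{1/p}(X) and p *)
Definition opposite : rel tedge := fun a b =>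
  (a.1 == b.1) && (val b.2 == ~: val a.2)%SET.
Definition tquad := fquot opposite.
HB.instance Definition _ := Finite.on tquad.
Definition quad : tedge -> tquad := fpi opposite.

(* (T, s) is positive if the enumeration s is positively oriented in T *)
Definition positive (x : flag X) : bool := odd_perm x.2 == neg x.1.

(* The edges from the vertex s 0 of T to s 1, s 2, s 3 are in cyclic order
   whenever (T, s) is positive; this is the boundary orientation on the link
   triangle of s 0, as seen on the boundary of a neighbourhood of s 0. *)
Definition cyc_next (a b : tquad) : bool :=
  [exists x : flag X, positive x &&
    [exists c : tedge, exists d : tedge,
     [&& c \in val a, d \in val b, c.1 == x.1, d.1 == x.1,
         val c.2 == [set x.2 pos0; x.2 pos1]%SET &
         val d.2 == [set x.2 pos0; x.2 pos2]%SET]]].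

Definition eps (R : pzRingType) (a b : tquad) : R :=
  (cyc_next a b)%:R - (cyc_next b a)%:R.
End Cells.

Section Shapes.
Variables (R : realType) (X : manifold).
Implicit Types (x : {ffun tedge X -> R^o}).

Definition angle_sums x : bool := [forall T : tet X, [forall v : 'I_4,
  \sum_(e : edge | v \in val e) x (T, e) == pi]].

(* tilde S(X) *)
Definition gshape := {x : {ffun tedge X -> R^o} | angle_sums x}.
HB.instance Definition _ := SubChoice.on gshape.

(* S(X), as a subset of tilde S(X) *)
Definition shape : set gshape := [set al : gshape | forall a, 0 < val al a].

Definition weight (al : gshape) : {ffun cell1 X -> R^o} :=
  [ffun e => \sum_(a | phi31 a == e) val al a].

(* tilde LS(X), consisting of pairs (shape, level) *)
Definition lgshape := (gshape * R)%type.

Definition based (g : {ffun cell1 X -> R}) : Prop :=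
  forall e, bdry_cell1 e -> g e = 0.

Definition shape_moved g (al be : gshape) : Prop := forall a,
  val be a = val al a +
    pi * \sum_(b : tedge X) eps R (quad a) (quad b) * g (phi31 b).

Definition level_shift (g : {ffun cell1 X -> R}) (al : gshape) : R :=
  \sum_e g e * \sum_(a | phi31 a == e) (3%:R^-1 - val al a / pi).

Definition gauge_equiv (al be : gshape) : Prop :=
  exists2 g, based g & shape_moved g al be.

Definition lgauge_equiv (al be : lgshape) : Prop :=
  exists g, [/\ based g, shape_moved g al.1 be.1 &
                be.2 = al.2 + level_shift g al.1].

(* tilde S_r(X), S_r(X), tilde LS_r(X) and LS_r(X) *)
Definition Sr := cquot gauge_equiv.
Definition Sr_pos : set Sr := [set cpi gauge_equiv al | al in shape].
Definition LSr := cquot lgauge_equiv.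
Definition LSr_pos : set LSr :=
  [set cpi lgauge_equiv al | al in [set al : lgshape | shape al.1]].

(* tilde Omega_{X,r} *)
Definition Omega_r (x : Sr) : {ffun cell1 X -> R^o} := weight (crepr x).

Definition forget (u : LSr) : Sr := cpi gauge_equiv (crepr u).1.

Definition level_act (t : R^o) (u : LSr) : LSr :=
  cpi lgauge_equiv ((crepr u).1, (crepr u).2 + t).
End Shapes.

(* The triangles of \partial N_0(X) are the corners (T, v).  A flag (T, s)
   names the oriented side of the triangle (T, s 0) that goes from the edge
   {s 0, s 1} to the edge {s 0, s 2} of T; it lies on the face of T opposite to
   s 3.  Two flags name the same oriented 1-cell of \partial N_0(X) iff they are
   equal or glued, and (T, s) has its source at the 0-cell given by the pair
   (s 0, s 1). *)
Section Link.
Variables (R : realType) (X : manifold).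

Definition glued : rel (flag X) := fun x y =>
  (glue (x.1, x.2 pos3) == Some (y.1, y.2 pos3)) &&
  [forall k, unlift (x.2 pos3) (x.2 k) == unlift (y.2 pos3) (y.2 k)].

Definition frev (x : flag X) : flag X := (x.1, (tperm pos1 pos2 * x.2)%g).
(* the next side of the same triangle, from {s 0, s 2} to {s 0, s 3} *)
Definition frot (x : flag X) : flag X :=
  (x.1, (tperm pos1 pos2 * tperm pos1 pos3 * x.2)%g).
(* the other side of the same triangle with the same source *)
Definition fflip (x : flag X) : flag X := (x.1, (tperm pos2 pos3 * x.2)%g).

Definition same_source : rel (flag X) :=
  connect (fun x y => glued x y || (y == fflip x)).

Implicit Types (c f : {ffun flag X -> R^o}) (z : {ffun flag X -> R}).

Definition is_cochain0 f : bool :=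
  [forall x, forall y, same_source x y ==> (f x == f y)].

Definition is_cochain1 c : bool :=
  [forall x, forall y, glued x y ==> (c x == c y)] &&
  [forall x, c (frev x) == - c x].

Definition is_cocycle1 c : bool :=
  is_cochain1 c && [forall x, c x + c (frot x) + c (frot (frot x)) == 0].

Fact is_cocycle1_submod : submod_closed (is_cocycle1 : {pred _}).
Proof.
split=> [|a c d].
  rewrite unfold_in; apply/andP; split; first (apply/andP; split).
  - by apply/'forall_'forall_implyP => x y _; rewrite !ffunE.
  - by apply/forallP => x; rewrite !ffunE oppr0.
  - by apply/forallP => x; rewrite !ffunE !addr0.
rewrite !unfold_in.
move=> /andP[/andP[/'forall_'forall_implyP c1 /forallP c2] /forallP c3].
move=> /andP[/andP[/'forall_'forall_implyP d1 /forallP d2] /forallP d3].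
apply/andP; split; first (apply/andP; split).
- apply/'forall_'forall_implyP => x y xy; rewrite !ffunE.
  by rewrite (eqP (c1 _ _ xy)) (eqP (d1 _ _ xy)).
- apply/forallP => x; rewrite !ffunE (eqP (c2 x)) (eqP (d2 x)).
  by rewrite scalerN opprD.
- apply/forallP => x; rewrite !ffunE.
  rewrite (_ : _ + _ = a *: (c x + c (frot x) + c (frot (frot x))) +
     (d x + d (frot x) + d (frot (frot x)))); last first.
    rewrite !scalerDr -!addrA; congr (_ + _).
    rewrite addrCA; congr (_ + _); rewrite [RHS]addrCA; congr (_ + _).
    by rewrite addrCA.
  by rewrite (eqP (c3 x)) (eqP (d3 x)) scaler0 addr0.
Qed.
HB.instance Definition _ := GRing.isSubmodClosed.Build R {ffun flag X -> R^o}
  is_cocycle1 is_cocycle1_submod.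

Definition Z1 := {c : {ffun flag X -> R^o} | is_cocycle1 c}.
HB.instance Definition _ := SubChoice.on Z1.
HB.instance Definition _ := [SubChoice_isSubLmodule of Z1 by <:].

Definition is_coboundary1 (c : Z1) : bool :=
  `[< exists2 f : {ffun flag X -> R^o}, is_cochain0 f &
      forall x, val c x = f (frev x) - f x >].

Fact is_coboundary1_submod : submod_closed (is_coboundary1 : {pred _}).
Proof.
split=> [|a c d].
  apply/asboolP; exists 0 => [|x]; last by rewrite !ffunE subrr.
  by apply/'forall_'forall_implyP => x y _; rewrite !ffunE.
move=> /asboolP[f f0 fc] /asboolP[g g0 gd].
apply/asboolP; exists (a *: f + g) => [|x].
  apply/'forall_'forall_implyP => x y xy; rewrite !ffunE.
  move: f0 g0 => /'forall_'forall_implyP f0 /'forall_'forall_implyP g0.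
  by rewrite (eqP (f0 _ _ xy)) (eqP (g0 _ _ xy)).
by rewrite !ffunE /= fc gd scalerBr opprD addrACA.
Qed.
HB.instance Definition _ := GRing.isSubmodClosed.Build R Z1
  is_coboundary1 is_coboundary1_submod.

(* H^1(\partial N_0(X), R) *)
Definition B1 : submodClosed Z1 := GRing.SubmodClosed.clone R Z1 is_coboundary1 _.
Definition H1 := vquot B1.
HB.instance Definition _ := GRing.Lmodule.on H1.

(* A 1-chain is a combination z of sides of triangles; it stands for the chain
   \sum_x z x [x] of \partial N_0(X).  Its boundary has at the source of x0 the
   coefficient incoming minus outgoing. *)
Definition is_cycle1 z : Prop := forall x0,
  \sum_(x | same_source x0 (frev x)) z x = \sum_(x | same_source x0 x) z x.

(* evaluation of a cohomology class on the homology class of a cycle *)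
Definition pairing (v : H1) z : R := \sum_x z x * val (vrepr v) x.

(* cocycles relative to the boundary of \partial N_0(X) *)
Definition is_relative (c : Z1) : Prop :=
  forall x : flag X, glue (x.1, x.2 pos3) = None -> val c x = 0.

(* \int a \cup b over \partial N_0(X), for cocycles a and b one of which is
   relative: the contribution of a triangle with consecutive positively oriented
   sides x, x' is (a x * b x' - a x' * b x) / 2, and the sum below meets every
   triangle three times. *)
Definition cup_integral (a b : Z1) : R := 6%:R^-1 *
  \sum_(x | positive x) (val a x * val b (frot x) - val a (frot x) * val b x).

(* Poincare-Lefschetz dual of (the homology class of) a cycle *)
Definition is_dual z (c : Z1) : Prop :=
  is_relative c /\ forall v : Z1, pairing (vpi B1 v) z = cup_integral v c.

Definition poincare_dual z : Z1 := xget 0 [set c | is_dual z c].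

(* intersection number of (the homology classes of) two cycles *)
Definition intersection z1 z2 : R :=
  cup_integral (poincare_dual z1) (poincare_dual z2).

Definition intersection_nondegenerate : Prop :=
  forall z, is_cycle1 z -> (forall z', is_cycle1 z' -> intersection z z' = 0) ->
  forall v, pairing v z = 0.
End Link.

Section Smooth.
Variable R : realType.

Fixpoint Ck (k n : nat) (f : 'rV[R]_n -> R^o) : Prop :=
  continuous f /\
  if k is k'.+1 then
    forall v, (forall x, derivable f x v) /\ Ck k' (fun x => 'D_v f x)
  else True.

Definition Cinfty n (f : 'rV[R]_n -> R^o) : Prop := forall k, Ck k f.

Definition affine_map (U V : lmodType R) (f : U -> V) : Prop :=
  forall (t : R) u w, f (t *: u + (1 - t) *: w) = t *: f u + (1 - t) *: f w.

(* Smooth functions on a set A identified through c with an affine subspace of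
   a vector space: those whose composites with the affine maps R^n -> A are
   smooth. *)
Definition smooth_via (A : Type) (V : lmodType R) (c : A -> V) : set (A -> R) :=
  [set f | forall n (L : 'rV[R]_n -> A),
     affine_map (fun u => c (L u)) -> Cinfty (fun u => f (L u) : R^o)].

(* p : E -> B is an affine V-bundle over its image: V acts on E, simply
   transitively on every non-empty fiber, and (p, triv) is a smooth
   trivialization with inverse (p x, v) |-> act v (sec (p x)).  The smooth
   structures of E and B are given by their sets of smooth functions. *)
Definition affine_bundle (E B : Type) (smE : set (E -> R)) (smB : set (B -> R))
    (p : E -> B) (V : lmodType R) (act : V -> E -> E) : Prop :=
  [/\ forall x, act 0 x = x,
      forall u v x, act (u + v) x = act u (act v x),
      forall v x, p (act v x) = p x,
      forall x y, p x = p y -> exists! v, y = act v x &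
   [/\ forall f, smB f -> smE (fun x => f (p x)),
       forall v f, smE f -> smE (fun x => f (act v x)) &
       exists (triv : E -> V) (sec : B -> E),
       [/\ forall v x, triv (act v x) = v + triv x,
           forall l : {scalar V}, smE (fun x => l (triv x)),
           forall x, p (sec (p x)) = p x /\ triv (sec (p x)) = 0 &
           forall f, smE f -> smB (fun b => f (sec b))]]].

Definition bracket (E : Type) := (E -> R) -> (E -> R) -> (E -> R).

Definition poisson (E : Type) (sm : set (E -> R)) (br : bracket E) : Prop :=
  [/\ forall f g, sm f -> sm g -> sm (br f g),
      forall k f g h, sm f -> sm g -> sm h ->
        br (fun x => k * f x + g x) h = (fun x => k * br f h x + br g h x),
      forall f g, sm f -> sm g -> br f g = (fun x => - br g f x),
      forall f g h, sm f -> sm g -> sm h ->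
        br (fun x => f x * g x) h = (fun x => f x * br g h x + br f h x * g x) &
      forall f g h, sm f -> sm g -> sm h -> forall x,
        br f (br g h) x + br g (br h f) x + br h (br f g) x = 0].

(* y is reached from x along an integral curve of a Hamiltonian vector field *)
Definition hamiltonian_step (E : Type) (sm : set (E -> R)) (br : bracket E)
    (x y : E) : Prop :=
  exists (f : E -> R) (c : R -> E), [/\ sm f, c 0 = x, c 1 = y &
    forall g, sm g -> forall t : R, 0 <= t <= 1 ->
      is_derive t 1 (fun s : R => g (c s) : R^o) (br g f (c t))].

Definition same_leaf (E : Type) (sm : set (E -> R)) (br : bracket E)
  : E -> E -> Prop := clos_refl_sym_trans E (hamiltonian_step sm br).

Definition smooth_iso (E F : Type) (smE : set (E -> R)) (smF : set (F -> R))
    (h : F -> E) : Prop :=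
  bijective h /\ forall f : E -> R, smE f <-> smF (fun x => f (h x)).

Definition poisson_morphism (E F : Type) (smE : set (E -> R))
    (brE : bracket E) (brF : bracket F) (h : F -> E) : Prop :=
  forall f g, smE f -> smE g -> forall x,
    brE f g (h x) = brF (fun y => f (h y)) (fun y => g (h y)) x.
End Smooth.

Section Structures.
Variables (R : realType) (X : manifold).

Definition smooth_S : set (gshape R X -> R) :=
  smooth_via (fun al : gshape R X => val al).

Definition smooth_LS : set (lgshape R X -> R) :=
  smooth_via (fun al : lgshape R X =>
    ((val al.1, al.2) : ({ffun tedge X -> R^o} * R^o)%type)).

Definition smooth_weights : set ({ffun cell1 X -> R^o} -> R) :=
  smooth_via (fun w : {ffun cell1 X -> R^o} => w).

Definition smooth_Sr : set (Sr R X -> R) :=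
  [set f | smooth_S (fun al => f (cpi _ al))].

Definition smooth_LSr : set (LSr R X -> R) :=
  [set f | smooth_LS (fun al => f (cpi _ al))].

Definition neumann_zagier (br : bracket R (gshape R X)) : Prop :=
  poisson smooth_S br /\
  forall a b : tedge X,
    br (fun al => val al a) (fun al => val al b) =
    fun=> eps R (quad a) (quad b).

(* bracket on the reduced space obtained from the bracket nz by reduction *)
Definition is_reduction (nz : bracket R (gshape R X)) (br : bracket R (Sr R X))
  : Prop :=
  poisson smooth_Sr br /\
  forall f g, smooth_Sr f -> smooth_Sr g -> forall al,
    br f g (cpi _ al) = nz (fun be => f (cpi _ be)) (fun be => g (cpi _ be)) al.

Variable act : H1 R X -> Sr R X -> Sr R X.

(* H^1 acts by translations of the affine space tilde S_r(X), linearly *)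
Definition by_translations : Prop :=
  exists iota : {linear H1 R X -> {ffun tedge X -> R^o}},
  forall v (al : gshape R X), exists2 be : gshape R X,
    val be = val al + iota v & act v (cpi _ al) = cpi _ be.

(* f is, on the fiber through x, a linear function defined by the cycle z *)
Definition linear_on_fiber (f : Sr R X -> R) (x : Sr R X)
    (z : {ffun flag X -> R}) : Prop :=
  forall v, f (act v x) = f x + pairing v z.

(* the fiberwise Poisson structure given by the intersection pairing *)
Definition bundle_poisson (br : bracket R (Sr R X)) : Prop :=
  [/\ poisson smooth_Sr br,
      forall f f' g x, smooth_Sr f -> smooth_Sr f' -> smooth_Sr g ->
        (forall y, Omega_r y = Omega_r x -> f y = f' y) ->
        br f g x = br f' g x &
      forall f1 f2 z1 z2 x, smooth_Sr f1 -> smooth_Sr f2 ->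
        is_cycle1 z1 -> is_cycle1 z2 ->
        linear_on_fiber f1 x z1 -> linear_on_fiber f2 x z2 ->
        br f1 f2 x = intersection z1 z2].
End Structures.

(* Cellular isomorphisms preserve the cells, their identifications and the
   orientation; they need not preserve the orders of the vertices. *)
Record iso (X Y : manifold) := Iso {
  iso_tet : tet X -> tet Y;
  iso_vert : tet X -> 'S_4;
  iso_bij : bijective iso_tet;
  iso_glued : forall (T T' : tet X) (s s' : 'S_4),
    glued (iso_tet T, (s * iso_vert T)%g) (iso_tet T', (s' * iso_vert T')%g) =
    glued (T, s) (T', s');
  iso_orient : forall T, odd_perm (iso_vert T) = neg T (+) neg (iso_tet T)
}.

Fact edge_map_subproof (s : 'S_4) (e : edge) : #|s @: val e| == 2%N.
Proof. by rewrite card_imset ?(valP e) //; exact: perm_inj. Qed.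

Definition edge_map (s : 'S_4) (e : edge) : edge :=
  Sub (s @: val e) (edge_map_subproof s e).

Section Induced.
Variables (R : realType) (X Y : manifold) (h : iso X Y).

Definition iso_tedge (a : tedge X) : tedge Y :=
  (iso_tet h a.1, edge_map (iso_vert h a.1) a.2).

Definition iso_flag (x : flag X) : flag Y :=
  (iso_tet h x.1, (x.2 * iso_vert h x.1)%g).

Fact gshape_pull_subproof (al : gshape R Y) :
  angle_sums [ffun a => val al (iso_tedge a)].
Proof.
apply/'forall_forallP => T v; set s := iso_vert h T.
have /'forall_forallP/(_ (iso_tet h T) (s v))/eqP <- := valP al.
apply/eqP; rewrite [RHS](reindex (edge_map s)) /=; last first.
  exists (edge_map s^-1%g) => e _; apply: val_inj => /=;
    rewrite -imset_comp (eq_imset (g := id)) ?imset_id // => k /=;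
    by rewrite ?permK ?permKV.
apply: eq_big => [e|e _]; last by rewrite ffunE.
by rewrite mem_imset //; exact: perm_inj.
Qed.

Definition gshape_pull (al : gshape R Y) : gshape R X :=
  Sub [ffun a => val al (iso_tedge a)] (gshape_pull_subproof al).

Definition Sr_pull (x : Sr R Y) : Sr R X :=
  cpi _ (gshape_pull (crepr x)).

Definition LSr_pull (u : LSr R Y) : LSr R X :=
  cpi _ (gshape_pull (crepr u).1, (crepr u).2).

Fact Z1_pull_subproof (c : Z1 R Y) :
  is_cocycle1 [ffun x => val c (iso_flag x)].
Proof.
have /andP[/andP[/'forall_'forall_implyP c1 /forallP c2] /forallP c3] := valP c.
have iso_rev x : iso_flag (frev x) = frev (iso_flag x).
  by rewrite /iso_flag /frev /= mulgA.
have iso_rot x : iso_flag (frot x) = frot (iso_flag x).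
  by rewrite /iso_flag /frot /= mulgA.
apply/andP; split; first (apply/andP; split).
- apply/'forall_'forall_implyP => -[T s] [T' s'] xy; rewrite !ffunE.
  by apply: c1; rewrite /iso_flag /= iso_glued.
- by apply/forallP => x; rewrite !ffunE iso_rev; exact: c2.
- by apply/forallP => x; rewrite !ffunE !iso_rot; exact: c3.
Qed.

Definition Z1_pull (c : Z1 R Y) : Z1 R X :=
  Sub [ffun x => val c (iso_flag x)] (Z1_pull_subproof c).

Definition H1_pull (v : H1 R Y) : H1 R X := vpi _ (Z1_pull (vrepr v)).
End Induced.

(* Main.v *)
(* The dihedral angles of a shape structure are the angles of the triangles of the
   link of the vertices, and a cocycle of the link has a holonomy, the linear form
   dot _ (hop c) on angles.  If all holonomies vanish, the angles are the
   differences of a function on the sides of the link, and adding up its values at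
   the two ends of every edge yields a gauge transformation.  Dually, by the
   Fredholm alternative, every holonomy is realized by angles of weight zero.
   Hence the fibers of the weight map are torsors over H^1 of the link.  In the
   closed case epsop (hop c) is the Neumann-Zagier Hamiltonian field of the
   holonomy of c.  In the bracket of two holonomies the terms coming from
   different vertices of a tetrahedron cancel across the faces, which leaves twice
   the cup product; this is why H^1 acts through (sqrt 2)^-1 epsop (hop c).
   Poincare-Lefschetz duality on the link makes the action free and, in the
   nondegenerate case, the leaves equal to the fibers. *)
From HB Require Import structures.
From Stdlib Require Import Relation_Operators.
From mathcomp Require Import all_boot all_order all_algebra all_fingroup.
From mathcomp Require Import all_classical all_reals all_analysis.
From mathcomp Require Import ring lra.
Require Import Defs.

Set Implicit Arguments.
Unset Strict Implicit.
Unset Printing Implicit Defensive.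

Import Order.TTheory GRing.Theory Num.Theory.
Import numFieldNormedType.Exports.

Local Open Scope classical_set_scope.
Local Open Scope ring_scope.

(** Positive flags carry the whole combinatorics. The incidences of vertices, edges, sides and faces
    of a tetrahedron become the moves [frot], [fswap] and [fturn], crossing a face becomes the
    involution [fcross], and every cancellation is a reindexing of a sum over positive flags.

    The inner product [dot] turns covectors into vectors, so that existence statements become
    Fredholm alternatives and choices can be made linear by orthogonal projections and generalized
    inverses.

    On tangent vectors [epsop] squares to -12. This inverts the Neumann-Zagier form explicitly and
    is the source of the constant 12.

    All brackets are constant bivectors in one redundant linear chart. The Jacobi identity then
    rests on the symmetry of second derivatives, which has to be derived from directional
    derivatives alone.

    The map from cohomology to angles and the Poincare-Lefschetz duals involve choices that
    isomorphisms do not respect. Naturality therefore holds for the former modulo gauge directions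
    and for the latter after cup products are taken. *)

Definition linmap (R : pzRingType) (U V : lmodType R) (f : U -> V)
    (f_lin : linear f) : {linear U -> V} :=
  HB.pack_for {linear U -> V} f (GRing.isLinear.Build R U V _ f f_lin).

(** * Fredholm alternative, orthogonal projections and generalized inverses *)

Section LinearAlgebra.
Variable R : realFieldType.
Implicit Types I J : finType.

Definition dot I (x y : {ffun I -> R^o}) : R := \sum_i x i * y i.

Definition ffdelta I (i : I) : {ffun I -> R^o} := [ffun j => (j == i)%:R].

Lemma dotC I (x y : {ffun I -> R^o}) : dot x y = dot y x.
Proof. by apply: eq_bigr => i _; rewrite mulrC. Qed.

Lemma dot_is_linear I (x : {ffun I -> R^o}) :
  linear (dot x : {ffun I -> R^o} -> R^o).
Proof.
move=> a y z; rewrite /dot scaler_sumr -big_split /=; apply: eq_bigr => i _.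
by rewrite !ffunE mulrDr; congr (_ + _); rewrite /GRing.scale /= mulrCA.
Qed.
HB.instance Definition _ I (x : {ffun I -> R^o}) :=
  GRing.isLinear.Build R {ffun I -> R^o} R^o _ (dot x) (dot_is_linear x).

Lemma dot0r I (x : {ffun I -> R^o}) : dot x 0 = 0.
Proof. exact: (linear0 (dot x)). Qed.
Lemma dotDr I (x y z : {ffun I -> R^o}) : dot x (y + z) = dot x y + dot x z.
Proof. exact: (linearD (dot x)). Qed.
Lemma dotBr I (x y z : {ffun I -> R^o}) : dot x (y - z) = dot x y - dot x z.
Proof. exact: (linearB (dot x)). Qed.
Lemma dotZr I (x y : {ffun I -> R^o}) (a : R) : dot x (a *: y) = a * dot x y.
Proof. exact: (linearZ_LR (dot x)). Qed.
Lemma dotBl I (x y z : {ffun I -> R^o}) : dot (x - y) z = dot x z - dot y z.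
Proof. by rewrite dotC dotBr ![dot z _]dotC. Qed.
Lemma dotDl I (x y z : {ffun I -> R^o}) : dot (x + y) z = dot x z + dot y z.
Proof. by rewrite dotC dotDr ![dot z _]dotC. Qed.
Lemma dotZl I (x y : {ffun I -> R^o}) (a : R) : dot (a *: x) y = a * dot x y.
Proof. by rewrite dotC dotZr dotC. Qed.

Lemma dot_delta I (x : {ffun I -> R^o}) i : dot x (ffdelta i) = x i.
Proof.
rewrite /dot (bigD1 i) //= ffunE eqxx mulr1 big1 ?addr0 // => j ji.
by rewrite ffunE (negbTE ji) mulr0.
Qed.

Lemma dot_eq0 I (x : {ffun I -> R^o}) : dot x x = 0 -> x = 0.
Proof.
move/eqP; rewrite psumr_eq0 => [/allP h|i _]; last by rewrite -expr2 sqr_ge0.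
apply/ffunP => i; rewrite ffunE; apply/eqP.
by rewrite -sqrf_eq0 expr2; apply: h; rewrite mem_index_enum.
Qed.

Lemma ffun_sum_delta I (x : {ffun I -> R^o}) :
  x = \sum_i x i *: ffdelta i.
Proof.
apply/ffunP => i; rewrite sum_ffunE (bigD1 i) //= !ffunE eqxx.
rewrite big1 => [|j ji]; first by rewrite addr0 /GRing.scale /= mulr1.
by rewrite !ffunE eq_sym (negbTE ji) scaler0.
Qed.

Lemma linear_sum_delta I (V : lmodType R) (f : {linear {ffun I -> R^o} -> V}) x :
  f x = \sum_i x i *: f (ffdelta i).
Proof.
by rewrite {1}(ffun_sum_delta x) linear_sum; apply: eq_bigr => i _; rewrite linearZ.
Qed.

Lemma sum_enum_val I (V : zmodType) (F : I -> V) :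
  \sum_i F i = \sum_(p < #|I|) F (enum_val p).
Proof.
by rewrite (reindex (@enum_val I predT)) //; exact: onW_bij (enum_val_bij _).
Qed.

(** The row of [k] lies in the row space of the matrix of [L] as soon as the cokernel of this matrix
    kills it, and the columns of that cokernel are vectors of the kernel of [L]. *)
Lemma fredholm I J (L : {linear {ffun I -> R^o} -> {ffun J -> R^o}})
    (L' : {ffun J -> R^o} -> {ffun I -> R^o}) (k : {ffun I -> R^o}) :
    (forall c t, dot t (L c) = dot (L' t) c) ->
  (forall c, L c = 0 -> dot k c = 0) -> exists t, L' t = k.
Proof.
move=> LL' Lk.
pose M := \matrix_(j < #|J|, i < #|I|) (L (ffdelta (enum_val i)) (enum_val j) : R).
pose kk := \row_(i < #|I|) (k (enum_val i) : R).
have /submxP[t tE] : (kk <= M)%MS.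
  rewrite submxE; apply/eqP/rowP => p; rewrite mxE [RHS]mxE.
  pose c : {ffun I -> R^o} := [ffun i => cokermx M (enum_rank i) p].
  have cE i : cokermx M i p = c (enum_val i) by rewrite ffunE enum_valK.
  have /Lk : L c = 0.
    apply/ffunP => j; rewrite (linear_sum_delta L) sum_ffunE [RHS]ffunE.
    have /matrixP/(_ (enum_rank j) p) := mulmx_coker M; rewrite mxE [RHS]mxE => Mj.
    rewrite -[RHS]Mj sum_enum_val; apply: eq_bigr => i _.
    by rewrite cE mxE enum_rankK ffunE /GRing.scale /= mulrC.
  rewrite /dot => kc; rewrite -[RHS]kc.
  by rewrite [RHS]sum_enum_val; apply: eq_bigr => i _; rewrite mxE cE.
exists [ffun j => t 0 (enum_rank j)]; apply/ffunP => i.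
rewrite -dot_delta -LL' /dot.
have /rowP/(_ (enum_rank i)) := tE; rewrite !mxE enum_rankK => ->.
rewrite sum_enum_val; apply: eq_bigr => j _.
by rewrite !mxE !enum_rankK ffunE enum_valK.
Qed.

(** The complement of the kernel is the range of the adjoint [L']. The component there solves the
    normal equation [L (L' t) = L x], whose operator is self-adjoint with the same kernel as
    [L']. *)
Lemma orth_proj_kernel I J (L : {linear {ffun I -> R^o} -> {ffun J -> R^o}}) x :
  exists m, L m = 0 /\ forall m', L m' = 0 -> dot (x - m) m' = 0.
Proof.
pose L' t : {ffun I -> R^o} := [ffun i => dot t (L (ffdelta i))].
have LL' c t : dot t (L c) = dot (L' t) c.
  rewrite {1}(ffun_sum_delta c) linear_sum (linear_sum (dot t)) /=.
  apply: eq_bigr => i _; rewrite linearZ dotZr mulrC.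
  by rewrite [L' t i]ffunE.
have L'_lin : linear L'.
  move=> a s t; apply/ffunP => i; rewrite !ffunE dotDl dotZl.
  by [].
pose LL := linmap L'_lin.
have [t tE] : exists t, L (LL t) = L x.
  apply: (fredholm (L := linmap (linearP (L \o LL)))).
    by move=> c t /=; rewrite LL' dotC [RHS]dotC LL'.
  move=> c /= Lc; have : LL c = 0.
    by apply: dot_eq0; rewrite -[in X in dot X]/(L' c) -LL' Lc dot0r.
  by move=> Lc0; rewrite dotC LL' -[L' c]/(LL c) Lc0 dotC dot0r.
exists (x - L' t); split; first by rewrite linearB -tE subrr.
by move=> m' Lm'; rewrite opprB addrC subrK -LL' Lm' dot0r.
Qed.

(** A linear choice of preimages; it later picks gauge parameters and lifts of weights. *)
Lemma linear_ginv (U V : vectType R) (D : {linear U -> V}) :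
  exists G : {linear V -> U}, forall u, D (G (D u)) = D u.
Proof.
exists (linfun D)^-1%VF => u.
have := @limg_lfunVK R U V (linfun D) (D u); rewrite !lfunE; apply.
by rewrite -(lfunE D) memv_img // memvf.
Qed.

End LinearAlgebra.

Section Projections.
Variable R : realFieldType.
Implicit Types I J : finType.

Lemma in_range I J (L' : {linear {ffun J -> R^o} -> {ffun I -> R^o}})
    (k : {ffun I -> R^o}) :
    (forall c, (forall t, dot (L' t) c = 0) -> dot k c = 0) ->
  exists t, L' t = k.
Proof.
move=> Lk; pose L c : {ffun J -> R^o} := [ffun j => dot c (L' (ffdelta R j))].
have L_lin : linear L.
  by move=> a c d; apply/ffunP => j; rewrite !ffunE dotDl dotZl.
pose LL := linmap L_lin.
have LL' c t : dot t (LL c) = dot (L' t) c.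
  rewrite dotC [RHS]dotC (linear_sum_delta L' t) linear_sum /=.
  by apply: eq_bigr => j _; rewrite ffunE linearZ mulrC.
by apply: (fredholm LL') => c Lc; apply: Lk => t; rewrite -LL' Lc dot0r.
Qed.

(** The projection is chosen pointwise, but it is linear because it is unique: a kernel vector
    orthogonal to the kernel vanishes. *)
Lemma orth_proj I J (L : {linear {ffun I -> R^o} -> {ffun J -> R^o}}) :
  exists P : {linear {ffun I -> R^o} -> {ffun I -> R^o}}, forall x,
    L (P x) = 0 /\ forall m, L m = 0 -> dot (P x) m = dot x m.
Proof.
have /choice[P PE] := orth_proj_kernel L.
have P1 x m : L m = 0 -> dot (P x) m = dot x m.
  move=> Lm; have [_ /(_ m Lm)] := PE x.
  by rewrite dotBl => /eqP; rewrite subr_eq0 => /eqP.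
have P_lin : linear P.
  move=> a x y; apply/eqP; rewrite -subr_eq0; apply/eqP/dot_eq0.
  have Lz : L (P (a *: x + y) - (a *: P x + P y)) = 0.
    by rewrite linearB linearP !(PE _).1 scaler0 addr0 subrr.
  by rewrite {1}dotBl dotDl dotZl !P1 // dotDl dotZl subrr.
exists (linmap P_lin) => x.
by split; [exact: (PE x).1|exact: P1].
Qed.
End Projections.

(** * Enumerations of the four vertices and the moves of flags *)

Section Positions.

Lemma pos0E : pos0 = @Ordinal 4 0 isT. Proof. by apply: val_inj; rewrite /= inordK. Qed.
Lemma pos1E : pos1 = @Ordinal 4 1 isT. Proof. by apply: val_inj; rewrite /= inordK. Qed.
Lemma pos2E : pos2 = @Ordinal 4 2 isT. Proof. by apply: val_inj; rewrite /= inordK. Qed.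
Lemma pos3E : pos3 = @Ordinal 4 3 isT. Proof. by apply: val_inj; rewrite /= inordK. Qed.
Definition posE := (pos0E, pos1E, pos2E, pos3E).

Lemma posP (k : 'I_4) : [\/ k = pos0, k = pos1, k = pos2 | k = pos3].
Proof.
case: k => -[|[|[|[|//]]]] lt; rewrite !posE; [apply: Or41|apply: Or42|apply: Or43|apply: Or44];
exact: val_inj.
Qed.

Lemma perm4P (s t : 'S_4) : s pos0 = t pos0 -> s pos1 = t pos1 ->
  s pos2 = t pos2 -> s pos3 = t pos3 -> s = t.
Proof. by move=> e0 e1 e2 e3; apply/permP => k; case: (posP k) => ->. Qed.

Lemma pos_neq (s : 'S_4) :
  [/\ s pos0 != s pos1, s pos0 != s pos2, s pos0 != s pos3 &
   [/\ s pos1 != s pos2, s pos1 != s pos3 & s pos2 != s pos3]].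
Proof. by rewrite !(inj_eq perm_inj) !posE. Qed.

Lemma perm_surj4 (s : 'S_4) (i : 'I_4) :
  [\/ i = s pos0, i = s pos1, i = s pos2 | i = s pos3].
Proof.
by case: (posP (s^-1%g i)) => /(canRL (permKV s)) ->;
  [apply: Or41|apply: Or42|apply: Or43|apply: Or44].
Qed.

End Positions.

Section Flags.
Variable X : manifold.
Implicit Types (x y : flag X) (a b : tedge X).

(* (s 0, s 1, s 2, s 3) |-> (s 1, s 0, s 3, s 2); with [frot] it generates the
   action of the alternating group on the positive flags of a tetrahedron. *)
Definition fswap x : flag X := (x.1, (tperm pos0 pos1 * tperm pos2 pos3 * x.2)%g).

Lemma frotE x : [/\ (frot x).2 pos0 = x.2 pos0, (frot x).2 pos1 = x.2 pos2,
  (frot x).2 pos2 = x.2 pos3 & (frot x).2 pos3 = x.2 pos1].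
Proof. by rewrite /frot /= !permM !permE /= !posE /=. Qed.

Lemma fswapE x : [/\ (fswap x).2 pos0 = x.2 pos1, (fswap x).2 pos1 = x.2 pos0,
  (fswap x).2 pos2 = x.2 pos3 & (fswap x).2 pos3 = x.2 pos2].
Proof. by rewrite /fswap /= !permM !permE /= !posE /=. Qed.

Lemma frevE x : [/\ (frev x).2 pos0 = x.2 pos0, (frev x).2 pos1 = x.2 pos2,
  (frev x).2 pos2 = x.2 pos1 & (frev x).2 pos3 = x.2 pos3].
Proof. by rewrite /frev /= !permM !permE /= !posE /=. Qed.

Lemma fflipE x : [/\ (fflip x).2 pos0 = x.2 pos0, (fflip x).2 pos1 = x.2 pos1,
  (fflip x).2 pos2 = x.2 pos3 & (fflip x).2 pos3 = x.2 pos2].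
Proof. by rewrite /fflip /= !permM !permE /= !posE /=. Qed.

Lemma flagP x y : x.1 = y.1 -> x.2 pos0 = y.2 pos0 -> x.2 pos1 = y.2 pos1 ->
  x.2 pos2 = y.2 pos2 -> x.2 pos3 = y.2 pos3 -> x = y.
Proof.
by case: x y => [T s] [T' s'] /= -> e0 e1 e2 e3; congr (_, _); exact: perm4P.
Qed.

Lemma frot3 x : frot (frot (frot x)) = x.
Proof.
by apply: flagP => //; have [? ? ? ?] := frotE x;
  have [? ? ? ?] := frotE (frot x); have [? ? ? ?] := frotE (frot (frot x)); congruence.
Qed.

Lemma fswapK : involutive fswap.
Proof.
by move=> x; apply: flagP => //; have [? ? ? ?] := fswapE x;
  have [? ? ? ?] := fswapE (fswap x); congruence.
Qed.

Lemma frevK : involutive (@frev X).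
Proof.
by move=> x; apply: flagP => //; have [? ? ? ?] := frevE x;
  have [? ? ? ?] := frevE (frev x); congruence.
Qed.

Lemma fflipK : involutive (@fflip X).
Proof.
by move=> x; apply: flagP => //; have [? ? ? ?] := fflipE x;
  have [? ? ? ?] := fflipE (fflip x); congruence.
Qed.

Lemma frev_fflip x : fflip (frev x) = frot x.
Proof.
have [? ? ? ?] := frotE x; have [? ? ? ?] := frevE x.
by have [? ? ? ?] := fflipE (frev x); apply: flagP => //; congruence.
Qed.

Lemma frev_frot x : frev (frot x) = frot (frot (frev x)).
Proof.
have [? ? ? ?] := frotE x; have [? ? ? ?] := frevE (frot x).
have [? ? ? ?] := frevE x; have [? ? ? ?] := frotE (frev x).
by have [? ? ? ?] := frotE (frot (frev x)); apply: flagP => //; congruence.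
Qed.

Lemma pos_frot x : positive (frot x) = positive x.
Proof.
by rewrite /positive /= !odd_permM !odd_tperm !posE /=.
Qed.

Lemma pos_fswap x : positive (fswap x) = positive x.
Proof. by rewrite /positive /= !odd_permM !odd_tperm !posE /=. Qed.

Lemma pos_frev x : positive (frev x) = ~~ positive x.
Proof.
by rewrite /positive /= !odd_permM !odd_tperm !posE /=; case: odd_perm; case: neg.
Qed.

Lemma pos_fflip x : positive (fflip x) = ~~ positive x.
Proof.
by rewrite /positive /= !odd_permM !odd_tperm !posE /=; case: odd_perm; case: neg.
Qed.

Fact fedge_subproof x : #|[set x.2 pos0; x.2 pos1]%SET| == 2%N.
Proof. by rewrite cards2; have [-> _ _ _] := pos_neq x.2. Qed.

Definition fedge x : tedge X :=
  (x.1, Sub [set x.2 pos0; x.2 pos1]%SET (fedge_subproof x)).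

Lemma fedgeP x a : x.1 = a.1 -> val a.2 = [set x.2 pos0; x.2 pos1]%SET -> fedge x = a.
Proof.
case: a => T e /= <- xe; rewrite /fedge; congr (_, _).
by apply: val_inj; rewrite /= xe.
Qed.

Lemma fedge_swap x : fedge (fswap x) = fedge x.
Proof.
apply: fedgeP => //=; have [-> -> _ _] := fswapE x.
by rewrite finset.setUC.
Qed.

Lemma fedge_flip x : fedge (fflip x) = fedge x.
Proof. by apply: fedgeP => //=; have [-> -> _ _] := fflipE x. Qed.

(** Two transpositions bring the ends of the edge to the positions 0 and 1. Exchanging the positions
    2 and 3 places [i], and exchanging the ends repairs the sign. *)
Lemma fedge_exists a (i : 'I_4) : i \notin val a.2 ->
  exists x, [/\ positive x, fedge x = a & x.2 pos3 = i].
Proof.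
case: a => T [e e2] /= ie.
have /cards2P[u [v [uv eE]]] := e2.
have ui : u != i by apply: contraNneq ie => <-; rewrite eE !inE eqxx.
have vi : v != i by apply: contraNneq ie => <-; rewrite eE !inE eqxx orbT.
pose s1 : 'S_4 := tperm pos0 u.
pose s2 : 'S_4 := (tperm pos1 (s1^-1 v) * s1)%g.
have s20 : s2 pos0 = u.
  have v0 : (s1^-1)%g v != pos0 by rewrite (can2_eq (permKV s1) (permK s1)) tpermL eq_sym.
  have n10 : pos1 != pos0 by rewrite !posE.
  by rewrite permM (tpermD n10 v0) tpermL.
have s21 : s2 pos1 = v by rewrite permM tpermL permKV.
have [s3 [s30 s31 s33]] : exists s : 'S_4, [/\ s pos0 = u, s pos1 = v & s pos3 = i].
  have [i0|i1|i2|i3] := perm_surj4 s2 i.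
  - by rewrite i0 s20 eqxx in ui.
  - by rewrite i1 s21 eqxx in vi.
  - exists (fflip (T, s2)).2.
    by have [-> -> _ ->] := fflipE (T, s2); split.
  - by exists s2; split.
have edE (s : 'S_4) : s pos0 = u -> s pos1 = v -> fedge (T, s) = (T, exist _ e e2).
  by move=> su sv; apply: fedgeP => //=; rewrite su sv.
have [pos|npos] := boolP (positive (T, s3)); first by exists (T, s3); rewrite edE.
exists (T, tperm pos0 pos1 * s3)%g; split.
- by move: npos; rewrite /positive /= odd_permM odd_tperm !posE /=; case: odd_perm; case: neg.
- by apply: fedgeP => //=; rewrite !permM tpermL tpermR s30 s31 eE finset.setUC.
- by rewrite /= permM tpermD // !posE.
Qed.

Lemma fedge_surj a : exists2 x, positive x & fedge x = a.
Proof.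
have [i ia] : exists i, i \notin val a.2.
  apply/existsP; rewrite -negb_forall; apply/negP => /forallP aT.
  have := valP a.2; rewrite (_ : val a.2 = [set: 'I_4]%SET) ?cardsT ?card_ord //.
  by apply/setP => i; rewrite aT inE.
by have [x [xp xa _]] := fedge_exists ia; exists x.
Qed.

(** The edge fixes the first two vertices up to exchange, hence also the last two. Of the four
    combinations positivity keeps those with both exchanges or none. *)
Lemma fedge_inj x y : positive x -> positive y -> fedge x = fedge y ->
  y = x \/ y = fswap x.
Proof.
move=> xp yp [T01 E01].
have [n01 n02 n03 [n12 n13 n23]] := pos_neq x.2.
have [m01 m02 m03 [m12 m13 m23]] := pos_neq y.2.
have y0 : y.2 pos0 \in [set x.2 pos0; x.2 pos1]%SET by rewrite E01 !inE eqxx.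
have y1 : y.2 pos1 \in [set x.2 pos0; x.2 pos1]%SET by rewrite E01 !inE eqxx orbT.
have yx3 : y.2 pos2 != x.2 pos0 /\ y.2 pos2 != x.2 pos1.
  by split; apply: contraTneq isT => y2;
    [have : x.2 pos0 \in [set y.2 pos0; y.2 pos1]%SET by rewrite -E01 !inE eqxx
    |have : x.2 pos1 \in [set y.2 pos0; y.2 pos1]%SET by rewrite -E01 !inE eqxx orbT];
    rewrite -y2 !inE => /orP[]; rewrite eq_sym ?(negbTE m02) ?(negbTE m12).
have yx4 : y.2 pos3 != x.2 pos0 /\ y.2 pos3 != x.2 pos1.
  by split; apply: contraTneq isT => y2;
    [have : x.2 pos0 \in [set y.2 pos0; y.2 pos1]%SET by rewrite -E01 !inE eqxx
    |have : x.2 pos1 \in [set y.2 pos0; y.2 pos1]%SET by rewrite -E01 !inE eqxx orbT];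
    rewrite -y2 !inE => /orP[]; rewrite eq_sym ?(negbTE m03) ?(negbTE m13).
have y23 : (y.2 pos2 = x.2 pos2 /\ y.2 pos3 = x.2 pos3) \/
           (y.2 pos2 = x.2 pos3 /\ y.2 pos3 = x.2 pos2).
  have [h|h|h|h] := perm_surj4 x.2 (y.2 pos2); have [k|k|k|k] := perm_surj4 x.2 (y.2 pos3);
  move: yx3 yx4 m23; rewrite h k ?eqxx => -[] // _ _ [] // _ _ _; by [left|right].
have y01 : (y.2 pos0 = x.2 pos0 /\ y.2 pos1 = x.2 pos1) \/
           (y.2 pos0 = x.2 pos1 /\ y.2 pos1 = x.2 pos0).
  move: y0 y1 m01; rewrite !inE => /orP[]/eqP -> /orP[]/eqP ->; rewrite ?eqxx // => _; by [left|right].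
have [? ? ? ?] := fswapE x; have [? ? ? ?] := fflipE x; have [? ? ? ?] := fswapE (fflip x).
case: y01 => -[? ?]; case: y23 => -[? ?].
- by left; apply: flagP.
- have yE : y = fflip x by apply: flagP => //; congruence.
  by move: yp; rewrite yE pos_fflip xp.
- have yE : y = fswap (fflip x) by apply: flagP => //; congruence.
  by move: yp; rewrite yE pos_fswap pos_fflip xp.
- by right; apply: flagP => //; congruence.
Qed.

Lemma fswap_neq x : fswap x != x.
Proof.
apply/eqP => xx; have [_ + _ _] := fswapE x; rewrite xx.
by move/eqP; rewrite eq_sym; have [/negbTE -> _ _ _] := pos_neq x.2.
Qed.

Lemma sum_pos_bij (V : nmodType) (w : flag X -> flag X) (F : flag X -> V) :
    bijective w -> (forall x, positive (w x) = positive x) ->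
  \sum_(x | positive x) F (w x) = \sum_(x | positive x) F x.
Proof.
move=> wb wp; rewrite [RHS](reindex w); last exact: onW_bij.
by apply: eq_bigl => x; rewrite wp.
Qed.

Lemma frot_bij : bijective (@frot X).
Proof. by exists (fun x => frot (frot x)) => x; rewrite frot3. Qed.

Lemma sum_frot (V : nmodType) (F : flag X -> V) :
  \sum_(x | positive x) F (frot x) = \sum_(x | positive x) F x.
Proof. exact: (sum_pos_bij F frot_bij pos_frot). Qed.

Lemma sum_frot2 (V : nmodType) (F : flag X -> V) :
  \sum_(x | positive x) F (frot (frot x)) = \sum_(x | positive x) F x.
Proof. by rewrite (sum_frot (fun x => F (frot x))) sum_frot. Qed.

Lemma sum_fswap (V : nmodType) (F : flag X -> V) :
  \sum_(x | positive x) F (fswap x) = \sum_(x | positive x) F x.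
Proof. exact: (sum_pos_bij F (inv_bij fswapK) pos_fswap). Qed.

(** The factor 2 counts the positive flags [x] and [fswap x] on each edge. *)
Lemma sum_fedge (R : pzRingType) (F : tedge X -> R) :
  \sum_(x | positive x) F (fedge x) = 2%:R * \sum_a F a.
Proof.
rewrite (partition_big fedge predT) //= mulr_sumr; apply: eq_bigr => a _.
have [x xp <-] := fedge_surj a.
rewrite (bigD1 x) /= ?xp ?eqxx // (bigD1 (fswap x)) /=; last first.
  by rewrite pos_fswap xp fedge_swap eqxx fswap_neq.
rewrite big1 => [|y]; first by rewrite addr0 fedge_swap mulr_natl.
case/andP=> /andP[/andP[yp /eqP yx] ny ns].
by have [yE|yE] := fedge_inj xp yp (esym yx); [rewrite yE eqxx in ny|rewrite yE eqxx in ns].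
Qed.

End Flags.

(** * Functions on finite quotients *)

Section FiniteQuotient.
Variables (D : finType) (r : rel D).
Hypothesis r_sym : symmetric r.

Lemma fpi_eq x y : (fpi r x == fpi r y) = connect r x y.
Proof.
apply/eqP/idP => [E|xy].
  have : y \in val (fpi r y) by rewrite /= inE connect0.
  by rewrite -E /= inE.
apply: val_inj => /=; apply/setP => z; rewrite !inE.
exact: (same_connect (sym_connect_sym r_sym)).
Qed.

Lemma fpi_surj (q : fquot r) : exists x, fpi r x = q.
Proof.
have /existsP[x /eqP qx] := valP q; exists x; exact: val_inj.
Qed.

Lemma fquot_lift (V : Type) (f : D -> V) (f0 : V) :
    (forall x y, r x y -> f x = f y) ->
  exists g : {ffun fquot r -> V}, forall x, g (fpi r x) = f x.
Proof.
move=> fr; exists [ffun q : fquot r => if [pick x | fpi r x == q] is Some x then f x else f0] => x.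
rewrite ffunE; case: pickP => [y|/(_ x)]; last by rewrite eqxx.
rewrite fpi_eq => /connectP[p pp ->].
elim: p y pp => //= z p IH y /andP[yz pp]; by rewrite -(IH _ pp) (fr _ _ yz).
Qed.
End FiniteQuotient.

(** * Crossing a face *)

Section Gluing.
Variable X : manifold.
Implicit Types (x y z : flag X) (a b : tedge X).

(** The relation [glued] as a partial function: [lift_perm i j 1] extends the order-preserving map
    of the faces by sending the opposite vertex [i] to [j]. *)
Definition fglue x : option (flag X) :=
  if glue (x.1, x.2 pos3) is Some f
  then Some (f.1, (x.2 * lift_perm (x.2 pos3) f.2 1)%g) else None.

Lemma gluedE x y : glued x y = (fglue x == Some y).
Proof.
rewrite /glued /fglue; case: glue => [[T j]|] //=.
apply/andP/eqP => [[/eqP[-> ->] /forallP h]|[<- /=]].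
  congr Some; rewrite [RHS]surjective_pairing; congr (_, _).
  apply/permP => k; rewrite permM; have := h k.
  case: unliftP => [m ->|->]; rewrite ?lift_perm_lift ?lift_perm_id ?perm1;
    by case: unliftP => // [n -> /eqP[->]].
rewrite permM lift_perm_id; split => //; apply/forallP => k; rewrite permM.
by case: (unliftP (x.2 pos3) (x.2 k)) => [m ->|->];
  rewrite ?lift_perm_lift ?lift_perm_id ?perm1 ?liftK ?unlift_none.
Qed.

Lemma fglue_none x : (fglue x == None) = (glue (x.1, x.2 pos3) == None).
Proof. by rewrite /fglue; case: glue. Qed.

Lemma fglue_sym x y : fglue x = Some y -> fglue y = Some x.
Proof.
rewrite /fglue; case E: glue => [[T j]|//] [<-] /=.
rewrite permM lift_perm_id (glue_sym E) /=; congr Some.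
rewrite [RHS]surjective_pairing; congr (_, _).
by rewrite -mulgA lift_permM mul1g lift_perm1 mulg1.
Qed.

Lemma fglueM (t : 'S_4) x y : t pos3 = pos3 -> fglue x = Some y ->
  fglue (x.1, t * x.2)%g = Some (y.1, t * y.2)%g.
Proof.
move=> t3; rewrite /fglue /= permM t3; case: glue => [[T j]|//] [<-] /=.
by rewrite mulgA.
Qed.

(** The parity of [lift_perm i j 1] is that of i + j, which is what [glue_orient] compares with the
    signs of the two tetrahedra. *)
Lemma fglue_pos x y : fglue x = Some y -> positive y = ~~ positive x.
Proof.
rewrite /fglue /positive; case E: glue => [[T j]|//] [<-] /=.
have := glue_orient E; rewrite /= odd_permM odd_lift_perm odd_perm1.
by case: (odd_perm _); case: (neg _); case: (neg _); case: (odd _); case: (odd _).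
Qed.

Lemma fglue_frev x y : fglue x = Some y -> fglue (frev x) = Some (frev y).
Proof. by apply: fglueM; rewrite permE /= !posE. Qed.

(* The next positive flag across the face opposite to s 3: a positive side of a
   triangle of the link is sent to the same side, reversed, of the adjacent
   triangle.  Flags on unglued faces are fixed. *)
Definition fcross x : flag X := if fglue x is Some y then frev y else x.

Lemma fcrossK : involutive fcross.
Proof.
rewrite /fcross => x; case E: (fglue x) => [y|]; last by rewrite E.
by rewrite (fglue_frev (fglue_sym E)) frevK.
Qed.

Lemma pos_fcross x : positive (fcross x) = positive x.
Proof.
rewrite /fcross; case E: (fglue x) => [y|//].
by rewrite pos_frev (fglue_pos E) negbK.
Qed.

Lemma fglue_fcross x : (fglue (fcross x) == None) = (fglue x == None).
Proof.
rewrite /fcross; case E: (fglue x) => [y|]; last by rewrite E.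
by rewrite (fglue_frev (fglue_sym E)).
Qed.

Lemma sum_fcross (V : nmodType) (F : flag X -> V) :
  \sum_(x | positive x) F (fcross x) = \sum_(x | positive x) F x.
Proof. exact: (sum_pos_bij F (inv_bij fcrossK) pos_fcross). Qed.

(** Crossing permutes the positive flags, so such a sum equals its own negative. Cancellations
    across faces are applications of this. *)
Lemma sum_fcross_anti (R : numDomainType) (F : flag X -> R) :
    (forall x, positive x -> fglue x != None -> F (fcross x) = - F x) ->
    (forall x, positive x -> fglue x = None -> F x = 0) ->
  \sum_(x | positive x) F x = 0.
Proof.
move=> Fc F0; have : \sum_(x | positive x) F x = - \sum_(x | positive x) F x.
  rewrite -[LHS]sum_fcross -sumrN; apply: eq_bigr => x xp.
  have [xn|xn] := eqVneq (fglue x) None; last exact: Fc.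
  by rewrite /fcross xn F0 // oppr0.
by move/eqP; rewrite -addr_eq0 -mulr2n mulrn_eq0 /= => /eqP.
Qed.

(** (s 1, s 2, s 0, s 3): the rotation of the face opposite to [s 3]. It keeps that face and so is
    compatible with gluing, whereas [frot] moves to another face. *)
Definition fturn x : flag X := frot (frot (fswap x)).

Lemma fturnE x : [/\ (fturn x).2 pos0 = x.2 pos1, (fturn x).2 pos1 = x.2 pos2,
  (fturn x).2 pos2 = x.2 pos0 & (fturn x).2 pos3 = x.2 pos3].
Proof.
rewrite /fturn; have [? ? ? ?] := fswapE x; have [? ? ? ?] := frotE (fswap x).
by have [? ? ? ?] := frotE (frot (fswap x)); split; congruence.
Qed.

Lemma pos_fturn x : positive (fturn x) = positive x.
Proof. by rewrite /fturn !pos_frot pos_fswap. Qed.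

Lemma fturn3 x : fturn (fturn (fturn x)) = x.
Proof.
have [? ? ? ?] := fturnE x; have [? ? ? ?] := fturnE (fturn x).
by have [? ? ? ?] := fturnE (fturn (fturn x)); apply: flagP => //; congruence.
Qed.

Lemma fswap_frot x : fswap (frot x) = fturn (fturn x).
Proof.
have [? ? ? ?] := fturnE x; have [? ? ? ?] := fturnE (fturn x).
have [? ? ? ?] := fswapE (frot x).
by have [? ? ? ?] := frotE x; apply: flagP => //; congruence.
Qed.

Lemma fglue_fturn x y : fglue x = Some y -> fglue (fturn x) = Some (fturn y).
Proof.
rewrite /fturn /frot /fswap /= !mulgA; apply: fglueM.
by rewrite !permM !permE /= !posE.
Qed.

Lemma fglue_fturn_none x : (fglue (fturn x) == None) = (fglue x == None).
Proof. by rewrite !fglue_none; have [_ _ _ ->] := fturnE x. Qed.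

(** Crossing reverses the orientation of the face and so conjugates its rotation to the inverse. *)
Lemma fcross_fturn x : fglue x != None ->
  fcross (fturn x) = fturn (fturn (fcross x)).
Proof.
rewrite /fcross; case E: (fglue x) => [y|//] _; rewrite (fglue_fturn E).
have [? ? ? ?] := fturnE y; have [? ? ? ?] := frevE (fturn y).
have [? ? ? ?] := fturnE (fturn (frev y)).
have [? ? ? ?] := fturnE (frev y); have [? ? ? ?] := frevE y.
by apply: flagP => //; congruence.
Qed.

Lemma fedge_frev x : fedge (frev x) = fedge (frot x).
Proof. by rewrite -fedge_flip frev_fflip. Qed.

Lemma fglue_edge x y : fglue x = Some y -> fedge y = fedge (frot (fcross x)).
Proof. by rewrite /fcross => ->; rewrite -fedge_frev frevK. Qed.

Lemma tedge_gluedP a b :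
  reflect (exists x y, [/\ positive x, fglue x = Some y, fedge x = a & fedge y = b])
          (tedge_glued a b).
Proof.
apply: (iffP existsP) => [[i /existsP[j /existsP[g /and3P[/eqP ij /eqP ag /eqP bg]]]]|].
  have ia : i \notin val a.2.
    by rewrite ag; apply/imsetP => -[m _] /eqP; rewrite (negbTE (neq_lift _ _)).
  have [x [xp xa x3]] := fedge_exists ia.
  have xT : x.1 = a.1 by rewrite -xa.
  exists x, (b.1, (x.2 * lift_perm i j 1)%g); split => //.
    by rewrite /fglue xT x3 ij.
  apply: fedgeP => //=; rewrite bg !permM.
  have -> : [set lift_perm i j 1 (x.2 pos0); lift_perm i j 1 (x.2 pos1)]%SET =
     (lift_perm i j 1 @: [set x.2 pos0; x.2 pos1])%SET by rewrite imsetU1 imset_set1.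
  have -> : [set x.2 pos0; x.2 pos1]%SET = val a.2 by rewrite -xa.
  rewrite ag -imset_comp; apply: eq_imset => m /=.
  by rewrite lift_perm_lift perm1.
move=> [x [y [_ xy <- <-]]]; exists (x.2 pos3); apply/existsP; exists (y.2 pos3).
apply/existsP; exists [set m | lift (x.2 pos3) m \in [set x.2 pos0; x.2 pos1]]%SET.
have [n01 n02 n03 [n12 n13 n23]] := pos_neq x.2.
have := xy; rewrite /fglue; case E: glue => [[T j]|//] [yE]; rewrite -yE /=.
rewrite !permM lift_perm_id eqxx /=.
have img : (lift (x.2 pos3) @: [set m | lift (x.2 pos3) m \in [set x.2 pos0; x.2 pos1]])%SET
   = [set x.2 pos0; x.2 pos1]%SET.
  apply/setP => k; apply/imsetP/idP => [[m]|kx]; first by rewrite inE => ? ->.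
  case: (unliftP (x.2 pos3) k) => [m km|k3]; first by rewrite km in kx *; exists m; rewrite // inE.
  by move: kx; rewrite k3 !inE => /orP[] /eqP e; [move: n03|move: n13]; rewrite e eqxx.
rewrite img eqxx /=; apply/eqP.
have -> : [set lift_perm (x.2 pos3) j 1 (x.2 pos0); lift_perm (x.2 pos3) j 1 (x.2 pos1)]%SET =
     (lift_perm (x.2 pos3) j 1 @: [set x.2 pos0; x.2 pos1])%SET by rewrite imsetU1 imset_set1.
rewrite -[in LHS]img -imset_comp; apply: eq_imset => m /=.
by rewrite lift_perm_lift perm1.
Qed.

Lemma tedge_glued_sym : symmetric (@tedge_glued X).
Proof.
suff h a b : tedge_glued a b -> tedge_glued b a by move=> a b; apply/idP/idP => /h.
case/tedge_gluedP => x [y [xp xy <- <-]]; have yx := fglue_sym xy.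
have [yp|yp] := boolP (positive y); apply/tedge_gluedP; first by exists y, x.
(* Here [y] is negative. Exchanging the ends of its edge makes it positive and keeps the face
   opposite to [s 3]. *)
have t3 : tperm pos0 pos1 pos3 = pos3 by rewrite tpermD // !posE.
pose w z : flag X := (z.1, (tperm pos0 pos1 * z.2)%g).
have wedge z : fedge (w z) = fedge z.
  by apply: fedgeP => //=; rewrite !permM tpermL tpermR finset.setUC.
exists (w y), (w x); rewrite !wedge; split => //; last exact: (fglueM t3).
by move: yp; rewrite /w /positive /= odd_permM odd_tperm !posE /=; case: odd_perm; case: neg.
Qed.

(** The [frot] is there because crossing exchanges the positions of the edges {s 0, s 1} and {s 0, s
    2} of the face. *)
Lemma phi31_fcross x : fglue x != None ->
  phi31 (fedge x) = phi31 (fedge (frot (fcross x))).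
Proof.
case E: (fglue x) => [y|//] _; apply/eqP; rewrite fpi_eq; last exact: tedge_glued_sym.
rewrite -(fglue_edge E); apply: connect1.
have [xp|xp] := boolP (positive x); first by apply/tedge_gluedP; exists x, y.
rewrite tedge_glued_sym; apply/tedge_gluedP; exists y, x.
by rewrite (fglue_pos E) xp (fglue_sym E).
Qed.

End Gluing.

(** * Opposite edges and the cyclic order in terms of flags *)

Section FlagPositions.
Variable X : manifold.
Implicit Types (x y s : flag X) (a b : tedge X).

Lemma frot_p0 x : (frot x).2 pos0 = x.2 pos0. Proof. by have [] := frotE x. Qed.
Lemma frot_p1 x : (frot x).2 pos1 = x.2 pos2. Proof. by have [] := frotE x. Qed.
Lemma frot_p2 x : (frot x).2 pos2 = x.2 pos3. Proof. by have [] := frotE x. Qed.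
Lemma frot_p3 x : (frot x).2 pos3 = x.2 pos1. Proof. by have [] := frotE x. Qed.
Lemma fswap_p0 x : (fswap x).2 pos0 = x.2 pos1. Proof. by have [] := fswapE x. Qed.
Lemma fswap_p1 x : (fswap x).2 pos1 = x.2 pos0. Proof. by have [] := fswapE x. Qed.
Lemma fswap_p2 x : (fswap x).2 pos2 = x.2 pos3. Proof. by have [] := fswapE x. Qed.
Lemma fswap_p3 x : (fswap x).2 pos3 = x.2 pos2. Proof. by have [] := fswapE x. Qed.
Lemma fturn_p0 x : (fturn x).2 pos0 = x.2 pos1. Proof. by have [] := fturnE x. Qed.
Lemma fturn_p1 x : (fturn x).2 pos1 = x.2 pos2. Proof. by have [] := fturnE x. Qed.
Lemma fturn_p2 x : (fturn x).2 pos2 = x.2 pos0. Proof. by have [] := fturnE x. Qed.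
Lemma fturn_p3 x : (fturn x).2 pos3 = x.2 pos3. Proof. by have [] := fturnE x. Qed.
Definition flagE := (frot_p0, frot_p1, frot_p2, frot_p3, fswap_p0, fswap_p1,
  fswap_p2, fswap_p3, fturn_p0, fturn_p1, fturn_p2, fturn_p3).

Lemma fedge_eq x y : x.1 = y.1 ->
  (x.2 pos0 = y.2 pos0 /\ x.2 pos1 = y.2 pos1) \/
  (x.2 pos0 = y.2 pos1 /\ x.2 pos1 = y.2 pos0) -> fedge x = fedge y.
Proof.
by move=> e [] [e0 e1]; apply: fedgeP => //=; rewrite e0 e1 // finset.setUC.
Qed.

(* (s 2, s 3, s 0, s 1) *)
Definition fopp x : flag X := fturn (frot x).

Lemma pos_fopp x : positive (fopp x) = positive x.
Proof. by rewrite /fopp pos_fturn pos_frot. Qed.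

Local Ltac fedge_tac := apply: fedge_eq => //; rewrite /fopp !flagE; auto.

(* Normal forms of the edges {s i, s j}: for ij = 01, 02, 03, 12, 13, 23 they are
   the initial edges of s, frot s, frot (frot s), fturn s, frot (fswap s), fopp s. *)
Lemma fedge02 s : fedge (frot (fopp s)) = fedge (frot s).
Proof. by fedge_tac. Qed.
Lemma fedge12 s : fedge (frot (frot (fopp s))) = fedge (fturn s).
Proof. by fedge_tac. Qed.
Lemma fedge13 s : fedge (frot (fswap (fopp s))) = fedge (frot (fswap s)).
Proof. by fedge_tac. Qed.
Lemma fedge03 s : fedge (frot (frot (fswap (fopp s)))) = fedge (frot (frot s)).
Proof. by fedge_tac. Qed.
Lemma fedge12_frot s : fedge (frot (fswap (frot s))) = fedge (fturn s).
Proof. by fedge_tac. Qed.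
Lemma fedge23_frot s : fedge (fturn (frot s)) = fedge (fopp s).
Proof. by []. Qed.
Lemma fedge23_frot2 s : fedge (frot (fswap (frot (frot s)))) = fedge (fopp s).
Proof. by fedge_tac. Qed.
Lemma fedge13_frot2 s : fedge (fturn (frot (frot s))) = fedge (frot (fswap s)).
Proof. by fedge_tac. Qed.
Lemma fedge_fopp_frot s : fedge (fopp (frot s)) = fedge (frot (fswap s)).
Proof. by fedge_tac. Qed.
Lemma fedge_fopp_frot2 s : fedge (fopp (frot (frot s))) = fedge (fturn s).
Proof. by fedge_tac. Qed.
Lemma fedge_fopp_fopp s : fedge (fopp (fopp s)) = fedge s.
Proof. by fedge_tac. Qed.

Lemma opposite_fedge s a : opposite (fedge s) a = (a == fedge (fopp s)).
Proof.
have setE : (~: [set s.2 pos0; s.2 pos1] = [set s.2 pos2; s.2 pos3])%SET.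
  apply/setP => k; rewrite !inE negb_or.
  by case: (perm_surj4 s.2 k) => ->; rewrite !(inj_eq perm_inj) !posE.
apply/andP/eqP => [[/eqP sa /eqP ae]|->].
  by apply/esym/fedgeP; [exact: sa|rewrite ae setE /fopp !flagE].
split => //; rewrite -[val (fedge (fopp s)).2]/[set (fopp s).2 pos0; (fopp s).2 pos1]%SET.
by rewrite /fopp !flagE setE.
Qed.

Lemma opposite_sym : symmetric (@opposite X).
Proof.
move=> a b; rewrite /opposite eq_sym; congr andb; apply/eqP/eqP => ->; by rewrite finset.setCK.
Qed.

(** Passing to the opposite edge is an involution, so a path of the generating relation only meets
    an edge and its opposite. *)
Lemma quad_eq a b : (quad a == quad b) = (a == b) || opposite a b.
Proof.
rewrite fpi_eq; last exact: opposite_sym.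
apply/idP/idP => [/connectP[p pp ->]|/orP[/eqP ->|]]; [|exact: connect0|exact: connect1].
have [s _ sa] := fedge_surj a; rewrite -{}sa in pp *.
elim/last_ind: p pp => [|p c IH]; first by rewrite eqxx.
rewrite rcons_path last_rcons => /andP[/IH {}IH].
case/orP: IH => [/eqP <- ->|]; first by rewrite orbT.
rewrite opposite_fedge => /eqP ->.
by rewrite opposite_fedge fedge_fopp_fopp eq_sym => ->.
Qed.

Lemma quad_fedge s a :
  (quad (fedge s) == quad a) = (a == fedge s) || (a == fedge (fopp s)).
Proof. by rewrite quad_eq opposite_fedge eq_sym. Qed.

(** The cyclic order of the pairs of opposite edges is the same at all four vertices, so [cyc_next]
    can be evaluated at any positive flag on the pair. *)
Lemma quad_frot s t : positive s -> positive t ->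
  quad (fedge s) = quad (fedge t) -> quad (fedge (frot s)) = quad (fedge (frot t)).
Proof.
move=> sp tp /eqP; rewrite quad_fedge => /orP[]/eqP st; apply/eqP; rewrite quad_fedge.
  have [->|->] := fedge_inj sp tp (esym st); first by rewrite eqxx.
  by rewrite fedge_fopp_frot eqxx orbT.
have op : positive (fopp s) by rewrite pos_fopp.
have [->|->] := fedge_inj op tp (esym st); first by rewrite fedge02 eqxx.
by rewrite fedge13 fedge_fopp_frot eqxx orbT.
Qed.

Lemma cyc_next_fedge s t : positive s -> positive t ->
  cyc_next (quad (fedge s)) (quad (fedge t)) = (quad (fedge (frot s)) == quad (fedge t)).
Proof.
move=> sp tp; apply/existsP/eqP => [[x /andP[xp /existsP[c /existsP[d]]]]|st].
  case/and5P => + + /eqP cx /eqP dx /andP[/eqP ce /eqP de].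
  have -> : c = fedge x by apply/esym/fedgeP.
  have -> : d = fedge (frot x) by apply/esym/fedgeP; rewrite ?flagE.
  rewrite !inE -!fpi_eq; try exact: opposite_sym.
  by move=> /eqP sx /eqP tx; exact: (etrans (quad_frot sp xp sx) (esym tx)).
exists s; rewrite sp /=; apply/existsP; exists (fedge s); apply/existsP; exists (fedge (frot s)).
rewrite !inE connect0 /= -fpi_eq; last exact: opposite_sym.
by rewrite -[fpi _ (fedge (frot s))]/(quad _) st !eqxx !flagE eqxx.
Qed.

Lemma eps_fedge (R : pzRingType) s t : positive s -> positive t ->
  eps R (quad (fedge s)) (quad (fedge t)) =
  (quad (fedge (frot s)) == quad (fedge t))%:R -
  (quad (fedge (frot (frot s))) == quad (fedge t))%:R.
Proof.
move=> sp tp; rewrite /eps !cyc_next_fedge //; congr (_ - (nat_of_bool _)%:R).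
have rsp : positive (frot s) by rewrite pos_frot.
have rtp : positive (frot t) by rewrite pos_frot.
have rrsp : positive (frot (frot s)) by rewrite pos_frot.
have rrtp : positive (frot (frot t)) by rewrite pos_frot.
apply/eqP/eqP => [ts|st].
  by have := quad_frot rrtp rsp (quad_frot rtp sp ts); rewrite frot3.
by have := quad_frot rrsp tp st; rewrite frot3.
Qed.

End FlagPositions.

(** * The Neumann-Zagier form and the holonomies of link cocycles *)

Section EdgeForms.
Variables (R : realType) (X : manifold).
Local Notation A := {ffun tedge X -> R^o}.
Local Notation C1 := {ffun flag X -> R^o}.
Implicit Types (x y f : A) (a c k : C1) (s t u : flag X).

Definition tangent x : Prop := forall s, positive s ->
  x (fedge s) + x (fedge (frot s)) + x (fedge (frot (frot s))) = 0.

Definition epsop x : A := [ffun a => \sum_b eps R (quad a) (quad b) * x b].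

Fact epsop_is_linear : linear epsop.
Proof.
move=> k x y; apply/ffunP => a; rewrite !ffunE scaler_sumr -big_split /=.
apply: eq_bigr => b _; rewrite !ffunE mulrDr; congr (_ + _).
by rewrite /GRing.scale /= mulrCA.
Qed.
HB.instance Definition _ := GRing.isLinear.Build R A A _ epsop epsop_is_linear.

Lemma sum_quad x s : \sum_b (quad (fedge s) == quad b)%:R * x b =
  x (fedge s) + x (fedge (fopp s)).
Proof.
have ne : fedge (fopp s) != fedge s.
  apply/eqP => E; have : s.2 pos0 \in val (fedge (fopp s)).2 by rewrite E /= !inE eqxx.
  have [_ n02 n03 _] := pos_neq s.2.
  rewrite -[val _]/[set (fopp s).2 pos0; (fopp s).2 pos1]%SET /fopp !flagE.
  by rewrite !inE (negbTE n02) (negbTE n03).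
rewrite (bigD1 (fedge s)) //= (bigD1 (fedge (fopp s))) //= !quad_fedge !eqxx orbT !mul1r.
rewrite big1 ?addr0 // => b /andP[/negbTE b1 /negbTE b2].
by rewrite quad_fedge b1 b2 mul0r.
Qed.

(** With ij for the edge {s i, s j} the right side is x 02 + x 13 - x 03 - x 12: the two pairs
    cyclically adjacent to {01, 23}, with opposite signs. *)
Lemma epsopE x s : positive s -> epsop x (fedge s) =
  x (fedge (frot s)) + x (fedge (frot (fswap s))) -
  x (fedge (frot (frot s))) - x (fedge (fturn s)).
Proof.
move=> sp; rewrite ffunE.
transitivity (\sum_b ((quad (fedge (frot s)) == quad b)%:R -
   (quad (fedge (frot (frot s))) == quad b)%:R) * x b).
  apply: eq_bigr => b _; have [t tp <-] := fedge_surj b.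
  by rewrite eps_fedge.
under eq_bigr do rewrite mulrBl.
rewrite big_split /= sumrN !sum_quad fedge_fopp_frot fedge_fopp_frot2.
by rewrite opprD addrA.
Qed.

Lemma dot_fedge x y :
  2%:R * dot x y = \sum_(s | positive s) x (fedge s) * y (fedge s).
Proof. by rewrite (sum_fedge (fun b => x b * y b)). Qed.

(** The involution [fswap] matches the four terms of [epsopE] two by two, which absorbs the factor 2
    of [dot_fedge]. *)
Lemma dot_epsop x y : dot x (epsop y) = \sum_(s | positive s)
  (x (fedge s) * y (fedge (frot s)) - x (fedge (frot s)) * y (fedge s)).
Proof.
have two : (2%:R : R) != 0 by rewrite pnatr_eq0.
apply: (mulfI two); rewrite dot_fedge.
transitivity (\sum_(s | positive s) (
   x (fedge s) * y (fedge (frot s)) + x (fedge s) * y (fedge (frot (fswap s)))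
   - x (fedge s) * y (fedge (frot (frot s))) - x (fedge s) * y (fedge (fturn s)))).
  by apply: eq_bigr => s sp; rewrite epsopE // !mulrDr !mulrN.
rewrite !big_split /= !sumrN.
have -> : \sum_(s | positive s) x (fedge s) * y (fedge (frot (fswap s))) =
   \sum_(s | positive s) x (fedge s) * y (fedge (frot s)).
  rewrite -sum_fswap; apply: eq_bigr => s _; by rewrite fedge_swap fswapK.
have -> : \sum_(s | positive s) x (fedge s) * y (fedge (fturn s)) =
   \sum_(s | positive s) x (fedge s) * y (fedge (frot (frot s))).
  rewrite -sum_fswap; apply: eq_bigr => s _.
  by rewrite fedge_swap /fturn fswapK.
have -> : \sum_(s | positive s) x (fedge s) * y (fedge (frot (frot s))) =
   \sum_(s | positive s) x (fedge (frot s)) * y (fedge s).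
  by rewrite -sum_frot; apply: eq_bigr => s _; rewrite frot3.
by ring.
Qed.

Lemma dot_epsopC x y : dot (epsop x) y = - dot x (epsop y).
Proof.
rewrite dotC !dot_epsop -sumrN; apply: eq_bigr => s _; by ring.
Qed.

Lemma tangent_epsop x : tangent (epsop x).
Proof.
move=> s sp; rewrite !epsopE ?pos_frot // !frot3 fedge12_frot fedge23_frot.
by rewrite fedge23_frot2 fedge13_frot2; ring.
Qed.

(** The equations at the two ends of an edge minus those at the other two vertices leave twice the
    difference of the opposite edges. *)
Lemma tangent_fopp x : tangent x -> forall s, positive s ->
  x (fedge (fopp s)) = x (fedge s).
Proof.
move=> xt s sp; have := xt s sp; have := xt (fswap s); have := xt (fopp s).
have := xt (fswap (fopp s)); rewrite !pos_fswap !pos_fopp => /(_ sp) h1 /(_ sp) h2 /(_ sp) h3 h4.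
move: h1 h2 h3 h4; rewrite fedge02 fedge12 fedge13 fedge03 !fedge_swap.
rewrite -[frot (frot (fswap s))]/(fturn s); lra.
Qed.

Lemma tangent_epsopE x s : tangent x -> positive s ->
  epsop x (fedge s) = 2%:R * (x (fedge (frot s)) - x (fedge (frot (frot s)))).
Proof.
move=> xt sp; rewrite epsopE // -fedge_fopp_frot -fedge_fopp_frot2.
by rewrite !(tangent_fopp xt) ?pos_frot //; ring.
Qed.

(** By [tangent_epsopE] the operator is twice the difference r - r^-1 for the cyclic shift r. On
    triples of sum zero 1 + r + r^2 = 0, so this difference has square -3. *)
Lemma epsop_epsop x : tangent x -> epsop (epsop x) = - 12%:R *: x.
Proof.
move=> xt; apply/ffunP => a; have [s sp <-] := fedge_surj a; rewrite [RHS]ffunE.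
rewrite (tangent_epsopE (tangent_epsop x)) // !(tangent_epsopE xt) ?pos_frot // !frot3.
have := xt s sp => h; rewrite /GRing.scale /=; lra.
Qed.

(** The factor 3^-1 makes holonomies sums of signed angles: if [c] is 1, -1, 0 on [s], [frot s],
    [frot (frot s)] and [x] is tangent, the triangle contributes to [dot x (hop c)] exactly
    [x (fedge (frot s))], the angle of the corner cut off by a curve dual to [c]. *)
Definition hop c : A := [ffun b => 3%:R^-1 * \sum_(s | positive s)
  c s * ((fedge (frot s) == b)%:R - (fedge s == b)%:R)].

Fact hop_is_linear : linear hop.
Proof.
move=> k c d; apply/ffunP => a; rewrite !ffunE /GRing.scale /= mulrCA -mulrDr.
congr (_ * _); rewrite mulr_sumr -big_split /=.
by apply: eq_bigr => b _; rewrite !ffunE /GRing.scale /=; ring.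
Qed.
HB.instance Definition _ := GRing.isLinear.Build R C1 A _ hop hop_is_linear.

Lemma sum_pick (F : tedge X -> R) b : \sum_a F a * (b == a)%:R = F b.
Proof.
rewrite (bigD1 b) //= eqxx mulr1 big1 ?addr0 // => a ab.
by rewrite eq_sym (negbTE ab) mulr0.
Qed.

Lemma dot_hop x c : dot x (hop c) = 3%:R^-1 * \sum_(s | positive s)
  c s * (x (fedge (frot s)) - x (fedge s)).
Proof.
rewrite /dot.
transitivity (\sum_a \sum_(s | positive s) 3%:R^-1 *
   (c s * (x a * (fedge (frot s) == a)%:R - x a * (fedge s == a)%:R))).
  apply: eq_bigr => a _; rewrite ffunE mulrA mulr_sumr.
  by apply: eq_bigr => s _; ring.
rewrite exchange_big /= mulr_sumr; apply: eq_bigr => s _.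
by rewrite -!mulr_sumr sumrB !sum_pick.
Qed.

Lemma sum_fedge_pick c u : positive u ->
  \sum_(s | positive s) c s * (fedge s == fedge u)%:R = c u + c (fswap u).
Proof.
move=> up; rewrite (bigD1 u) //= eqxx mulr1 (bigD1 (fswap u)) /=; last first.
  by rewrite pos_fswap up fswap_neq.
rewrite fedge_swap eqxx mulr1 big1 ?addr0 // => s /andP[/andP[sp su] sw].
case: eqP => [us|_]; last by rewrite mulr0.
by have [E|E] := fedge_inj up sp (esym us); [rewrite E eqxx in su|rewrite E eqxx in sw].
Qed.

Lemma hopE c u : positive u -> hop c (fedge u) = 3%:R^-1 *
  (c (frot (frot u)) + c (fturn u) - c u - c (fswap u)).
Proof.
move=> up; rewrite ffunE; congr (_ * _).
under eq_bigr do rewrite mulrBr.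
rewrite sumrB sum_fedge_pick //.
have -> : \sum_(s | positive s) c s * (fedge (frot s) == fedge u)%:R =
   \sum_(s | positive s) [ffun s => c (frot (frot s))] s * (fedge s == fedge u)%:R.
  by rewrite -sum_frot2; apply: eq_bigr => s _; rewrite frot3 ffunE.
by rewrite sum_fedge_pick // !ffunE opprD addrA.
Qed.

(* Cocycles of the link, as functions on the positive flags only. *)
Definition pcocycle c : Prop :=
  (forall s, positive s -> fglue s != None -> c (fcross s) = - c s) /\
  (forall s, positive s -> c s + c (frot s) + c (frot (frot s)) = 0).

Definition prelative c : Prop := forall s, positive s -> fglue s = None -> c s = 0.

Definition pcup a c : R := 6%:R^-1 *
  \sum_(s | positive s) (a s * c (frot s) - a (frot s) * c s).

Lemma pcupE a c : pcup a c = 6%:R^-1 *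
  \sum_(s | positive s) a s * (c (frot s) - c (frot (frot s))).
Proof.
congr (_ * _); rewrite sumrB.
rewrite -[X in _ - X]sum_frot2 -sumrB; apply: eq_bigr => s _.
by rewrite !frot3; ring.
Qed.

Lemma pcupC a c : pcup a c = - pcup c a.
Proof. by rewrite /pcup -mulrN -sumrN; congr (_ * _); apply: eq_bigr => s _; ring. Qed.

(** The three sides of a triangle share the value of [F], so the cocycle relation factors out. This
    lets coefficients of [c] be changed by functions constant on link triangles. *)
Lemma sum_triangle c (F : flag X -> R) : pcocycle c ->
    (forall s, positive s -> F (frot s) = F s) ->
  \sum_(s | positive s) c s * F s = 0.
Proof.
move=> [_ c0] FF.
have three : (3%:R : R) != 0 by rewrite pnatr_eq0.
apply: (mulfI three); rewrite mulr0.
transitivity (\sum_(s | positive s) (c s + c (frot s) + c (frot (frot s))) * F s).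
  have E1 : \sum_(s | positive s) c (frot s) * F s = \sum_(s | positive s) c s * F s.
    rewrite -[RHS]sum_frot; apply: eq_bigr => s sp; by rewrite FF.
  have E2 : \sum_(s | positive s) c (frot (frot s)) * F s = \sum_(s | positive s) c s * F s.
    by rewrite -[RHS]sum_frot2; apply: eq_bigr => s sp; rewrite !FF ?pos_frot.
  under [RHS]eq_bigr do rewrite !mulrDl.
  by rewrite !big_split /= E1 E2; ring.
by rewrite big1 // => s sp; rewrite c0 // mul0r.
Qed.

Lemma dot_epsop_hop f c : pcocycle c -> dot (epsop f) (hop c) =
  \sum_(s | positive s) c s * (f (fedge (frot (frot s))) + f (fedge (fturn s))).
Proof.
move=> cc; rewrite dot_hop.
(* The sum over all six edges is constant on the triangle. Adding it changes nothing and completes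
   the coefficient of [c s] to 3 (f 03 + f 12). *)
pose S s := f (fedge s) + f (fedge (frot s)) + f (fedge (frot (frot s))) +
   f (fedge (fopp s)) + f (fedge (frot (fswap s))) + f (fedge (fturn s)).
have S0 : \sum_(s | positive s) c s * S s = 0.
  apply: sum_triangle => // s sp.
  by rewrite /S !frot3 fedge_fopp_frot fedge12_frot fedge23_frot; ring.
have three : (3%:R : R) != 0 by rewrite pnatr_eq0.
apply: (mulfI three); rewrite mulrA divff // mul1r.
rewrite -[LHS]addr0 -[X in _ + X]S0 -big_split mulr_sumr /=; apply: eq_bigr => s sp.
rewrite !epsopE ?pos_frot // !frot3 fedge12_frot fedge23_frot /S; ring.
Qed.

Definition glue_inv f : Prop := forall s, positive s -> fglue s != None ->
  f (fedge s) = f (fedge (frot (fcross s))).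

Definition vanish_bdry f : Prop := forall s, positive s -> fglue s = None ->
  f (fedge s) = 0.

Lemma glue_inv02 f s : glue_inv f -> positive s -> fglue s != None ->
  f (fedge (frot s)) = f (fedge (fcross s)).
Proof.
by move=> fi sp sg; rewrite [RHS]fi ?pos_fcross ?fglue_fcross // fcrossK.
Qed.

Lemma fedge_fturn2 s : fedge (fturn (fturn s)) = fedge (frot s).
Proof. by apply: fedge_eq => //; rewrite !flagE; auto. Qed.

Lemma glue_inv12 f s : glue_inv f -> positive s -> fglue s != None ->
  f (fedge (fturn s)) = f (fedge (fturn (fcross s))).
Proof.
move=> fi sp sg; rewrite fi ?pos_fturn ?fglue_fturn_none //.
rewrite fcross_fturn //; congr (f _).
by apply: fedge_eq => //; rewrite !flagE; auto.
Qed.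

Lemma vanish_bdry12 f s : vanish_bdry f -> positive s -> fglue s = None ->
  f (fedge (fturn s)) = 0.
Proof.
move=> fv sp sg; apply: fv; rewrite ?pos_fturn //; apply/eqP.
by rewrite fglue_fturn_none sg.
Qed.

Lemma vanish_bdry02 f s : vanish_bdry f -> positive s -> fglue s = None ->
  f (fedge (frot s)) = 0.
Proof.
move=> fv sp sg; rewrite -fedge_fturn2; apply: vanish_bdry12; rewrite ?pos_fturn //.
by apply/eqP; rewrite fglue_fturn_none sg.
Qed.

(* Every edge weight is a Casimir of the holonomies of the link. *)
Lemma dot_epsop_hop_glue f c : pcocycle c -> glue_inv f ->
  (prelative c \/ vanish_bdry f) -> dot (epsop f) (hop c) = 0.
Proof.
move=> cc fi cf; rewrite dot_epsop_hop //.
have [cg c0] := cc.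
have bd s (F : A -> flag X -> R) : positive s -> fglue s = None ->
    (vanish_bdry f -> F f s = 0) -> c s * F f s = 0.
  by move=> sp sg F0; case: cf => [cr|/F0 ->]; rewrite ?cr ?mul0r ?mulr0.
under eq_bigr do rewrite mulrDr.
rewrite big_split /= [X in _ + X]sum_fcross_anti ?addr0; first last.
- move=> s sp sg; apply: (bd s (fun f s => f (fedge (fturn s)))) => // fv.
  exact: vanish_bdry12.
- by move=> s sp sg; rewrite cg // mulNr -glue_inv12.
(* The edge 12 lies in the face opposite to [s 3], but 03 does not. The cocycle relation moves its
   term to the other two sides of the triangle, whose faces contain it. *)
transitivity (\sum_(s | positive s) - (c s * (f (fedge (frot s)) + f (fedge s)))).
  transitivity (\sum_(s | positive s) - (c (frot s) * f (fedge (frot (frot s))) +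
     c (frot (frot s)) * f (fedge (frot (frot s))))).
    by apply: eq_bigr => s sp; have := c0 s sp => h; rewrite -mulrDl -mulNr; congr (_ * _); lra.
  rewrite !sumrN !big_split /=; congr (- _).
  under [RHS]eq_bigr do rewrite mulrDr.
  rewrite big_split /=; congr (_ + _).
    by rewrite -[RHS]sum_frot.
  by rewrite -[RHS]sum_frot2.
apply: sum_fcross_anti => s sp sg.
  by rewrite cg // mulNr -glue_inv02 // -fi // addrC.
rewrite (bd s (fun f s => f (fedge (frot s)) + f (fedge s))) ?oppr0 // => fv.
by rewrite vanish_bdry02 // fv // addr0.
Qed.

(** Crossing exchanges the edges 01 and 02 of a face, so the antisymmetric summand of [dot_epsop]
    changes sign. This is the gauge invariance of the weights. *)
Lemma dot_epsop_glue f g : glue_inv f -> glue_inv g -> vanish_bdry g ->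
  dot f (epsop g) = 0.
Proof.
move=> fi gi gv; rewrite dot_epsop; apply: sum_fcross_anti => s sp sg.
  by rewrite -!glue_inv02 // -!fi // -gi // ; ring.
by rewrite (gv s) // (vanish_bdry02 gv) // !mulr0 subr0.
Qed.

(* The terms coming from different vertices of a tetrahedron cancel in pairs
   across the faces, so that only the cup product remains. *)
Lemma dot_epsop_hop_hop a c : pcocycle a -> pcocycle c ->
    prelative a \/ prelative c ->
  dot (epsop (hop a)) (hop c) = - 2%:R * pcup a c.
Proof.
move=> ac cc rel; rewrite dot_epsopC dotC mulNr; congr (- _).
rewrite dot_epsop_hop // pcupE.
have [ag a0] := ac; have [cg c0] := cc.
(* The arguments of [c] are the sides of the face of [s] at its two other vertices. Crossing the
   face exchanges them and changes the sign of both [a] and [c]. *)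
have face : \sum_(s | positive s) a s * c (fturn (fturn s)) =
    \sum_(s | positive s) a s * c (fturn s).
  apply/eqP; rewrite -subr_eq0 -sumrB; apply/eqP.
  apply: sum_fcross_anti => s sp sg; last first.
    have /eqP sg1 : fglue (fturn s) == None by rewrite fglue_fturn_none sg.
    have /eqP sg2 : fglue (fturn (fturn s)) == None by rewrite !fglue_fturn_none sg.
    case: rel => [ar|cr]; first by rewrite ar // !mul0r subrr.
    by rewrite !cr ?pos_fturn // !mulr0 subrr.
  rewrite ag // -fcross_fturn // cg ?pos_fturn ?fglue_fturn_none //.
  have E : fturn (fcross s) = fcross (fturn (fturn s)).
    by rewrite fcross_fturn ?fglue_fturn_none // fcross_fturn // fturn3.
  by rewrite E cg ?pos_fturn ?fglue_fturn_none //; ring.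
have three : (3%:R : R) != 0 by rewrite pnatr_eq0.
(* [D] keeps the sides of the link triangle of [s] and gives the cup product. [K] collects the sides
   at the other vertices of the tetrahedron and has to sum to zero. *)
pose D s : R := c (frot s) - c (frot (frot s)).
pose K s : R := c (fswap (frot (fswap s))) - c (fswap (frot (frot s))) +
   c (frot (fswap s)) + c (fturn (fturn s)) - c (fturn s) - c (frot (fswap (frot s))).
transitivity (3%:R^-1 * \sum_(s | positive s) a s * (D s + K s)).
  rewrite mulr_sumr; apply: eq_bigr => s sp.
  rewrite !hopE ?pos_frot ?pos_fswap // !frot3 /D /K.
  have -> : fturn (frot (frot s)) = fswap (frot (fswap s)).
    by apply: flagP => //; rewrite !flagE.
  have -> : fswap (fturn s) = frot (fswap (frot s)).
    by apply: flagP => //; rewrite !flagE.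
  by ring.
under eq_bigr do rewrite mulrDr.
rewrite big_split /= -/D.
have -> : \sum_(s | positive s) a s * K s = 0; last first.
  by rewrite addr0 mulrA; congr (_ * _); field.
(* Rotations of [s] and both cocycle relations leave only products of two sides in a common face,
   which [face] cancels. *)
transitivity (\sum_(s | positive s) 3%:R * (a (frot (frot s)) * c (fswap s) - a s * c (fturn s))).
  transitivity (\sum_(s | positive s) (a (frot s) * c (fturn s) - a (frot s) * c (fswap s)
     + a s * c (frot (fswap s)) + a (frot (frot s)) * c (fswap s) - a s * c (fturn s)
     - a (frot (frot s)) * c (frot (fswap s)))).
    under eq_bigr do rewrite /K !mulrDr !mulrN.
    rewrite !big_split /= !sumrN.
    rewrite -[X in X - _ + _ + _ - _ - _]sum_frot.
    rewrite -[X in _ - X + _ + _ - _ - _]sum_frot.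
    rewrite -[X in _ - _ + _ + X - _ - _]sum_frot2.
    rewrite -[X in _ - _ + _ + _ - _ - X]sum_frot2.
    congr (_ - _ + _ + _ - _ - _); apply: eq_bigr => s _.
    - by congr (_ * c _); apply: flagP => //; rewrite !flagE.
    - by congr (_ * c _); apply: flagP => //; rewrite !flagE.
    - by congr (_ * c _); apply: flagP => //; rewrite !flagE.
    - by congr (_ * c _); apply: flagP => //; rewrite !flagE.
  apply: eq_bigr => s sp; have := a0 s sp => h1.
  have := c0 (fswap s); rewrite pos_fswap -/(fturn s) => /(_ sp) h2.
  have -> : a (frot s) = - a s - a (frot (frot s)) by lra.
  have -> : c (frot (fswap s)) = - c (fswap s) - c (fturn s) by lra.
  by ring.
rewrite -mulr_sumr sumrB -face.
rewrite -[X in _ - X]sum_frot2 -sumrB big1 ?mulr0 // => s _; apply/eqP; rewrite subr_eq0; apply/eqP.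
by congr (_ * c _); apply: flagP => //; rewrite !flagE.
Qed.

End EdgeForms.

(** * Poincare-Lefschetz duality on the link and trivial holonomy *)

Section Duality.
Variables (R : realType) (X : manifold).
Local Notation A := {ffun tedge X -> R^o}.
Local Notation C1 := {ffun flag X -> R^o}.
Implicit Types (x f : A) (c k : C1) (s u y : flag X).

Lemma pcocycle_val (c : Z1 R X) : pcocycle (val c).
Proof.
have /andP[/andP[/'forall_'forall_implyP cg /forallP cr] /forallP ct] := valP c.
split=> s sp; last exact/eqP.
rewrite /fcross; case E: (fglue s) => [y|//] _; rewrite (eqP (cr _)).
by congr (- _); apply/esym/eqP/cg; rewrite gluedE E.
Qed.

Lemma prelative_val (c : Z1 R X) : prelative (val c) <-> is_relative c.
Proof.
have /andP[/andP[_ /forallP cr] _] := valP c.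
split=> [h s sg|h s _ sg]; last by apply: h; apply/eqP; rewrite -fglue_none sg.
have [sp|sp] := boolP (positive s); first by apply: h => //; apply/eqP; rewrite fglue_none sg.
have /eqP -> : val c s == - val c (frev s) by rewrite (eqP (cr s)) opprK.
rewrite h ?oppr0 ?pos_frev //; apply/eqP.
by rewrite fglue_none; have [_ _ _ ->] := frevE s; rewrite sg.
Qed.

(** Exactly one of [s] and [frev s] is positive, so antisymmetry under reversal dictates the
    extension. *)
Lemma pcocycle_ext c : pcocycle c ->
  exists c' : Z1 R X, forall s, positive s -> val c' s = c s.
Proof.
move=> [cg c0].
pose d : C1 := [ffun s => if positive s then c s else - c (frev s)].
have dr s : d (frev s) = - d s.
  rewrite !ffunE pos_frev frevK; case: ifP => [/negbTE -> |/negbFE ->] //.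
  by rewrite opprK.
have dp s : positive s -> d s = c s by move=> sp; rewrite ffunE sp.
have dg s y : positive s -> fglue s = Some y -> d s = d y.
  move=> sp sy; have := cg s sp; rewrite /fcross sy => /(_ isT) E.
  have yp : positive (frev y) by rewrite pos_frev (fglue_pos sy) sp.
  by rewrite dp // -[c s]opprK -E -dp // dr opprK.
have dc : is_cocycle1 d.
  apply/andP; split; first (apply/andP; split).
  - apply/'forall_'forall_implyP => s y; rewrite gluedE => /eqP sy; apply/eqP.
    have [sp|sp] := boolP (positive s); first exact: dg.
    by apply/esym/dg; [rewrite (fglue_pos sy) sp|exact: fglue_sym].
  - by apply/forallP => s; rewrite dr.
  - apply/forallP => s; apply/eqP; have [sp|sp] := boolP (positive s).
      by rewrite !dp ?pos_frot //; exact: c0.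
    have rp : positive (frev s) by rewrite pos_frev.
    have E u : d u = - d (frev u) by rewrite dr opprK.
    rewrite E [d (frot s)]E [d (frot (frot s))]E !frev_frot.
    rewrite frot3 !dp ?pos_frot // -[RHS]oppr0 -(c0 (frev s)) //.
    by rewrite !opprD addrAC.
by exists (exist _ d dc) => s sp /=; exact: dp.
Qed.

(* Fredholm alternative for the cocycle equations; [t] collects the multipliers
   of the triangle equations. *)
Lemma cocycle_annihilator (rel : bool) k :
    (forall c, pcocycle c -> (rel -> prelative c) ->
      \sum_(s | positive s) k s * c s = 0) ->
  exists t : flag X -> R, [/\ forall s, positive s -> t (frot s) = t s,
    forall s, positive s -> fglue s != None ->
      k (fcross s) - t (fcross s) = k s - t s &
    ~~ rel -> forall s, positive s -> fglue s = None -> k s = t s].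
Proof.
move=> kc.
(* One family of equations for the gluings, one for the triangles, and one for the unglued sides
   when [rel] holds. *)
pose J : finType := (flag X + (flag X + flag X))%type.
pose L c : {ffun J -> R^o} := [ffun j : J => match j with
  | inl s => if positive s then (if fglue s != None then c s + c (fcross s) else 0) else 0
  | inr (inl s) => if positive s then c s + c (frot s) + c (frot (frot s)) else 0
  | inr (inr s) => if positive s then (if rel && (fglue s == None) then c s else 0) else 0
  end].
have L_lin : linear L.
  move=> b c d; apply/ffunP => -[s|[s|s]]; rewrite !ffunE /GRing.scale /=;
    do ?case: ifP => _; ring.
pose LL := linmap L_lin.
pose L' (t : {ffun J -> R^o}) : C1 := [ffun s => if positive s then
  (if fglue s != None then t (inl s) + t (inl (fcross s)) else 0) +
  (t (inr (inl s)) + t (inr (inl (frot s))) + t (inr (inl (frot (frot s))))) +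
  (if rel && (fglue s == None) then t (inr (inr s)) else 0) else 0].
have LL' c t : dot t (LL c) = dot (L' t) c.
  rewrite /dot !big_sumType /=.
  have msum (F G : flag X -> R) : (forall s, positive s -> F s = G s) ->
     (forall s, ~~ positive s -> F s = 0) -> \sum_s F s = \sum_(s | positive s) G s.
    move=> FG F0; rewrite [RHS]big_mkcond; apply: eq_bigr => s _.
    by case: ifPn => sp; [exact: FG|exact: F0].
  rewrite (msum _ (fun s => t (inl s) * (if fglue s != None then c s + c (fcross s) else 0)));
    [|by move=> s sp; rewrite ffunE sp|by move=> s /negbTE sp; rewrite ffunE sp mulr0].
  rewrite (msum _ (fun s => t (inr (inl s)) * (c s + c (frot s) + c (frot (frot s)))));
    [|by move=> s sp; rewrite ffunE sp|by move=> s /negbTE sp; rewrite ffunE sp mulr0].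
  rewrite (msum _ (fun s => t (inr (inr s)) * (if rel && (fglue s == None) then c s else 0)));
    [|by move=> s sp; rewrite ffunE sp|by move=> s /negbTE sp; rewrite ffunE sp mulr0].
  rewrite (msum _ (fun s => (if fglue s != None then t (inl s) * c s + t (inl (fcross s)) * c s else 0) +
    ((t (inr (inl s)) * c s + t (inr (inl (frot s))) * c s + t (inr (inl (frot (frot s)))) * c s) +
  t (inr (inr s)) * (if rel && (fglue s == None) then c s else 0))));
    [|move=> s sp; rewrite ffunE sp; do 2!case: ifP => _; ring
    |by move=> s /negbTE sp; rewrite ffunE sp mul0r].
  rewrite !big_split /=; congr (_ + (_ + _)).
    have E : \sum_(s | positive s) (if fglue s != None then t (inl (fcross s)) * c s else 0) =
      \sum_(s | positive s) (if fglue s != None then t (inl s) * c (fcross s) else 0).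
      rewrite -[RHS]sum_fcross; apply: eq_bigr => s _.
      by rewrite fglue_fcross fcrossK.
    transitivity (\sum_(s | positive s) (if fglue s != None then t (inl s) * c s else 0) +
      \sum_(s | positive s) (if fglue s != None then t (inl s) * c (fcross s) else 0)).
      by rewrite -big_split /=; apply: eq_bigr => s _; case: ifP => _; ring.
    by rewrite -E -big_split /=; apply: eq_bigr => s _; case: ifP => _; ring.
  under eq_bigr do rewrite !mulrDr.
  rewrite !big_split /= -!addrA; congr (_ + _); rewrite addrC; congr (_ + _).
    by rewrite -[LHS]sum_frot; apply: eq_bigr => s _; rewrite frot3.
  by rewrite -[LHS]sum_frot2; apply: eq_bigr => s _; rewrite frot3.
have [t tE] : exists t, L' t = [ffun s => if positive s then k s else 0].
  apply: (fredholm LL') => c Lc; rewrite -[RHS](kc c).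
  - rewrite /dot [RHS]big_mkcond; apply: eq_bigr => s _; rewrite ffunE.
    by case: ifP; rewrite ?mul0r.
  - split=> s sp.
      move=> sg; have /ffunP/(_ (inl s)) := Lc; rewrite !ffunE sp sg => /eqP.
      by rewrite addrC addr_eq0 => /eqP.
    by have /ffunP/(_ (inr (inl s))) := Lc; rewrite !ffunE sp.
  - move=> r s sp sg; have /ffunP/(_ (inr (inr s))) := Lc.
    by rewrite !ffunE sp sg r eqxx.
(* Each triangle equation is listed at its three flags. Adding the three multipliers gives a
   function constant on the triangle. *)
pose t1 s : R := t (inr (inl s)).
exists (fun s => t1 s + t1 (frot s) + t1 (frot (frot s))).
have kE s : positive s -> k s = L' t s by move=> sp; rewrite tE ffunE sp.
split=> [s sp|s sp sg|r s sp sg]; first by rewrite frot3 /t1; ring.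
  rewrite !kE ?pos_fcross // !ffunE pos_fcross sp fglue_fcross sg fcrossK.
  by rewrite (negbTE sg) andbF /t1; ring.
by rewrite kE // ffunE sp sg eqxx (negbTE r) /= /t1; ring.
Qed.

Lemma pcocycle_ext_rel c : pcocycle c -> prelative c ->
  exists c' : Z1 R X, is_relative c' /\ forall s, positive s -> val c' s = c s.
Proof.
move=> cc cr; have [c' c'E] := pcocycle_ext cc; exists c'; split => //.
by apply/prelative_val => s sp sg; rewrite c'E // cr.
Qed.

Lemma eq_pcup (a a' c c' : C1) : (forall s, positive s -> a s = a' s) ->
  (forall s, positive s -> c s = c' s) -> pcup a c = pcup a' c'.
Proof.
by move=> aa cc; congr (_ * _); apply: eq_bigr => s sp; rewrite !aa ?cc ?pos_frot.
Qed.

(** The primitive of a cocycle on a single triangle, normalized to have sum zero over the three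
    corners. *)
Definition pot (a : C1) s : R := 3%:R^-1 * (a (frot (frot s)) - a s).

Lemma potB (a : C1) s : pcocycle a -> positive s -> pot a (frot s) - pot a s = a s.
Proof.
move=> [_ a0] sp; have := a0 s sp => h; rewrite /pot frot3; lra.
Qed.

(** [frot (fcross s)] is the next positive flag around the 0-cell of the link where [s] starts, so
    invariance under it is constancy on 0-cells. *)
Lemma same_source_inv (V : Type) (f : flag X -> V) :
    (forall s, positive s -> fglue s != None -> f s = f (frot (fcross s))) ->
  exists F : flag X -> V, [/\ forall s, positive s -> F s = f s,
     forall s, F (fflip s) = F s & forall s u, same_source s u -> F s = F u].
Proof.
move=> fi; pose F s := if positive s then f s else f (fflip s).
have Fp s : positive s -> F s = f s by rewrite /F => ->.
have Ff s : F (fflip s) = F s.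
  by rewrite /F pos_fflip fflipK; case: (positive s).
have Fg s y : positive s -> fglue s = Some y -> F s = F y.
  move=> sp sy; rewrite Fp // fi ?sy // /fcross sy.
  by rewrite -frev_fflip frevK -Ff Fp // pos_fflip (fglue_pos sy) sp.
exists F; split => // s u /connectP[p pp ->].
elim: p s pp => //= y p IH s /andP[sy pp]; rewrite -(IH _ pp).
case/orP: sy => [|/eqP ->]; last by rewrite Ff.
rewrite gluedE => /eqP sy; have [sp|sp] := boolP (positive s); first exact: Fg.
by apply/esym/Fg; [rewrite (fglue_pos sy) sp|exact: fglue_sym].
Qed.

Lemma is_coboundaryP (c : Z1 R X) : c \in B1 R X <->
  exists f : flag X -> R, (forall s, positive s -> val c s = f (frot s) - f s) /\
   forall s, positive s -> fglue s != None -> f s = f (frot (fcross s)).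
Proof.
split.
  move=> /asboolP[f /'forall_'forall_implyP f0 fc]; exists f.
  have ff s y : same_source s y -> f s = f y by move=> sy; apply/eqP/f0.
  have flip s : f (fflip s) = f s.
    by apply/esym/ff/connect1; rewrite eqxx orbT.
  split=> s sp; first by rewrite fc -flip frev_fflip.
  rewrite /fcross; case E: (fglue s) => [y|//] _.
  rewrite -frev_fflip frevK flip; apply/ff/connect1.
  by rewrite gluedE E eqxx.
move=> [f [fc fi]]; have [F [Fp Ff Fs]] := same_source_inv fi.
apply/asboolP; exists [ffun s => F s].
  by apply/'forall_'forall_implyP => s y sy; rewrite !ffunE (Fs _ _ sy).
have /andP[/andP[_ /forallP cr] _] := valP c.
have h s : positive s -> val c s = F (frev s) - F s.
  by move=> sp; rewrite fc // -!Fp ?pos_frot // -frev_fflip Ff.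
move=> s; rewrite !ffunE; have [sp|sp] := boolP (positive s); first exact: h.
have /eqP -> : val c s == - val c (frev s) by rewrite (eqP (cr s)) opprK.
by rewrite h ?pos_frev // frevK opprB.
Qed.

(** The injective half of duality. The multipliers [t] from [cocycle_annihilator] are the
    integration constants with which the primitives on single triangles fit together along glued
    sides. *)
Lemma pcup_coboundary (a : Z1 R X) :
    (forall c : Z1 R X, is_relative c -> cup_integral a c = 0) -> a \in B1 R X.
Proof.
move=> ac; have aa := pcocycle_val a; have [ag a0] := aa.
pose k : C1 := [ffun s => val a (frot (frot s)) - val a (frot s)].
have [|t [tr tg _]] := @cocycle_annihilator true k.
  move=> c cc /(_ isT) cr; have [c' [c'r c'E]] := pcocycle_ext_rel cc cr.
  have six : (6%:R^-1 : R) != 0 by rewrite invr_eq0 pnatr_eq0.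
  apply: (mulfI six); rewrite mulr0 -[RHS](ac c') // -[RHS]/(pcup (val a) (val c')).
  rewrite (eq_pcup (fun s _ => erefl) c'E) /pcup; congr (_ * _).
  rewrite sumrB -[X in _ = X - _]sum_frot2 -sumrB; apply: eq_bigr => s sp.
  by rewrite ffunE frot3; ring.
apply/is_coboundaryP.
(* By the triangle relation [pot] is k / 6 minus half of [a]. The antisymmetry of [a] across a face
   takes care of the second term, and t / 6 corrects the first. *)
exists (fun s => pot (val a) s - 6%:R^-1 * t s); split=> s sp.
  by rewrite tr // -[LHS](potB aa sp); ring.
move=> sg; have := tg s sp sg; rewrite !ffunE.
have up : positive (fcross s) by rewrite pos_fcross.
have := ag s sp sg; have := a0 s sp; have := a0 _ up; rewrite tr ?pos_fcross // /pot frot3.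
lra.
Qed.

Lemma glue_inv_phi31 (g : cell1 X -> R) : glue_inv [ffun a => g (phi31 a) : R^o].
Proof. by move=> s sp sg; rewrite !ffunE (phi31_fcross sg). Qed.

Lemma glue_inv_cell1 f : glue_inv f ->
  exists g : {ffun cell1 X -> R^o}, forall a, g (phi31 a) = f a.
Proof.
move=> fi; apply: (fquot_lift (@tedge_glued_sym X) (0 : R^o)) => a b.
case/tedge_gluedP => s [y [sp sy <- <-]].
by rewrite fi // ?sy // (fglue_edge sy).
Qed.

Lemma based_vanish (g : {ffun cell1 X -> R}) : based g ->
  vanish_bdry [ffun a => g (phi31 a) : R^o].
Proof.
move=> gb s sp sg; rewrite ffunE; apply: gb; exists (fedge s), (s.2 pos3); split => //.
  by apply/eqP; rewrite -fglue_none sg.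
have [n01 n02 n03 [n12 n13 n23]] := pos_neq s.2.
by rewrite !inE negb_or eq_sym n03 eq_sym n13.
Qed.

Lemma vanish_based (g : {ffun cell1 X -> R}) f : (forall a, g (phi31 a) = f a) ->
  vanish_bdry f -> based g.
Proof.
move=> gf fv e [a [i [<- ag ia]]]; have [s [sp sa s3]] := fedge_exists ia.
rewrite gf -sa; apply: fv => //; apply/eqP; rewrite fglue_none s3.
by rewrite (_ : s.1 = a.1) ?ag // -sa.
Qed.

(* The angles are the differences of a function on the sides of the link, whose
   sum over the two ends of an edge in a face only depends on the edge. *)
Lemma trivial_holonomy (rel : bool) x : tangent x ->
    (forall c : Z1 R X, (rel -> is_relative c) -> dot x (hop (val c)) = 0) ->
  exists g : {ffun cell1 X -> R}, (~~ rel -> based g) /\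
    x = epsop [ffun a => g (phi31 a)].
Proof.
move=> xt xc; pose k : C1 := [ffun s => 3%:R^-1 * (x (fedge (frot s)) - x (fedge s))].
have [|t [tr tg tb]] := @cocycle_annihilator rel k.
  move=> c cc cr.
  have [c' [c'r c'E]] : exists c' : Z1 R X, (rel -> is_relative c') /\
      forall s, positive s -> val c' s = c s.
    case: rel cr {xc} => cr; last by have [c'] := pcocycle_ext cc; exists c'.
    by have [c' [? ?]] := pcocycle_ext_rel cc (cr isT); exists c'.
  rewrite -[RHS](xc c') // dot_hop mulr_sumr; apply: eq_bigr => s sp.
  by rewrite c'E // ffunE; ring.
pose h s : R := k s - t s.
have hr s : positive s -> h (frot s) - h s = - x (fedge (frot s)).
  move=> sp; have := xt s sp; rewrite /h tr // !ffunE; lra.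
have hg s : positive s -> fglue s != None -> h (fcross s) = h s by exact: tg.
(* [s] and [fturn s] are the sides of one face at the two ends of the edge {s 0, s 1}. The other
   face of the tetrahedron at this edge has the same sum, because by [hr] the angle of the edge is
   added at one end and subtracted at the other. *)
pose Y s : R := h s + h (fturn s).
have Yswap s : positive s -> Y (fswap s) = Y s.
  move=> sp; rewrite /Y.
  have -> : fturn (fswap s) = frot (frot s) by rewrite /fturn fswapK.
  have := hr (frot (frot s)); rewrite !pos_frot frot3 => /(_ sp) h1.
  have := hr (fturn s); rewrite !pos_fturn {2 3}/fturn frot3 fedge_swap => /(_ sp) h2.
  lra.
pose w : A := [ffun a => if [pick s | positive s && (fedge s == a)] is Some s then Y s else 0].
have wE s : positive s -> w (fedge s) = Y s.
  move=> sp; rewrite ffunE; case: pickP => [u /andP[up /eqP us]|/(_ s)]; last by rewrite sp eqxx.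
  by have [->|->] := fedge_inj sp up (esym us); rewrite ?Yswap.
have wi : glue_inv w.
  move=> s sp sg; rewrite wE // -fedge_fturn2 wE ?pos_fturn ?pos_fcross // /Y fturn3.
  rewrite addrC hg // -[in LHS]hg ?pos_fturn ?fglue_fturn_none //.
  by rewrite fcross_fturn.
have xE : x = epsop (- 2%:R^-1 *: w).
  apply/ffunP => a; have [s sp <-] := fedge_surj a.
  rewrite linearZ ffunE epsopE // -[fedge (frot s)]fedge_fturn2.
  have -> : fedge (frot (fswap s)) = fedge (fturn (frot (frot s))).
    by rewrite fedge13_frot2.
  rewrite !wE ?pos_fturn ?pos_frot // /Y fturn3.
  have -> : fturn (fturn (frot (frot s))) = fswap s.
    by apply: flagP => //; rewrite !flagE.
  have := hr (frot (frot s)); rewrite !pos_frot frot3 => /(_ sp) h1.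
  have := hr (fturn s); rewrite !pos_fturn {1 3}/fturn frot3 fedge_swap => /(_ sp) h2.
  rewrite /GRing.scale /=; lra.
have [g gE] : exists g : {ffun cell1 X -> R^o}, forall a, g (phi31 a) = (- 2%:R^-1 *: w) a.
  apply: glue_inv_cell1 => s sp sg; rewrite [LHS]ffunE [RHS]ffunE; congr (_ *: _).
  exact: wi.
exists g; split => [nrel|]; last by rewrite xE; congr epsop; apply/ffunP => a; rewrite [RHS]ffunE gE.
apply: (vanish_based gE) => s sp sg; rewrite ffunE wE // /Y /h !(tb nrel) ?pos_fturn //.
  by rewrite !subrr addr0 scaler0.
by apply/eqP; rewrite fglue_fturn_none sg.
Qed.

(** After summation by parts the coefficient of [f s] is 2 x 01 - x 02 - x 03, which tangency turns
    into 3 x 01; the 3^-1 of [hop] cancels. The function [g] adds the values of [f] at the two ends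
    of an edge. *)
Lemma dot_hop_coboundary (c : Z1 R X) : c \in B1 R X ->
  exists g : {ffun cell1 X -> R^o}, forall x, tangent x ->
    dot x (hop (val c)) = dot x [ffun a => g (phi31 a)].
Proof.
move=> /is_coboundaryP[f [fc fi]].
pose w : A := [ffun a => if [pick s | positive s && (fedge s == a)] is Some s
  then f s + f (fswap s) else 0].
have wE s : positive s -> w (fedge s) = f s + f (fswap s).
  move=> sp; rewrite ffunE; case: pickP => [u /andP[up /eqP us]|/(_ s)]; last by rewrite sp eqxx.
  by have [->|->] := fedge_inj sp up (esym us); rewrite ?fswapK 1?addrC.
have wi : glue_inv w.
  move=> s sp sg; rewrite !wE ?pos_frot ?pos_fcross // fswap_frot -fcross_fturn //.
  rewrite [in LHS]fi //; congr (_ + _).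
  rewrite [RHS]fi ?pos_fcross ?pos_fturn ?fglue_fcross ?fglue_fturn_none //.
  by rewrite fcrossK /fturn frot3.
have [g gE] := glue_inv_cell1 wi; exists g => x xt.
have -> : [ffun a => g (phi31 a)] = w by apply/ffunP => a; rewrite ffunE gE.
have two : (2%:R : R) != 0 by rewrite pnatr_eq0.
apply: (mulfI two); rewrite [RHS]dot_fedge dot_hop.
transitivity (2%:R * \sum_(s | positive s) f s * x (fedge s)); last first.
  have E : \sum_(s | positive s) x (fedge s) * f (fswap s) = \sum_(s | positive s) f s * x (fedge s).
    by rewrite -[RHS]sum_fswap; apply: eq_bigr => s _; rewrite fedge_swap mulrC.
  under [RHS]eq_bigr => s sp do rewrite wE // mulrDr.
  rewrite big_split /= E mulr_natl mulr2n; congr (_ + _).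
  by apply: eq_bigr => s _; rewrite mulrC.
congr (_ * _).
have E1 : \sum_(s | positive s) f (frot s) * x (fedge (frot s)) = \sum_(s | positive s) f s * x (fedge s).
  by rewrite -[RHS]sum_frot.
have E2 : \sum_(s | positive s) f (frot s) * x (fedge s) = \sum_(s | positive s) f s * x (fedge (frot (frot s))).
  by rewrite -[RHS]sum_frot; apply: eq_bigr => s _; rewrite frot3.
transitivity (3%:R^-1 * (\sum_(s | positive s) f s * x (fedge s) -
   \sum_(s | positive s) f s * x (fedge (frot (frot s))) -
   \sum_(s | positive s) f s * x (fedge (frot s)) +
   \sum_(s | positive s) f s * x (fedge s))).
  congr (_ * _); rewrite -[X in X - _ - _ + _]E1 -E2 -!sumrB -big_split /=.
  by apply: eq_bigr => s sp; rewrite fc //; ring.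
rewrite -!sumrB -big_split mulr_sumr /=; apply: eq_bigr => s sp.
have := xt s sp => h.
have -> : x (fedge (frot (frot s))) = - x (fedge s) - x (fedge (frot s)) by lra.
by field.
Qed.
End Duality.

Lemma vpi0 (R : pzRingType) (V : lmodType R) (B : submodClosed V) : vpi B 0 = 0.
Proof. by apply: (addrI (vpi B 0)); rewrite -vpiD !addr0. Qed.

(** * From cohomology classes to angles of weight zero modulo gauge *)

Section Holonomy.
Variables (R : realType) (X : manifold).
Local Notation A := {ffun tedge X -> R^o}.
Local Notation C1 := {ffun flag X -> R^o}.
Local Notation G := {ffun cell1 X -> R^o}.
Implicit Types (x m : A) (c : C1) (g : G) (z : Z1 R X).

Definition wt x : G := [ffun e => \sum_(a | phi31 a == e) x a].

Fact wt_is_linear : linear wt.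
Proof.
move=> k x y; apply/ffunP => e; rewrite !ffunE scaler_sumr -big_split /=.
by apply: eq_bigr => a _; rewrite !ffunE.
Qed.
HB.instance Definition _ := GRing.isLinear.Build R A G _ wt wt_is_linear.

Definition pullg g : A := [ffun a => g (phi31 a)].

Fact pullg_is_linear : linear pullg.
Proof. by move=> k g h; apply/ffunP => a; rewrite !ffunE. Qed.
HB.instance Definition _ := GRing.isLinear.Build R G A _ pullg pullg_is_linear.

(** The adjoint of the weight map: vectors of weight zero are orthogonal to all functions coming
    from edges of X. *)
Lemma dot_pullg g x : dot (pullg g) x = dot g (wt x).
Proof.
rewrite /dot (partition_big (@phi31 X) predT) //=; apply: eq_bigr => e _.
by rewrite ffunE mulr_sumr; apply: eq_bigr => a /eqP <-; rewrite ffunE.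
Qed.

(** A linear projection onto the based functions, so that [gaugemap] can be linear on all of [G]. *)
Definition interior_part g : G := [ffun e => if `[< bdry_cell1 e >] then 0 else g e].

Definition gaugemap g : A := epsop (pullg (interior_part g)).

Fact gaugemap_is_linear : linear gaugemap.
Proof.
move=> k g h; rewrite /gaugemap -!linearP; congr (epsop (pullg _)).
by apply/ffunP => e; rewrite !ffunE; case: ifP => _; rewrite ?scaler0 ?addr0.
Qed.
HB.instance Definition _ := GRing.isLinear.Build R G A _ gaugemap gaugemap_is_linear.

Lemma based_interior g : based (interior_part g).
Proof. by move=> e eb; rewrite ffunE asboolT. Qed.

Lemma interior_based g : based g -> interior_part g = g.
Proof.
by move=> gb; apply/ffunP => e; rewrite ffunE; case: asboolP => // /gb ->.
Qed.

Definition gauged x : Prop := exists g, x = gaugemap g.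

Lemma gauged0 : gauged 0. Proof. by exists 0; rewrite linear0. Qed.
Lemma gaugedP k x y : gauged x -> gauged y -> gauged (k *: x + y).
Proof. by move=> [g ->] [h ->]; exists (k *: g + h); rewrite linearP. Qed.
Lemma gaugedD x y : gauged x -> gauged y -> gauged (x + y).
Proof. by move=> gx gy; rewrite -[x]scale1r; apply: gaugedP. Qed.
Lemma gaugedZ k x : gauged x -> gauged (k *: x).
Proof. by move=> gx; rewrite -[_ *: _]addr0; apply: gaugedP => //; exact: gauged0. Qed.
Lemma gaugedN x : gauged x -> gauged (- x).
Proof. by move=> gx; rewrite -scaleN1r; apply: gaugedZ. Qed.
Lemma gaugedB x y : gauged x -> gauged y -> gauged (x - y).
Proof. by move=> gx gy; apply: gaugedD => //; apply: gaugedN. Qed.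

Lemma gauged_based g : based g -> gauged (epsop (pullg g)).
Proof. by move=> gb; exists g; rewrite /gaugemap interior_based. Qed.

(** The directions along the fibers of the weight map, before gauge reduction. *)
Definition flat x : Prop := tangent x /\ wt x = 0.

Lemma tangentP k x y : tangent x -> tangent y -> tangent (k *: x + y).
Proof.
move=> xt yt s sp; have := xt s sp; have := yt s sp.
rewrite !ffunE /GRing.scale /= => h1 h2.
transitivity (k * (x (fedge s) + x (fedge (frot s)) + x (fedge (frot (frot s)))) +
  (y (fedge s) + y (fedge (frot s)) + y (fedge (frot (frot s))))); first by ring.
by rewrite h1 h2 mulr0 addr0.
Qed.

Lemma tangent0 : tangent (0 : A).
Proof. by move=> s _; rewrite !ffunE !addr0. Qed.

Lemma flatP k x y : flat x -> flat y -> flat (k *: x + y).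
Proof.
move=> [xt xw] [yt yw]; split; first exact: tangentP.
by rewrite linearP /= xw yw scaler0 addr0.
Qed.
Lemma flat0 : flat (0 : A).
Proof. by split; [exact: tangent0|rewrite linear0]. Qed.
Lemma flatD x y : flat x -> flat y -> flat (x + y).
Proof. by move=> fx fy; rewrite -[x]scale1r; apply: flatP. Qed.
Lemma flatZ k x : flat x -> flat (k *: x).
Proof. by move=> fx; rewrite -[_ *: _]addr0; apply: flatP => //; exact: flat0. Qed.
Lemma flatB x y : flat x -> flat y -> flat (x - y).
Proof. by move=> fx fy; rewrite -scaleN1r addrC; apply: flatP. Qed.

Lemma epsop_dot x a : epsop x a = - dot (epsop (ffdelta R a)) x.
Proof. by rewrite dot_epsopC opprK dotC dot_delta. Qed.

Lemma wt_epsop x e : wt (epsop x) e = - dot (epsop (pullg (ffdelta R e))) x.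
Proof. by rewrite dot_epsopC opprK dot_pullg dotC dot_delta. Qed.

Lemma wt_gaugemap g : wt (gaugemap g) = 0.
Proof.
apply/ffunP => e; rewrite wt_epsop [RHS]ffunE dot_epsopC opprK.
apply: dot_epsop_glue; try exact: glue_inv_phi31.
exact/based_vanish/based_interior.
Qed.

Lemma flat_gauged x : gauged x -> flat x.
Proof. by move=> [g ->]; split; [exact: tangent_epsop|exact: wt_gaugemap]. Qed.

Lemma dot_gauged_hop x z : gauged x -> dot x (hop (val z)) = 0.
Proof.
move=> [g ->]; apply: dot_epsop_hop_glue; [exact: pcocycle_val|exact: glue_inv_phi31|right].
exact/based_vanish/based_interior.
Qed.

Lemma flat_epsop_hop z : is_relative z -> flat (epsop (hop (val z))).
Proof.
move=> zr; split; first exact: tangent_epsop.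
apply/ffunP => e; rewrite wt_epsop dot_epsop_hop_glue ?oppr0 ?ffunE //.
- exact: pcocycle_val.
- exact: glue_inv_phi31.
- by left; apply/prelative_val.
Qed.

(** For the converse, [epsop (hop c)] with [c] relative is flat and its holonomies are cup products
    with [c] up to a factor, so [pcup_coboundary] applies. *)
Lemma coboundary_flat z :
  z \in B1 R X <-> forall m, flat m -> dot m (hop (val z)) = 0.
Proof.
split=> [zb m [mt mw]|mz].
  have [g ->] // := dot_hop_coboundary zb.
  by rewrite dotC -[X in dot X]/(pullg g) dot_pullg mw dot0r.
apply: pcup_coboundary => c cr.
have := mz _ (flat_epsop_hop cr).
rewrite dot_epsop_hop_hop; try exact: pcocycle_val; last by left; apply/prelative_val.
move/eqP; rewrite mulf_eq0 oppr_eq0 pnatr_eq0 /= => /eqP h.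
by rewrite -[LHS]/(pcup (val z) (val c)) pcupC h oppr0.
Qed.

Lemma gauged_holonomy x : tangent x ->
  (forall z, dot x (hop (val z)) = 0) -> gauged x.
Proof.
move=> xt xz; have [|g [/(_ isT) gb ->]] := @trivial_holonomy R X false x xt.
  by move=> c _; exact: xz.
exact: gauged_based.
Qed.

Lemma flat_constraints : exists (J : finType)
  (L : {linear A -> {ffun J -> R^o}}), forall x, L x = 0 <-> flat x.
Proof.
pose J : finType := (flag X + cell1 X)%type.
pose L x : {ffun J -> R^o} := [ffun j : J => match j with
  | inl s => if positive s then x (fedge s) + x (fedge (frot s)) + x (fedge (frot (frot s))) else 0
  | inr e => wt x e end].
have L_lin : linear L.
  move=> k x y; apply/ffunP => -[s|e]; last first.
    by have /ffunP/(_ e) := linearP wt k x y; rewrite !ffunE.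
  rewrite ![in LHS]ffunE ![in RHS]ffunE.
  by case: ifP => _; rewrite ?scaler0 ?addr0 // /GRing.scale /=; ring.
exists J, (linmap L_lin) => x; split=> [/ffunP Lx|[xt xw]].
  split=> [s sp|]; first by have := Lx (inl s); rewrite !ffunE sp.
  by apply/ffunP => e; have := Lx (inr e); rewrite ffunE !ffunE => ->.
apply/ffunP => -[s|e]; rewrite [LHS]ffunE [RHS]ffunE; last by rewrite xw ffunE.
by case: ifP => // sp; exact: xt.
Qed.

Lemma flat_proj : exists P : {linear A -> A}, forall x,
  flat (P x) /\ forall m, flat m -> dot (P x) m = dot x m.
Proof.
have [J [L LE]] := flat_constraints; have [P PE] := orth_proj L.
exists P => x; have [/LE Px Pm] := PE x; split=> // m /LE; exact: Pm.
Qed.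

Lemma cocycle_proj (rel : bool) : exists Q : {linear C1 -> C1}, forall c,
  [/\ is_cocycle1 (Q c),
      rel -> forall s : flag X, glue (s.1, s.2 pos3) = None -> Q c s = 0 &
      forall m : C1, is_cocycle1 m ->
        (rel -> forall s : flag X, glue (s.1, s.2 pos3) = None -> m s = 0) ->
        dot (Q c) m = dot c m].
Proof.
pose J : finType := (flag X * flag X + (flag X + (flag X + flag X)))%type.
pose L c : {ffun J -> R^o} := [ffun j : J => match j with
  | inl p => if glued p.1 p.2 then c p.1 - c p.2 else 0
  | inr (inl s) => c (frev s) + c s
  | inr (inr (inl s)) => c s + c (frot s) + c (frot (frot s))
  | inr (inr (inr s)) => if rel && (glue (s.1, s.2 pos3) == None) then c s else 0 end].
have L_lin : linear L.
  move=> k c d; apply/ffunP => -[p|[s|[s|s]]]; rewrite !ffunE /GRing.scale /=; try ring;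
  by case: ifP => _; ring.
have LE c : L c = 0 <-> is_cocycle1 c /\
    (rel -> forall s : flag X, glue (s.1, s.2 pos3) = None -> c s = 0).
  split=> [/ffunP Lc|[]].
    split; last first.
      move=> r s sg; have := Lc (inr (inr (inr s))).
      by rewrite !ffunE r sg eqxx.
    apply/andP; split; first (apply/andP; split).
    - apply/'forall_'forall_implyP => s u su; have := Lc (inl (s, u)).
      by rewrite !ffunE /= su => /eqP; rewrite subr_eq0.
    - apply/forallP => s; have := Lc (inr (inl s)).
      by rewrite !ffunE => /eqP; rewrite addr_eq0.
    - by apply/forallP => s; have := Lc (inr (inr (inl s))); rewrite !ffunE => ->.
  move=> /andP[/andP[/'forall_'forall_implyP c1 /forallP c2] /forallP c3] c4.
  apply/ffunP => -[[s u]|[s|[s|s]]]; rewrite !ffunE /=.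
  - by case: ifP => // su; rewrite (eqP (c1 _ _ su)) subrr.
  - by rewrite (eqP (c2 s)) addNr.
  - exact/eqP.
  - by case: ifP => // /andP[r /eqP]; exact: c4.
have [Q QE] := orth_proj (linmap L_lin).
exists Q => c; have [/LE[Qc Qr] Qm] := QE c; split=> // m mc mr.
by apply: Qm; apply/LE.
Qed.

Lemma toZ1_exists : exists T : {linear C1 -> Z1 R X},
  forall z c, T (val z) = z /\ dot (val (T c)) (val z) = dot c (val z).
Proof.
have [Q QE] := cocycle_proj false.
pose T c : Z1 R X := Sub (Q c) (let: And3 h _ _ := QE c in h).
have T_lin : linear T by move=> k c d; apply: val_inj => /=; exact: linearP.
exists (linmap T_lin) => z c /=.
have Qz d (m : C1) : is_cocycle1 m -> dot (Q d) m = dot d m.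
  by move=> mc; have [_ _ ->] := QE d.
split; last by apply: Qz; exact: valP.
apply: val_inj; rewrite /=; apply/eqP; rewrite -subr_eq0; apply/eqP/dot_eq0.
have zc := valP z; have [Qzc _ _] := QE (val z).
by rewrite dotBl [dot _ (Q _ - _)]dotBr [dot _ (Q _ - _)]dotBr !Qz // !subrr.
Qed.

(* Only the closed case has to match the Neumann-Zagier form.  In general a
   class is sent to its holonomy pairing, turned into a vector of angles by the
   inner product. *)
Definition angles_of (P : {linear A -> A}) c : A :=
  if `[< closed_manifold X >] then (Num.sqrt 2%:R)^-1 *: epsop (hop c)
  else P (hop c).

Fact angles_of_is_linear P : linear (angles_of P).
Proof.
move=> k c d; rewrite /angles_of; case: ifP => _; last by rewrite !linearP.
by rewrite linearP linearP scalerDr !scalerA mulrC.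
Qed.
HB.instance Definition _ P :=
  GRing.isLinear.Build R C1 A _ (angles_of P) (angles_of_is_linear P).

Section Angles.
Variables (P : {linear A -> A}).
Hypothesis PE : forall x, flat (P x) /\ forall m, flat m -> dot (P x) m = dot x m.

Lemma closed_relative z : closed_manifold X -> is_relative z.
Proof. by move=> Xc s sg; have := Xc (s.1, s.2 pos3). Qed.

Lemma closed_based g : closed_manifold X -> based g.
Proof. by move=> Xc e [a [i [_ ag _]]]; have := Xc (a.1, i). Qed.

Lemma flat_angles z : flat (angles_of P (val z)).
Proof.
rewrite /angles_of; case: asboolP => [Xc|_]; last exact: (PE _).1.
exact/flatZ/flat_epsop_hop/closed_relative.
Qed.

Lemma sqrt2_neq0 : (Num.sqrt 2%:R : R) != 0.
Proof. by rewrite sqrtr_eq0 -ltNge ltr0n. Qed.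

(** Skewness and [epsop_epsop] allow [epsop] to be removed from both sides of a pairing. *)
Lemma dot_tangent_epsop m x : tangent m ->
  dot (epsop m) (epsop x) = 12%:R * dot m x.
Proof.
by move=> mt; rewrite -[dot (epsop m) _]opprK -dot_epsopC epsop_epsop // dotZl mulNr opprK.
Qed.

(** This becomes the freeness of the action. In the closed case [epsop] is stripped by
    [dot_tangent_epsop]. Otherwise a gauged [P (hop z)] is orthogonal to itself, since gauge
    directions have no holonomy. *)
Lemma angles_coboundary z : gauged (angles_of P (val z)) <-> z \in B1 R X.
Proof.
rewrite /angles_of; case: asboolP => [Xc|_].
  split=> [|zb].
    case/(gaugedZ (Num.sqrt 2%:R)) => g; rewrite scalerA divff ?sqrt2_neq0 // scale1r => zg.
    apply/coboundary_flat => m [mt mw].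
    have twelve : (12%:R : R) != 0 by rewrite pnatr_eq0.
    apply: (mulfI twelve); rewrite -dot_tangent_epsop // zg dot_tangent_epsop //.
    by congr (_ * _); rewrite dotC dot_pullg mw dot0r.
  apply: gaugedZ; have [g gE] := dot_hop_coboundary zb.
  rewrite (_ : epsop _ = epsop (pullg g)); first exact/gauged_based/closed_based.
  apply/ffunP => a; rewrite !(epsop_dot _ a); congr (- _).
  exact/gE/tangent_epsop.
split=> [pg|zb].
  apply/coboundary_flat => m mf; rewrite dotC -(PE _).2 //.
  have -> : P (hop (val z)) = 0; last by rewrite dotC dot0r.
  apply: dot_eq0; rewrite (PE _).2 ?(PE _).1 //; last exact: (PE _).1.
  by rewrite dotC dot_gauged_hop.
have -> : P (hop (val z)) = 0; last exact: gauged0.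
apply: dot_eq0; rewrite (PE _).2; last exact: (PE _).1.
by rewrite dotC; apply: (coboundary_flat z).1 zb _ (PE _).1.
Qed.

(** By [in_range] it is enough that [x] is orthogonal to every [k] orthogonal to all angles and
    gauge directions. For such [k] the vector [epsop k], or [P k] in the bounded case, has trivial
    holonomy and is a gauge direction. The first is orthogonal to [epsop x], the second to
    itself. *)
Lemma angles_onto x : flat x -> exists z, gauged (x - angles_of P (val z)).
Proof.
move=> [xt xw]; have [Q QE] := toZ1_exists.
pose J : finType := (flag X + cell1 X)%type.
pose T (t : {ffun J -> R^o}) : A := angles_of P (val (Q [ffun s => t (inl s)])) +
  gaugemap [ffun e => t (inr e)].
have T_lin : linear T.
  move=> k s t; rewrite /T scalerDr addrACA.
  have -> : [ffun u => (k *: s + t) (inl u)] =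
      k *: [ffun u => s (inl u)] + [ffun u => t (inl u)] :> C1.
    by apply/ffunP => u; rewrite !ffunE.
  have -> : [ffun u => (k *: s + t) (inr u)] =
      k *: [ffun u => s (inr u)] + [ffun u => t (inr u)] :> G.
    by apply/ffunP => u; rewrite !ffunE.
  rewrite (linearP gaugemap); congr (_ + _).
  by rewrite (linearP Q) (linearP val) (linearP (angles_of P)).
have TE c g : T [ffun j : J => match j with inl s => c s | inr e => g e end] =
    angles_of P (val (Q c)) + gaugemap g.
  by rewrite /T; congr (angles_of P (val (Q _)) + gaugemap _); apply/ffunP => u; rewrite !ffunE.
have [t tE] : exists t, T t = x; last first.
  exists (Q [ffun s => t (inl s)]).
  by exists [ffun e => t (inr e)]; rewrite -tE /T /= addrC addKr.
apply: (in_range (L' := linmap T_lin)) => k /= kT.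
have kz z : dot (angles_of P (val z)) k = 0.
  have := kT [ffun j : J => match j with inl s => val z s | inr e => (0 : G) e end].
  by rewrite TE linear0 addr0 (QE z 0).1.
have kg g : based g -> dot (epsop (pullg g)) k = 0.
  move=> gb; have := kT [ffun j : J => match j with inl s => (0 : C1) s | inr e => g e end].
  by rewrite TE (linear0 Q) (linear0 val) (linear0 (angles_of P)) add0r /gaugemap interior_based.
move: kz; rewrite /angles_of; case: asboolP => [Xc|_] kz.
  have [g gE] : gauged (epsop k).
    apply: gauged_holonomy => [|z]; first exact: tangent_epsop.
    rewrite dot_epsopC dotC; have /eqP := kz z.
    by rewrite dotZl mulf_eq0 invr_eq0 (negbTE sqrt2_neq0) /= => /eqP ->; rewrite oppr0.
  have twelve : (12%:R : R) != 0 by rewrite pnatr_eq0.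
  apply: (mulfI twelve); rewrite -dot_tangent_epsop // gE dot_tangent_epsop //.
  by congr (_ * _); rewrite dotC dot_pullg xw dot0r.
have [Pk Pm] := PE k.
have [g gE] : gauged (P k).
  apply: gauged_holonomy => [|z]; first exact: Pk.1.
  have [hf hm] := PE (hop (val z)).
  by rewrite -(kz z) [RHS]dotC -(Pm _ hf) [RHS]dotC (hm _ Pk) dotC.
have Pk0 : P k = 0.
  by apply: dot_eq0; rewrite Pm // gE dotC; exact: kg (based_interior g).
by rewrite dotC -Pm ?Pk0; [rewrite dotC dot0r|split].
Qed.

(** Representatives of classes are arbitrary, so [pr] removes the gauge part linearly. Coboundaries
    have gauged angles, hence the result only depends on the class. *)
Lemma h1_angles : exists iota : {linear H1 R X -> A},
  [/\ forall v, flat (iota v), forall v, gauged (iota v) -> v = 0,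
      forall x, flat x -> exists v, gauged (x - iota v) &
      forall z, gauged (iota (vpi (B1 R X) z) - angles_of P (val z))].
Proof.
have [D DE] := linear_ginv gaugemap.
pose pr x := x - gaugemap (D x).
have prg x : gauged (pr x - x).
  by rewrite /pr addrC addKr; apply: gaugedN; exists (D x).
have pr0 x : gauged x -> pr x = 0 by move=> [g ->]; rewrite /pr DE subrr.
pose iota (v : H1 R X) := pr (angles_of P (val (vrepr v))).
have pr_lin : linear pr.
  move=> k x y; rewrite /pr (linearP D) (linearP gaugemap) scalerBr.
  by rewrite opprD addrACA.
pose prl := linmap pr_lin.
have iotaE z : iota (vpi (B1 R X) z) = pr (angles_of P (val z)).
  apply/eqP; rewrite -subr_eq0 -(linearB prl) -linearB; apply/eqP/pr0.
  rewrite -[_ - _]/(val (vrepr (vpi (B1 R X) z) - z)); apply/angles_coboundary.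
  by apply/vpi_eq; rewrite vreprK.
have iota_lin : linear iota.
  move=> k v w; rewrite -(vreprK v) -(vreprK w).
  rewrite -[k *: vpi _ _]/(vscale k (vpi _ _)) vpiZ -vpiD !iotaE.
  by rewrite -(linearP prl) -linearP.
exists (linmap iota_lin).
split=> [v|v gv|x xf|z] /=.
- have := flatD (flat_gauged (prg (angles_of P (val (vrepr v))))) (flat_angles (vrepr v)).
  by rewrite subrK.
- have /angles_coboundary zb : gauged (angles_of P (val (vrepr v))).
    have := gaugedB gv (prg (angles_of P (val (vrepr v)))).
    by rewrite opprB addrC subrK.
  by rewrite -[v]vreprK -(vpi0 (B1 R X)); apply/vpi_eq; rewrite subr0.
- have [z zx] := angles_onto xf; exists (vpi (B1 R X) z); rewrite iotaE.
  have := gaugedB zx (prg (angles_of P (val z))).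
  by rewrite opprB addrA subrK.
- by rewrite iotaE; exact: prg.
Qed.
End Angles.
End Holonomy.

(** * Calculus with directional derivatives *)

Section DirectionalDerivatives.
Variable R : realType.

(** A directional derivative only sees the restriction to a line. This moves derivatives between
    charts, translates and functions of one variable. *)
Lemma derive_congr (V W : normedModType R) (f : V -> R^o) (g : W -> R^o) y w z v :
  (forall h, f (h *: w + y) = g (h *: v + z)) ->
  (derivable f y w -> derivable g z v) /\ 'D_w f y = 'D_v g z.
Proof.
move=> fg; have fgE : (fun h : R => h^-1 *: ((f \o shift y) (h *: w) - f y)) =
    (fun h : R => h^-1 *: ((g \o shift z) (h *: v) - g z)).
  by apply/funext => h; have := fg 0; rewrite /= !scale0r !add0r => ->; rewrite fg.
by rewrite /derivable /derive fgE.
Qed.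

Variable n : nat.
Implicit Types (f g : 'rV[R]_n -> R^o) (x u v w : 'rV[R]_n).

Lemma derivable_line f x w (s : R) : derivable f (x + s *: w) w ->
  is_derive s 1 (fun s : R => f (x + s *: w) : R^o) ('D_w f (x + s *: w)).
Proof.
move=> fd.
have [h|h1 h2] := @derive_congr _ R f (fun s : R => f (x + s *: w) : R^o)
   (x + s *: w) w s 1.
  by rewrite addrCA -scalerDl /GRing.scale /= mulr1.
by apply: DeriveDef; [exact: h1|].
Qed.

Lemma line_mvt f x w (b : R) : (forall y, derivable f y w) ->
  exists t : R, `|t| <= `|b| /\ f (x + b *: w) - f x = b * 'D_w f (x + t *: w).
Proof.
move=> fd; pose p (s : R) : R := f (x + s *: w).
have pd (s : R) : is_derive s 1 (p : R -> R^o) ('D_w f (x + s *: w)) by exact: derivable_line.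
have pc a c : {within `[a, c], continuous p}.
  by apply: derivable_within_continuous => s _; exact: (@ex_derive _ _ _ _ _ _ _ (pd s)).
have p0 : p 0 = f x by rewrite /p scale0r addr0.
have [b0|b0] := leP 0 b.
  have [t] := MVT_segment b0 (fun s _ => pd s) (pc 0 b).
  rewrite in_itv /= => /andP[t0 tb]; rewrite p0 subr0 mulrC => ->.
  by exists t; rewrite !ger0_norm // (le_trans t0).
have [t] := MVT_segment (ltW b0) (fun s _ => pd s) (pc b 0).
rewrite in_itv /= => /andP[bt t0]; rewrite p0 sub0r => E.
exists t; split; first by rewrite (ler0_norm t0) (ltr0_norm b0) lerN2.
by rewrite -[LHS]opprB E mulrN opprK mulrC.
Qed.

Lemma cvg_bounded (a : R) (t : R -> R) :
  (forall h, `|t h| <= `|a * h|) -> t h @[h --> 0^'] --> (0 : R).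
Proof.
move=> ta; apply: (@cvg_to_0_linear _ _ `|a| 1) => // h _.
by rewrite -normrM.
Qed.

(* Continuity along the points x + h v + t(h) w, for the mean value arguments. *)
Lemma cvg_line2 f x v w (a b : R) (s t : R -> R) : continuous f ->
    (forall h, `|s h| <= `|a * h|) -> (forall h, `|t h| <= `|b * h|) ->
  f (x + s h *: v + t h *: w) @[h --> 0^'] --> f x.
Proof.
move=> fc sa tb; have xE : x + 0 *: v + 0 *: w = x by rewrite !scale0r !addr0.
rewrite -[in X in _ --> X]xE.
apply: (@cvg_comp _ _ _ (fun h => x + s h *: v + t h *: w) f _ (nbhs (x + 0 *: v + 0 *: w))).
  apply: cvgD; first apply: cvgD.
  - exact: cvg_cst.
  - by apply: cvgZr_tmp; apply: cvg_bounded sa.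
  - by apply: cvgZr_tmp; apply: cvg_bounded tb.
exact: fc.
Qed.

(** The mean value theorem writes the increment along [w] as a derivative at a nearby point, and
    continuity of ['D_w f] gives the limit. *)
Lemma derive_addZ f x v w (a : R) :
    (forall y, derivable f y v) -> (forall y, derivable f y w) ->
    continuous (fun y => 'D_w f y) ->
  derivable f x (v + a *: w) /\ 'D_(v + a *: w) f x = 'D_v f x + a * 'D_w f x.
Proof.
move=> fv fw fc.
have /choice[t tE] := fun h : R => line_mvt (x + h *: v) (a * h) fw.
have lim : h^-1 *: ((f \o shift x) (h *: (v + a *: w)) - f x) @[h --> 0^'] -->
    ('D_v f x + a * 'D_w f x : R^o).
  have c1 : h^-1 *: ((f \o shift x) (h *: v) - f x) + a * 'D_w f (x + h *: v + t h *: w)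
     @[h --> 0^'] --> ('D_v f x + a * 'D_w f x : R^o).
    have c2 : 'D_w f (x + h *: v + t h *: w) @[h --> 0^'] --> ('D_w f x : R^o).
      apply: (@cvg_line2 (fun y => 'D_w f y) x v w 1 a id t) => // h.
        by rewrite mul1r.
      exact: (tE h).1.
    by apply: cvgD; [exact: fv|apply: cvgM c2; exact: cvg_cst].
  apply: cvg_trans c1; apply: near_eq_cvg; near=> h.
  have h0 : h != 0 by near: h; exact: nbhs_dnbhs_neq.
  have [_ E] := tE h.
  have -> : h *: (v + a *: w) = h *: v + (a * h) *: w by rewrite scalerDr scalerA mulrC.
  rewrite /= [h *: v + _ + x]addrC [h *: v + x]addrC addrA.
  rewrite -[f (x + h *: v + (a * h) *: w)](subrK (f (x + h *: v))) E.
  by rewrite /GRing.scale /=; field.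
by split; [apply/cvg_ex; eexists; exact: lim|exact: cvg_lim lim].
Unshelve. all: by end_near.
Qed.

Lemma eq_at_limit f g x v w (p q : R -> R * R) : continuous f -> continuous g ->
    (forall h, `|(p h).1| <= `|h| /\ `|(p h).2| <= `|h|) ->
    (forall h, `|(q h).1| <= `|h| /\ `|(q h).2| <= `|h|) ->
    (forall h, h != 0 -> f (x + (p h).1 *: v + (p h).2 *: w) =
                         g (x + (q h).1 *: w + (q h).2 *: v)) ->
  f x = g x.
Proof.
move=> fc gc ph qh fg.
have l1 : f (x + (p h).1 *: v + (p h).2 *: w) @[h --> 0^'] --> f x.
  by apply: (@cvg_line2 f x v w 1 1 (fun h => (p h).1) (fun h => (p h).2)) => // h;
    rewrite mul1r; have [] := ph h.
have l2 : g (x + (q h).1 *: w + (q h).2 *: v) @[h --> 0^'] --> g x.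
  by apply: (@cvg_line2 g x w v 1 1 (fun h => (q h).1) (fun h => (q h).2)) => // h;
    rewrite mul1r; have [] := qh h.
apply: (cvg_unique _ l1) => //; apply: cvg_trans l2.
apply: near_eq_cvg; near=> h; rewrite fg //.
by near: h; exact: nbhs_dnbhs_neq.
Unshelve. all: by end_near.
Qed.

(** Both mixed derivatives, taken at points tending to [x], equal the same second difference divided
    by the square of [h]. *)
Lemma derive_schwarz f x v w :
    (forall y, derivable f y v) -> (forall y, derivable f y w) ->
    (forall y, derivable (fun y => 'D_v f y : R^o) y w) ->
    (forall y, derivable (fun y => 'D_w f y : R^o) y v) ->
    continuous (fun y => 'D_w (fun y => 'D_v f y : R^o) y) ->
    continuous (fun y => 'D_v (fun y => 'D_w f y : R^o) y) ->
  'D_w (fun y => 'D_v f y : R^o) x = 'D_v (fun y => 'D_w f y : R^o) x.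
Proof.
have second (f' : 'rV[R]_n -> R^o) (v' w' : 'rV[R]_n) :
    (forall y, derivable f' y v') ->
    (forall y, derivable (fun y => 'D_v' f' y : R^o) y w') -> forall h : R,
    exists st : R * R, [/\ `|st.1| <= `|h|, `|st.2| <= `|h| &
      f' (x + h *: v' + h *: w') - f' (x + h *: v') - (f' (x + h *: w') - f' x) =
      h * (h * 'D_w' (fun y => 'D_v' f' y : R^o) (x + st.1 *: v' + st.2 *: w'))].
  move=> fv fvw h; pose F y : R^o := f' (y + h *: w') - f' y.
  have Fd y : is_derive y v' F ('D_v' f' (y + h *: w') - 'D_v' f' y).
    apply: is_deriveB; last exact: (DeriveDef (fv y) erefl).
    have [k|h1 h2] := @derive_congr _ _ f' (fun y => f' (y + h *: w') : R^o)
      (y + h *: w') v' y v'; first by rewrite addrA.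
    by apply: DeriveDef; [exact/h1/fv|].
  have [s [sh E]] := @line_mvt F x v' h (fun y => @ex_derive _ _ _ _ _ _ _ (Fd y)).
  have [t [th E']] := @line_mvt (fun y => 'D_v' f' y : R^o) (x + s *: v') w' h fvw.
  exists (s, t); split=> //=; rewrite -E' -[RHS]/(h * (_ - _)).
  rewrite -(@derive_val _ _ _ _ _ _ _ (Fd (x + s *: v'))) -E /F.
  by rewrite opprB addrACA -!addrA; congr (_ + _); rewrite addrCA [RHS]addrCA !addrA.
move=> fv fw fvw fwv cvw cwv.
have /choice[p pE] := second f v w fv fvw.
have /choice[q qE] := second f w v fw fwv.
have ph h : `|(p h).1| <= `|h| /\ `|(p h).2| <= `|h| by have [] := pE h.
have qh h : `|(q h).1| <= `|h| /\ `|(q h).2| <= `|h| by have [] := qE h.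
apply: (eq_at_limit cvw cwv ph qh) => h h0.
have [_ _ E1] := pE h; have [_ _ E2] := qE h.
have E0 : f (x + h *: v + h *: w) - f (x + h *: v) - (f (x + h *: w) - f x) =
    f (x + h *: w + h *: v) - f (x + h *: w) - (f (x + h *: v) - f x) :> R.
  by rewrite [x + h *: w + h *: v]addrAC; ring.
exact: (mulfI h0 (mulfI h0 (etrans (esym E1) (etrans E0 E2)))).
Qed.

End DirectionalDerivatives.

(** * Smooth functions of several variables *)

Section SmoothFunctions.
Variable R : realType.
Implicit Types n m k : nat.

Lemma CkW k n (f : 'rV[R]_n -> R^o) : Ck k.+1 f -> Ck k f.
Proof.
elim: k f => [|k IH] f [fc fd]; split=> // v.
by have [fdv fk] := fd v; split=> //; exact: IH.
Qed.

Lemma Ck_cst k n (c : R) : Ck k (fun _ : 'rV[R]_n => c : R^o).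
Proof.
elim: k c => [|k IH] c /=; split; try exact: cst_continuous; try by [].
move=> v; split=> [x|]; first exact: derivable_cst.
rewrite (_ : (fun x => _) = fun=> 0 : R^o) //.
by apply/funext => x; rewrite derive_cst.
Qed.

Lemma CkD k n (f g : 'rV[R]_n -> R^o) : Ck k f -> Ck k g ->
  Ck k (fun x => f x + g x : R^o).
Proof.
elim: k f g => [|k IH] f g [fc fd] [gc gd]; (split=> [x|//];
  first by [apply: (@continuousD _ _ _ f g); [exact: fc|exact: gc]]).
move=> v; have [fv fk] := fd v; have [gv gk] := gd v; split=> [x|].
  exact: (@derivableD _ _ _ f g).
rewrite (_ : (fun x => _) = fun x => 'D_v f x + 'D_v g x); first exact: IH.
by apply/funext => x; exact: (@deriveD _ _ _ f g).
Qed.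

Lemma CkM k n (f g : 'rV[R]_n -> R^o) : Ck k f -> Ck k g ->
  Ck k (fun x => f x * g x : R^o).
Proof.
elim: k f g => [|k IH] f g Cf Cg; have [fc fd] := Cf; have [gc gd] := Cg; (split=> [x|//];
  first by [apply: (@continuousM _ _ f g); [exact: fc|exact: gc]]).
move=> v; have [fv fk] := fd v; have [gv gk] := gd v; split=> [x|].
  exact: (@derivableM _ _ f g).
rewrite (_ : (fun x => _) = fun x => f x * 'D_v g x + g x * 'D_v f x).
  by apply: CkD; apply: IH => //; exact: CkW.
by apply/funext => x; exact: (@deriveM _ _ f g).
Qed.

Lemma Ck_comp k n m (f : 'rV[R]_n -> R^o) (l : {linear 'rV[R]_m -> 'rV[R]_n})
    (b : 'rV[R]_n) : continuous l -> Ck k f -> Ck k (fun u => f (l u + b)).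
Proof.
move=> lc; elim: k f => [|k IH] f [fc fd]; (split=> [x|//];
  first by [apply: (@continuous_comp _ _ _ (fun u => l u + b) f);
    [apply: (@continuousD _ _ _ l (cst b)); [exact: lc|exact: cst_continuous]|exact: fc]]).
move=> v; have [fv fk] := fd (l v).
have E x : (derivable f (l x + b) (l v) ->
     derivable (fun u => f (l u + b)) x v) /\
   'D_(l v) f (l x + b) = 'D_v (fun u => f (l u + b)) x.
  by apply: derive_congr => h; rewrite linearD linearZ addrA.
split=> [x|]; first exact/(E x).1/fv.
rewrite (_ : (fun x => _) = fun u => 'D_(l v) f (l u + b)); first exact: IH fk.
by apply/funext => x; rewrite (E x).2.
Qed.

Lemma linear_rV_continuous n (V : normedModType R) (l : {linear 'rV[R]_n -> V}) :
  continuous l.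
Proof.
have lE u : l u = \sum_(i < n) u 0 i *: l (delta_mx 0 i).
  by rewrite {1}(row_sum_delta u) linear_sum; apply: eq_bigr => i _; rewrite linearZ.
rewrite (_ : (l : _ -> _) = fun u => \sum_(i < n) u 0 i *: l (delta_mx 0 i)); last first.
  by apply/funext => u; exact: lE.
move=> u; apply: cvg_big => [||i _]; [exact: add_continuous|exact: nbhs_filter|].
apply: (@cvgZr_tmp R V _ (nbhs u)); exact: (@coord_continuous R 1 n 0 i u).
Qed.

Lemma is_derive_affine1 (k c : R) : is_derive (0 : R) 1 (fun s : R => s * k + c : R^o) k.
Proof.
have -> : (fun s : R => s * k + c : R^o) = (k \*: (@id R : R -> R^o)) + cst (c : R^o).
  by apply/funext => s; rewrite [s * k]mulrC.
have h : is_derive (0 : R) 1 ((k \*: (@id R : R -> R^o)) + cst (c : R^o)) (k *: (1 : R^o) + 0).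
  exact: is_deriveD.
have E : (k *: (1 : R^o) + 0) = k by rewrite addr0 /GRing.scale /= mulr1.
by rewrite E in h.
Qed.

Lemma Cinfty_linear n (l : {linear 'rV[R]_n -> R^o}) (c : R) :
  Cinfty (fun u => l u + c : R^o).
Proof.
have E x v : (derivable (fun s : R => s * l v + (l x + c) : R^o) 0 1 ->
     derivable (fun u => l u + c : R^o) x v) /\
   'D_1 (fun s : R => s * l v + (l x + c) : R^o) 0 = 'D_v (fun u => l u + c : R^o) x.
  apply: derive_congr => h /=; rewrite addr0 linearD linearZ /GRing.scale /= mulr1.
  by rewrite addrA.
have lc : continuous (fun u => l u + c : R^o).
  move=> x; apply: (@continuousD _ _ _ l (cst c)); first exact: linear_rV_continuous.
  exact: cst_continuous.
case=> [|k]; split=> // v; split=> [x|].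
  by apply: (E x v).1; exact: (@ex_derive _ _ _ _ _ _ _ (is_derive_affine1 _ _)).
rewrite (_ : (fun x => _) = fun=> l v); first exact: Ck_cst.
by apply/funext => x; rewrite -(E x v).2; exact: (@derive_val _ _ _ _ _ _ _ (is_derive_affine1 _ _)).
Qed.

Lemma derive_linear n (l : {linear 'rV[R]_n -> R^o}) (c : R) x v :
  'D_v (fun u => l u + c : R^o) x = l v.
Proof.
have [h|_ <-] := @derive_congr R R _ (fun s : R => s * l v + (l x + c) : R^o)
   (fun u => l u + c : R^o) 0 1 x v.
  by rewrite addr0 linearD linearZ /GRing.scale /= mulr1 addrA.
exact: (@derive_val _ _ _ _ _ _ _ (is_derive_affine1 _ _)).
Qed.

Section Cinfty.
Variable n : nat.
Implicit Types (f g : 'rV[R]_n -> R^o).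

Lemma Cinfty_cst (c : R) : Cinfty (fun _ : 'rV[R]_n => c : R^o).
Proof. by move=> k; exact: Ck_cst. Qed.
Lemma CinftyD f g : Cinfty f -> Cinfty g -> Cinfty (fun x => f x + g x : R^o).
Proof. by move=> Cf Cg k; exact: CkD. Qed.
Lemma CinftyM f g : Cinfty f -> Cinfty g -> Cinfty (fun x => f x * g x : R^o).
Proof. by move=> Cf Cg k; exact: CkM. Qed.
Lemma CinftyZ (a : R) f : Cinfty f -> Cinfty (fun x => a * f x : R^o).
Proof. by move=> Cf; apply: CinftyM => //; exact: Cinfty_cst. Qed.
Lemma Cinfty_sum (I : Type) (r : seq I) (P : pred I) (F : I -> 'rV[R]_n -> R^o) :
  (forall i, Cinfty (F i)) -> Cinfty (fun x => \sum_(i <- r | P i) F i x : R^o).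
Proof.
move=> CF; elim: r => [|i r IH].
  by rewrite (_ : (fun x => _) = fun=> 0); [exact: Cinfty_cst|apply/funext => x; rewrite big_nil].
case Pi: (P i); rewrite (_ : (fun x => _) = fun x => if P i then F i x + \sum_(j <- r | P j) F j x
  else \sum_(j <- r | P j) F j x); try (by apply/funext => x; rewrite big_cons);
  rewrite Pi //; exact: CinftyD.
Qed.

Lemma Cinfty_continuous f : Cinfty f -> continuous f.
Proof. by move=> /(_ 0%N)[]. Qed.
Lemma Cinfty_derivable f x v : Cinfty f -> derivable f x v.
Proof. by move=> /(_ 1%N)[_ /(_ v)[]]. Qed.
Lemma Cinfty_derive f v : Cinfty f -> Cinfty (fun x => 'D_v f x : R^o).
Proof. by move=> Cf k; have [_ /(_ v)[]] := Cf k.+1. Qed.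

Lemma derive_lin f x (a : R) v w : Cinfty f ->
  'D_(v + a *: w) f x = 'D_v f x + a * 'D_w f x.
Proof.
move=> Cf; have fc : continuous (fun y => 'D_w f y).
  exact: (Cinfty_continuous (Cinfty_derive w Cf)).
have fd u y : derivable f y u by exact: Cinfty_derivable.
by have [_ ->] := derive_addZ x a (fd v) (fd w) fc.
Qed.

Lemma derive0 f x : Cinfty f -> 'D_0 f x = 0.
Proof.
move=> Cf; have /= := derive_lin x 1 0 0 Cf; rewrite scaler0 addr0 mul1r => /eqP.
by rewrite addrC -subr_eq subrr eq_sym => /eqP.
Qed.

Lemma derive_sum_dir f x (I : finType) (a : I -> R) (v : I -> 'rV[R]_n) : Cinfty f ->
  'D_(\sum_i a i *: v i) f x = \sum_i a i * 'D_(v i) f x.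
Proof.
move=> Cf; elim/big_rec2: _ => [|i y w _ <-]; first exact: derive0.
by rewrite addrC derive_lin // addrC.
Qed.

Lemma deriveC f x v w : Cinfty f ->
  'D_w (fun y => 'D_v f y : R^o) x = 'D_v (fun y => 'D_w f y : R^o) x.
Proof.
by move=> Cf; apply: derive_schwarz => [y|y|y|y||]; try exact: Cinfty_derivable;
  try (by apply: Cinfty_derivable; exact: Cinfty_derive);
  apply: Cinfty_continuous; do 2!apply: Cinfty_derive.
Qed.

Lemma derive_add f g x v : Cinfty f -> Cinfty g ->
  'D_v (fun y => f y + g y : R^o) x = 'D_v f x + 'D_v g x.
Proof. by move=> Cf Cg; apply: (@deriveD _ _ _ f g); exact: Cinfty_derivable. Qed.

Lemma derive_mul f g x v : Cinfty f -> Cinfty g ->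
  'D_v (fun y => f y * g y : R^o) x = f x * 'D_v g x + 'D_v f x * g x.
Proof.
move=> Cf Cg; rewrite [X in _ = _ + X]mulrC.
by apply: (@deriveM _ _ f g); exact: Cinfty_derivable.
Qed.

Lemma derive_scale (a : R) f x v : Cinfty f ->
  'D_v (fun y => a * f y : R^o) x = a * 'D_v f x.
Proof.
move=> Cf; rewrite derive_mul //; last exact: Cinfty_cst.
by rewrite (@derive_cst _ _ _ (a : R^o)) mul0r addr0.
Qed.

Lemma derive_bigsum (I : Type) (r : seq I) (F : I -> 'rV[R]_n -> R^o) x v :
  (forall i, Cinfty (F i)) ->
  'D_v (fun y => \sum_(i <- r) F i y : R^o) x = \sum_(i <- r) 'D_v (F i) x.
Proof.
move=> CF; elim: r => [|i r IH].
  rewrite big_nil (_ : (fun y => _) = cst 0) ?derive_cst //.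
  by apply/funext => y; rewrite big_nil.
rewrite big_cons -IH -derive_add //; last exact: Cinfty_sum.
by congr ('D_v _ x); apply/funext => y; rewrite big_cons.
Qed.

End Cinfty.

Lemma Cinfty_comp n m (f : 'rV[R]_n -> R^o) (l : {linear 'rV[R]_m -> 'rV[R]_n})
    (b : 'rV[R]_n) : Cinfty f -> Cinfty (fun u => f (l u + b)).
Proof. by move=> Cf k; apply: Ck_comp => //; exact: linear_rV_continuous. Qed.

Lemma affine_map_linear (U V : lmodType R) (f : U -> V) : affine_map f ->
  exists l : {linear U -> V}, forall u, f u = l u + f 0.
Proof.
move=> fa; pose l u := f u - f 0.
have lZ a u : l (a *: u) = a *: l u.
  have := fa a u 0; rewrite scaler0 addr0 /l => ->.
  by rewrite scalerBl scale1r scalerBr addrCA [LHS]addrC addKr.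
have two : (2%:R : R) != 0 by rewrite pnatr_eq0.
have lD u w : l (u + w) = l u + l w.
  (* The midpoint of 2 u and 2 w is u + w, which gives additivity. *)
  have := fa (2%:R^-1) (2%:R *: u) (2%:R *: w).
  have h : 1 - 2%:R^-1 = 2%:R^-1 :> R by field.
  rewrite h !scalerA mulVf // !scale1r => E.
  have E2 x : f (2%:R *: x) = 2%:R *: l x + f 0 by rewrite -lZ /l subrK.
  rewrite {1}/l E !E2 !scalerDr !scalerA mulVf // !scale1r addrACA -scalerDl.
  have -> : 2%:R^-1 + 2%:R^-1 = 1 :> R by field.
  by rewrite scale1r addrK.
have l_lin : linear l by move=> a u w; rewrite lD lZ.
exists (linmap l_lin) => u /=.
by rewrite /l subrK.
Qed.

End SmoothFunctions.

Lemma sum4_rev (V : nmodType) (J : finType) (F : J -> J -> J -> J -> V) :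
  \sum_i \sum_j \sum_k \sum_l F i j k l = \sum_l \sum_k \sum_j \sum_i F i j k l.
Proof.
have sum3 (G : J -> J -> J -> V) :
    \sum_j \sum_k \sum_l G j k l = \sum_l \sum_k \sum_j G j k l.
  transitivity (\sum_j \sum_l \sum_k G j k l).
    by apply: eq_bigr => j _; rewrite exchange_big.
  by rewrite exchange_big; apply: eq_bigr => l _; rewrite exchange_big.
transitivity (\sum_i \sum_l \sum_k \sum_j F i j k l).
  by apply: eq_bigr => i _; exact: sum3.
rewrite exchange_big; apply: eq_bigr => l _.
by rewrite exchange_big; apply: eq_bigr => k _; rewrite exchange_big.
Qed.

(** * Poisson brackets of constant bivectors *)

Section ConstantBivector.
Variables (R : realType) (N : nat) (J : finType) (d : J -> 'rV[R]_N) (Pi : J -> J -> R).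
Hypothesis PiC : forall i j, Pi i j = - Pi j i.
Implicit Types (F G H : 'rV[R]_N -> R^o).

Definition pb F G : 'rV[R]_N -> R^o :=
  fun u => \sum_i \sum_j Pi i j * ('D_(d i) F u * 'D_(d j) G u).

Lemma Cinfty_pb F G : Cinfty F -> Cinfty G -> Cinfty (pb F G).
Proof.
move=> CF CG; apply: Cinfty_sum => i; apply: Cinfty_sum => j.
by apply: CinftyZ; apply: CinftyM; exact: Cinfty_derive.
Qed.

Lemma pbC F G u : pb F G u = - pb G F u.
Proof.
rewrite /pb exchange_big -sumrN; apply: eq_bigr => i _; rewrite -sumrN.
by apply: eq_bigr => j _; rewrite PiC; ring.
Qed.

Lemma pb_linear k F G H u : Cinfty F -> Cinfty G ->
  pb (fun u => k * F u + G u) H u = k * pb F H u + pb G H u.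
Proof.
move=> CF CG; rewrite /pb mulr_sumr -big_split; apply: eq_bigr => i _ /=.
rewrite mulr_sumr -big_split; apply: eq_bigr => j _ /=.
by rewrite derive_add ?derive_scale //; [ring|exact: CinftyZ].
Qed.

Lemma pb_leibniz F G H u : Cinfty F -> Cinfty G ->
  pb (fun u => F u * G u) H u = F u * pb G H u + pb F H u * G u.
Proof.
move=> CF CG; rewrite /pb mulr_sumr mulr_suml -big_split; apply: eq_bigr => i _ /=.
rewrite mulr_sumr mulr_suml -big_split; apply: eq_bigr => j _ /=.
by rewrite derive_mul //; ring.
Qed.

Lemma derive_pb F G v u : Cinfty F -> Cinfty G ->
  'D_v (pb F G) u = pb (fun u => 'D_v F u) G u + pb F (fun u => 'D_v G u) u.
Proof.
move=> CF CG.
rewrite /pb derive_bigsum => [|i]; last first.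
  by apply: Cinfty_sum => j; apply: CinftyZ; apply: CinftyM; exact: Cinfty_derive.
rewrite -big_split; apply: eq_bigr => i _ /=.
rewrite derive_bigsum => [|j]; last first.
  by apply: CinftyZ; apply: CinftyM; exact: Cinfty_derive.
rewrite -big_split; apply: eq_bigr => j _ /=.
rewrite derive_scale; last by apply: CinftyM; exact: Cinfty_derive.
rewrite derive_mul; try exact: Cinfty_derive.
rewrite (deriveC u (d i) v CF) (deriveC u (d j) v CG).
by rewrite [X in _ * X]addrC mulrDr.
Qed.

(* {F, {G, H}} = T F G H - T F H G, where T contracts the Hessian of its second
   argument and T F G H = T H G F. *)
Lemma pb_jacobi F G H u : Cinfty F -> Cinfty G -> Cinfty H ->
  pb F (pb G H) u + pb G (pb H F) u + pb H (pb F G) u = 0.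
Proof.
pose T F G H : R := \sum_i \sum_j Pi i j * ('D_(d i) F u * pb (fun u => 'D_(d j) G u) H u).
have pbE F' G' H' : Cinfty G' -> Cinfty H' -> pb F' (pb G' H') u = T F' G' H' - T F' H' G'.
  move=> CG CH; rewrite /T -sumrB; apply: eq_bigr => i _; rewrite -sumrB.
  apply: eq_bigr => j _; rewrite derive_pb // [pb G' _ u]pbC; ring.
have TC F' G' H' : Cinfty G' -> T F' G' H' = T H' G' F'.
  move=> CG; rewrite /T.
  transitivity (\sum_i \sum_j \sum_k \sum_l Pi i j * Pi k l *
     ('D_(d i) F' u * 'D_(d k) (fun u => 'D_(d j) G' u : R^o) u * 'D_(d l) H' u)).
    apply: eq_bigr => i _; apply: eq_bigr => j _; rewrite /pb !mulr_sumr.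
    apply: eq_bigr => k _; rewrite !mulr_sumr; apply: eq_bigr => l _; ring.
  transitivity (\sum_l \sum_k \sum_j \sum_i Pi i j * Pi k l *
     ('D_(d i) F' u * 'D_(d k) (fun u => 'D_(d j) G' u : R^o) u * 'D_(d l) H' u)).
    exact: (sum4_rev (fun i j k l => Pi i j * Pi k l *
     ('D_(d i) F' u * 'D_(d k) (fun u => 'D_(d j) G' u : R^o) u * 'D_(d l) H' u))).
  apply: eq_bigr => l _; apply: eq_bigr => k _; rewrite /pb !mulr_sumr.
  apply: eq_bigr => j _; rewrite !mulr_sumr; apply: eq_bigr => i _.
  rewrite (deriveC u (d j) (d k) CG) (PiC i j) (PiC k l); ring.
move=> CF CG CH; rewrite !pbE // (TC F G) // (TC G H) // (TC H F) //; ring.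
Qed.

Variables (E : Type) (Lam : 'rV[R]_N -> E) (rep : E -> 'rV[R]_N) (sm : set (E -> R)).
Hypothesis repK : cancel rep Lam.
Hypothesis LamD : forall u u' w, Lam u = Lam u' -> Lam (u + w) = Lam (u' + w).
Hypothesis smE : forall f, sm f <-> Cinfty (fun u => f (Lam u) : R^o).

(** [Lam] may be many-to-one. By [LamD] equal images stay equal under translations, so the
    derivatives of [f] through [Lam] do not depend on the preimage [rep x]. *)
Definition cbr : bracket R E := fun f g x =>
  pb (fun u => f (Lam u)) (fun u => g (Lam u)) (rep x).

Lemma derive_chart (f : E -> R) u u' v : Lam u = Lam u' ->
  'D_v (fun u => f (Lam u) : R^o) u = 'D_v (fun u => f (Lam u) : R^o) u'.
Proof.
move=> uu; have [h|_ ->//] := @derive_congr R _ _ (fun u => f (Lam u) : R^o)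
  (fun u => f (Lam u) : R^o) u v u' v.
by rewrite ![h *: v + _]addrC (LamD _ uu).
Qed.

Lemma cbrE f g u : cbr f g (Lam u) = pb (fun u => f (Lam u)) (fun u => g (Lam u)) u.
Proof.
apply: eq_bigr => i _; apply: eq_bigr => j _; congr (_ * (_ * _)); apply: derive_chart;
exact: repK.
Qed.

Lemma cbr_chart f g : (fun u => cbr f g (Lam u) : R^o) =
  pb (fun u => f (Lam u)) (fun u => g (Lam u)).
Proof. by apply/funext => u; exact: cbrE. Qed.

Lemma cbr_poisson : poisson sm cbr.
Proof.
split=> [f g|k f g h|f g|f g h|f g h].
- by move=> /smE Cf /smE Cg; apply/smE; rewrite cbr_chart; exact: Cinfty_pb.
- by move=> /smE Cf /smE Cg _; apply/funext => x; exact: pb_linear.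
- by move=> _ _; apply/funext => x; exact: pbC.
- by move=> /smE Cf /smE Cg _; apply/funext => x; rewrite /cbr pb_leibniz // repK.
- by move=> /smE Cf /smE Cg /smE Ch x; rewrite /cbr !cbr_chart pb_jacobi.
Qed.

End ConstantBivector.

(** * Classes of an equivalence relation *)

Section ClassQuotientTheory.
Variables (T : Type) (r : T -> T -> Prop).

Lemma cpi_crepr (C : cquot r) : cpi r (crepr C) = C.
Proof. by case: C => C h; apply: eq_exist => /=; rewrite -(projT2 (cid h)). Qed.

Hypotheses (r_refl : forall x, r x x) (r_sym : forall x y, r x y -> r y x)
  (r_trans : forall x y z, r x y -> r y z -> r x z).

Lemma cpi_eq x y : cpi r x = cpi r y <-> r x y.
Proof.
split=> [[E]|xy]; first by have : r y y by []; rewrite -E.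
apply: eq_exist; apply/funext => z; apply/propext; split; first exact/r_trans/r_sym.
exact: r_trans.
Qed.

End ClassQuotientTheory.

(** * The affine space of generalized shapes and its chart *)

Section ShapeSpace.
Variables (R : realType) (X : manifold).
Local Notation A := {ffun tedge X -> R^o}.
Local Notation G := {ffun cell1 X -> R^o}.
Local Notation gauge := (@gauge_equiv R X).
Implicit Types (x : A) (g : G) (al be : gshape R X).

Lemma sum_vertex x (s : flag X) :
  \sum_(e : edge | s.2 pos0 \in val e) x (s.1, e) =
  x (fedge s) + x (fedge (frot s)) + x (fedge (frot (frot s))).
Proof.
have [n01 n02 n03 [n12 n13 n23]] := pos_neq s.2.
pose e1 := (fedge s).2; pose e2 := (fedge (frot s)).2; pose e3 := (fedge (frot (frot s))).2.
have v1 : val e1 = [set s.2 pos0; s.2 pos1]%SET by [].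
have v2 : val e2 = [set s.2 pos0; s.2 pos2]%SET.
  by rewrite -[val _]/[set (frot s).2 pos0; (frot s).2 pos1]%SET !flagE.
have v3 : val e3 = [set s.2 pos0; s.2 pos3]%SET.
  by rewrite -[val _]/[set (frot (frot s)).2 pos0; (frot (frot s)).2 pos1]%SET !flagE.
have in1 k : s.2 k \in val e1 = (k \in [set pos0; pos1]%SET) by rewrite v1 !finset.inE !(inj_eq perm_inj).
have in2 k : s.2 k \in val e2 = (k \in [set pos0; pos2]%SET) by rewrite v2 !finset.inE !(inj_eq perm_inj).
have in3 k : s.2 k \in val e3 = (k \in [set pos0; pos3]%SET) by rewrite v3 !finset.inE !(inj_eq perm_inj).
have d21 : e2 != e1.
  by apply/eqP => E; have := in1 pos2; rewrite -E in2 !finset.inE !posE.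
have d31 : e3 != e1.
  by apply/eqP => E; have := in1 pos3; rewrite -E in3 !finset.inE !posE.
have d32 : e3 != e2.
  by apply/eqP => E; have := in2 pos3; rewrite -E in3 !finset.inE !posE.
rewrite (bigD1 e1) /= ?in1 ?inE ?eqxx // (bigD1 e2) /= ?in2 ?inE ?eqxx ?d21 //.
rewrite (bigD1 e3) /= ?in3 ?inE ?eqxx ?d31 ?d32 // big1 ?addr0 ?addrA //.
move=> e /andP[/andP[/andP[se ne1] ne2] ne3]; exfalso.
have /cards2P[u [v [uv eE]]] := valP e.
have [w [wE ws]] : exists w, val e = [set s.2 pos0; w]%SET /\ w != s.2 pos0.
  rewrite eE; have : s.2 pos0 \in [set u; v]%SET by rewrite -eE.
  rewrite !finset.inE => /orP[]/eqP su; rewrite su; first by exists v; rewrite eq_sym.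
  by exists u; rewrite finset.setUC.
case: (perm_surj4 s.2 w) => wk; rewrite wk in wE ws.
- by rewrite eqxx in ws.
- by case/eqP: ne1; apply: val_inj; rewrite wE v1.
- by case/eqP: ne2; apply: val_inj; rewrite wE v2.
- by case/eqP: ne3; apply: val_inj; rewrite wE v3.
Qed.

Lemma angle_sumsP x : angle_sums x <-> forall s, positive s ->
  x (fedge s) + x (fedge (frot s)) + x (fedge (frot (frot s))) = pi.
Proof.
split=> [/'forall_'forall_eqP xs s sp|xs]; first by rewrite -sum_vertex xs.
apply/'forall_'forall_eqP => T v.
have [s [sp sT sv]] : exists s : flag X, [/\ positive s, s.1 = T & s.2 pos0 = v].
  have [sp|sp] := boolP (positive ((T, tperm pos0 v) : flag X)).
    by exists (T, tperm pos0 v); rewrite /= tpermL.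
  exists (frev (T, tperm pos0 v)); rewrite pos_frev sp; split => //.
  by have [-> _ _ _] := frevE ((T, tperm pos0 v) : flag X); rewrite /= tpermL.
by rewrite -(xs s sp) -sum_vertex sT sv.
Qed.

Fact regular_subproof : angle_sums ([ffun _ => pi / 3%:R] : A).
Proof. by apply/angle_sumsP => s _; rewrite !ffunE; field. Qed.

(** The regular shape serves as origin. The 1/3 in [level_shift] is its angle over pi, so all level
    shifts vanish there. *)
Definition al0 : gshape R X := Sub [ffun _ => pi / 3%:R] regular_subproof.

Lemma tangent_sub al be : tangent (val be - val al).
Proof.
move=> s sp; have /angle_sumsP/(_ s sp) := valP al; have /angle_sumsP/(_ s sp) := valP be.
rewrite !ffunE => h1 h2; lra.
Qed.

Lemma tangent_proj : exists P : {linear A -> A}, forall x,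
  tangent (P x) /\ forall m : A, tangent m -> dot (P x) m = dot x m.
Proof.
pose L x : {ffun flag X -> R^o} := [ffun s => if positive s then
  x (fedge s) + x (fedge (frot s)) + x (fedge (frot (frot s))) else 0].
have L_lin : linear L.
  move=> k x y; apply/ffunP => s; rewrite !ffunE.
  by case: ifP => _; rewrite ?scaler0 ?addr0 // /GRing.scale /=; ring.
have LE x : L x = 0 <-> tangent x.
  split=> [/ffunP Lx s sp|xt]; first by have := Lx s; rewrite !ffunE sp.
  by apply/ffunP => s; rewrite !ffunE; case: ifP => // sp; exact: xt.
have [P PE] := orth_proj (linmap L_lin).
by exists P => x; have [/LE Px Pm] := PE x; split=> // m /LE; exact: Pm.
Qed.

Definition tproj : {linear A -> A} := sval (cid tangent_proj).

Lemma tprojP x : tangent (tproj x) /\ forall m : A, tangent m -> dot (tproj x) m = dot x m.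
Proof. exact: (svalP (cid tangent_proj)). Qed.

Lemma tangentB x y : tangent x -> tangent y -> tangent (x - y).
Proof. by move=> xt yt; rewrite addrC -scaleN1r; exact: tangentP. Qed.

Lemma tproj_unique x y : tangent y -> (forall m, tangent m -> dot y m = dot x m) ->
  tproj x = y.
Proof.
move=> yt ym; have [xt xm] := tprojP x.
apply/eqP; rewrite -subr_eq0; apply/eqP/dot_eq0.
by rewrite dotBl xm ?ym ?subrr //; exact: tangentB.
Qed.

Lemma tproj_id x : tangent x -> tproj x = x.
Proof. by move=> xt; exact: tproj_unique. Qed.

(** A skew operator with tangent image kills the complement of the tangent space. *)
Lemma epsop_tproj x : epsop (tproj x) = epsop x.
Proof.
apply/ffunP => a; rewrite !(epsop_dot _ a) ![dot (epsop _) _]dotC.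
by rewrite (tprojP x).2 //; exact: tangent_epsop.
Qed.

Lemma dot_tproj x y : dot (tproj x) y = dot x (tproj y).
Proof.
have [xt xm] := tprojP x; have [yt ym] := tprojP y.
by rewrite dotC -ym // dotC xm.
Qed.

Fact shift_subproof al x : angle_sums (val al + tproj x).
Proof.
apply/angle_sumsP => s sp; have /angle_sumsP/(_ s sp) := valP al.
have := (tprojP x).1 s sp; rewrite !ffunE => h1 h2; lra.
Qed.

(** Projecting first makes translation total; for tangent [x] it is the plain one. *)
Definition shiftg al x : gshape R X := Sub (val al + tproj x) (shift_subproof al x).

Lemma val_shiftg al x : tangent x -> val (shiftg al x) = val al + x.
Proof. by move=> xt; rewrite /= tproj_id. Qed.

Lemma shiftg_sub al be : shiftg al (val be - val al) = be.
Proof.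
by apply: val_inj; rewrite val_shiftg; [rewrite addrC subrK|exact: tangent_sub].
Qed.

Lemma epsop_pullg g a :
  epsop (pullg g) a = \sum_b eps R (quad a) (quad b) * g (phi31 b).
Proof. by rewrite ffunE; apply: eq_bigr => b _; rewrite ffunE. Qed.

Lemma shape_movedP g al be : shape_moved g al be <->
  val be - val al = pi *: epsop (pullg g).
Proof.
split=> [h|/ffunP h a].
  by apply/ffunP => a; rewrite 2!ffunE h [RHS]ffunE epsop_pullg addrAC subrr add0r.
by have := h a; rewrite 2!ffunE [RHS]ffunE epsop_pullg => E; rewrite -[X in _ + X]E addrC subrK.
Qed.

Lemma pi_neq0 : pi != 0 :> R.
Proof. by rewrite gt_eqF // pi_gt0. Qed.

Lemma basedZ (k : R) g : based g -> based (k *: g).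
Proof. by move=> gb e /gb ge; rewrite ffunE ge scaler0. Qed.

Lemma gauge_equivP al be : gauge al be <-> gauged (val be - val al).
Proof.
split=> [[g gb /shape_movedP ->]|[g gE]].
  by apply: gaugedZ; exact: gauged_based.
exists (pi^-1 *: interior_part g); first exact/basedZ/based_interior.
apply/shape_movedP; rewrite gE 2!linearZ /= scalerA.
by rewrite divff ?pi_neq0 // scale1r.
Qed.

Lemma gauge_refl al : gauge al al.
Proof. by apply/gauge_equivP; rewrite subrr; exact: gauged0. Qed.
Lemma gauge_sym al be : gauge al be -> gauge be al.
Proof. by move=> /gauge_equivP h; apply/gauge_equivP; rewrite -opprB; exact: gaugedN. Qed.
Lemma gauge_trans al be ga : gauge al be -> gauge be ga -> gauge al ga.
Proof.
move=> /gauge_equivP h1 /gauge_equivP h2; apply/gauge_equivP.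
have -> : val ga - val al = (val ga - val be) + (val be - val al) by rewrite addrA subrK.
exact: gaugedD.
Qed.

Lemma Sr_eq al be : cpi gauge al = cpi gauge be <-> gauged (val be - val al).
Proof.
apply: iff_trans (gauge_equivP al be); apply: cpi_eq;
  [exact: gauge_refl|exact: gauge_sym|exact: gauge_trans].
Qed.

Lemma Sr_surj (x : Sr R X) : exists al, x = cpi gauge al.
Proof. by exists (crepr x); rewrite cpi_crepr. Qed.

Lemma crepr_Sr al : gauged (val al - val (crepr (cpi gauge al))).
Proof. by apply/Sr_eq; rewrite cpi_crepr. Qed.

Lemma weightE al : weight al = wt (val al).
Proof. by apply/ffunP => e; rewrite !ffunE. Qed.

Lemma Omega_rE al : Omega_r (cpi gauge al) = wt (val al).
Proof.
rewrite /Omega_r weightE; apply/esym/eqP; rewrite -subr_eq0 -(linearB (@wt R X)).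
by apply/eqP; have [] := flat_gauged (crepr_Sr al).
Qed.

Lemma gauged_tproj x y al : gauged (x - y) -> tangent x -> tangent y ->
  cpi gauge (shiftg al x) = cpi gauge (shiftg al y).
Proof.
move=> xy xt yt; apply/Sr_eq; rewrite !val_shiftg // opprD addrACA subrr add0r.
by rewrite -opprB; exact: gaugedN.
Qed.

Definition vecr x : 'rV[R]_#|{: tedge X}| := \row_i x (enum_val i).
Definition unvecr (u : 'rV[R]_#|{: tedge X}|) : A := [ffun a => u 0 (enum_rank a)].

Fact vecr_is_linear : linear vecr.
Proof. by move=> k x y; apply/rowP => i; rewrite !mxE !ffunE. Qed.
HB.instance Definition _ := GRing.isLinear.Build R A _ _ vecr vecr_is_linear.
Fact unvecr_is_linear : linear unvecr.
Proof. by move=> k x y; apply/ffunP => i; rewrite !ffunE !mxE. Qed.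
HB.instance Definition _ := GRing.isLinear.Build R _ A _ unvecr unvecr_is_linear.

Lemma vecrK : cancel vecr unvecr.
Proof. by move=> x; apply/ffunP => a; rewrite ffunE mxE enum_rankK. Qed.
(** A redundant chart that forgets the directions orthogonal to the tangent space, so no basis of
    tangent vectors is chosen. *)
Definition chart (u : 'rV[R]_#|{: tedge X}|) : gshape R X := shiftg al0 (unvecr u).
Definition unchart al : 'rV[R]_#|{: tedge X}| := vecr (val al - val al0).

Lemma unchartK : cancel unchart chart.
Proof. by move=> al; rewrite /chart vecrK shiftg_sub. Qed.

Lemma val_chart u : val (chart u) = val al0 + tproj (unvecr u).
Proof. by []. Qed.

Lemma val_chartD u w : val (chart (u + w)) = val (chart u) + tproj (unvecr w).
Proof. by rewrite !val_chart (linearD unvecr) (linearD tproj) addrA. Qed.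

Lemma chartD u u' w : chart u = chart u' -> chart (u + w) = chart (u' + w).
Proof. by move=> uu; apply: val_inj; rewrite !val_chartD uu. Qed.

(** Reduces smoothness along all affine maps to smoothness in the one chart. *)
Lemma affine_gshape n (L : 'rV[R]_n -> gshape R X) :
    affine_map (fun u => val (L u)) ->
  exists (l : {linear 'rV[R]_n -> 'rV[R]_#|{: tedge X}|}) b, forall u, L u = chart (l u + b).
Proof.
move=> La; have [l lE] := affine_map_linear La.
exists (linmap (linearP (vecr \o l))), (unchart (L 0)) => u.
apply: val_inj; rewrite addrC val_chartD unchartK /= vecrK lE addrC; congr (_ + _).
rewrite tproj_id // (_ : l u = val (L u) - val (L 0)); first exact: tangent_sub.
by rewrite lE addrK.
Qed.

Lemma affine_comp (U V W : lmodType R) (f : U -> V) (l : {linear V -> W}) (c : W) :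
  affine_map f -> affine_map (fun u => l (f u) + c).
Proof.
move=> fa t u w; rewrite fa linearP linearZ !scalerDr addrACA -scalerDl.
by rewrite addrC [t + _]addrC subrK scale1r addrC.
Qed.

Lemma affine_chart : affine_map (fun u => val (chart u)).
Proof.
have -> : (fun u => val (chart u)) = (fun u => (tproj \o unvecr) u + val al0).
  by apply/funext => u; rewrite val_chart addrC.
by apply: (@affine_comp _ _ _ idfun (tproj \o unvecr)) => t u w.
Qed.

Lemma smooth_SE (f : gshape R X -> R) :
  smooth_S f <-> Cinfty (fun u => f (chart u) : R^o).
Proof.
split=> [fs|Cf n L /affine_gshape[l [b lE]]]; first by apply: fs; exact: affine_chart.
rewrite (_ : (fun u => _) = fun u => f (chart (l u + b))).
  exact: (@Cinfty_comp R _ n (fun u => f (chart u)) l b Cf).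
by apply/funext => u; rewrite lE.
Qed.

Lemma Cinfty_affine n (f : 'rV[R]_n -> R^o) : affine_map f -> Cinfty f.
Proof.
move=> fa; have [l lE] := affine_map_linear fa.
rewrite (_ : f = fun u => l u + f 0); first exact: Cinfty_linear.
exact/funext.
Qed.

End ShapeSpace.

(** * The bundle of leveled shapes *)

Section Levels.
Variables (R : realType) (X : manifold).
Local Notation A := {ffun tedge X -> R^o}.
Local Notation G := {ffun cell1 X -> R^o}.
Local Notation gauge := (@gauge_equiv R X).
Local Notation lgauge := (@lgauge_equiv R X).
Implicit Types (x : A) (g : G) (al be : gshape R X) (l t : R).

Lemma level_shiftE g al :
  level_shift g al = - (pi^-1 * dot (pullg g) (val al - val (al0 R X))).
Proof.
rewrite /level_shift -[RHS]mulrN mulrC.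
rewrite (_ : - dot _ _ = dot (pullg g) (val (al0 R X) - val al)); last first.
  by rewrite !dotBr opprB.
rewrite dot_pullg mulr_suml; apply: eq_bigr => e _; rewrite -mulrA; congr (_ * _).
rewrite ffunE mulr_suml; apply: eq_bigr => a _; rewrite !ffunE /=.
by rewrite mulrBl; congr (_ - _); rewrite mulrAC divff ?pi_neq0 // mul1r.
Qed.

Lemma level_shift_moved g al be : based g -> gauged (val be - val al) ->
  level_shift g be = level_shift g al.
Proof.
move=> gb [k kE]; rewrite !level_shiftE; congr (- (_ * _)); apply/eqP.
rewrite -subr_eq0 -dotBr opprB addrA subrK kE dot_pullg.
by rewrite -[X in wt X]/(gaugemap k) wt_gaugemap dot0r.
Qed.

(** Without this the translations of levels would not be free. By [dot_tangent_epsop] the pairing of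
    [pullg g] with a tangent vector is 1/12 of the pairing of their images under [epsop]. *)
Lemma level_shift_ker g al : epsop (pullg g) = 0 -> level_shift g al = 0.
Proof.
move=> g0; rewrite level_shiftE.
have twelve : (12%:R : R) != 0 by rewrite pnatr_eq0.
rewrite (_ : dot _ _ = 0) ?mulr0 ?oppr0 //; apply: (mulfI twelve).
by rewrite mulr0 dotC -dot_tangent_epsop ?g0 ?dot0r //; exact: tangent_sub.
Qed.

Lemma level_shift_lin (k : R) g (h : G) al :
  level_shift (k *: g + h) al = k * level_shift g al + level_shift h al.
Proof.
rewrite !level_shiftE (linearP (@pullg R X)) dotDl dotZl; ring.
Qed.

Lemma lgauge_equivP (u v : lgshape R X) : lgauge u v <-> exists2 g, based g &
  val v.1 - val u.1 = pi *: epsop (pullg g) /\ v.2 = u.2 + level_shift g u.1.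
Proof.
split=> [[g [gb /shape_movedP gm gl]]|[g gb [gm gl]]]; exists g => //.
by split=> //; exact/shape_movedP.
Qed.

Lemma moved_gauged g x : based g -> x = pi *: epsop (pullg g) -> gauged x.
Proof. by move=> gb ->; apply: gaugedZ; exact: gauged_based. Qed.

Lemma lgauge_refl u : lgauge u u.
Proof.
apply/lgauge_equivP; exists 0; first by move=> e _; rewrite ffunE.
rewrite subrr (linear0 (@pullg R X)) linear0 scaler0; split=> //.
by rewrite level_shift_ker ?addr0 // (linear0 (@pullg R X)) linear0.
Qed.

Lemma lgauge_sym u v : lgauge u v -> lgauge v u.
Proof.
move=> /lgauge_equivP[g gb [gm gl]]; apply/lgauge_equivP; exists (-1 *: g); first exact: basedZ.
split; first by rewrite 2!linearZ /= -opprB gm scaleN1r scalerN.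
rewrite -[_ *: g]addr0 level_shift_lin (level_shift_ker (g := 0)) ?addr0; last first.
  by rewrite (linear0 (@pullg R X)) linear0.
by rewrite (level_shift_moved gb (moved_gauged gb gm)) gl mulN1r addrK.
Qed.

Lemma lgauge_trans u v w : lgauge u v -> lgauge v w -> lgauge u w.
Proof.
move=> /lgauge_equivP[g gb [gm gl]] /lgauge_equivP[h hb [hm hl]].
apply/lgauge_equivP; exists (1 *: h + g).
  by move=> e eb; rewrite !ffunE gb // hb // scaler0 addr0.
split.
  by rewrite 2!linearP /= !scale1r scalerDr -hm -gm addrA subrK.
rewrite level_shift_lin mul1r hl gl -addrA [level_shift g _ + _]addrC.
by rewrite (level_shift_moved hb (moved_gauged gb gm)).
Qed.

Lemma LSr_eq u v : cpi lgauge u = cpi lgauge v <-> lgauge u v.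
Proof. by apply: cpi_eq; [exact: lgauge_refl|exact: lgauge_sym|exact: lgauge_trans]. Qed.

Lemma LSr_surj (u : LSr R X) : exists al l, u = cpi lgauge (al, l).
Proof. by exists (crepr u).1, (crepr u).2; rewrite -surjective_pairing cpi_crepr. Qed.

Lemma lgauge_gauge u v : lgauge u v -> gauged (val v.1 - val u.1).
Proof. by move=> /lgauge_equivP[g gb [gm _]]; exact: moved_gauged gm. Qed.

Lemma forgetE al l : forget (cpi lgauge (al, l)) = cpi gauge al.
Proof.
by apply/Sr_eq; apply: (lgauge_gauge (v := (al, l))); apply/LSr_eq; rewrite cpi_crepr.
Qed.

Lemma lgauge_addl u v t : lgauge u v -> lgauge (u.1, u.2 + t) (v.1, v.2 + t).
Proof.
move=> /lgauge_equivP[g gb [gm gl]]; apply/lgauge_equivP; exists g => //; split=> //=.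
by rewrite gl addrAC.
Qed.

Lemma level_actE t al l :
  level_act t (cpi lgauge (al, l)) = cpi lgauge (al, l + t).
Proof.
by apply/LSr_eq; apply: (lgauge_addl (v := (al, l))); apply/LSr_eq; rewrite cpi_crepr.
Qed.

Lemma lgauge_transport al be l : gauge al be -> exists l', lgauge (al, l) (be, l').
Proof.
move=> [g gb gm]; exists (l + level_shift g al); apply/lgauge_equivP; exists g => //.
by split=> //; exact/shape_movedP.
Qed.

Definition ginv_map : {linear A -> G} := sval (cid (linear_ginv (@gaugemap R X))).

Lemma ginv_mapK g : gaugemap (ginv_map (gaugemap g)) = gaugemap g.
Proof. exact: (svalP (cid (linear_ginv (@gaugemap R X)))). Qed.

(** A based gauge parameter that realizes the gauge direction [x], chosen linearly; [pi^-1] undoes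
    the factor in [shape_moved]. *)
Definition gpart x : G := pi^-1 *: interior_part (ginv_map x).

Lemma gpart_based x : based (gpart x).
Proof. exact/basedZ/based_interior. Qed.

Lemma epsop_gpart x : epsop (pullg (gpart x)) = pi^-1 *: gaugemap (ginv_map x).
Proof. by rewrite 2!linearZ. Qed.

Fact interior_part_is_linear : linear (@interior_part R X).
Proof.
by move=> k g h; apply/ffunP => e; rewrite !ffunE; case: ifP; rewrite ?scaler0 ?addr0.
Qed.
HB.instance Definition _ := GRing.isLinear.Build R G G _ (@interior_part R X)
  interior_part_is_linear.

Fact gpart_is_linear : linear gpart.
Proof.
move=> k x y; rewrite /gpart (linearP ginv_map) (linearP (@interior_part R X)) scalerDr !scalerA.
by rewrite mulrC.
Qed.
HB.instance Definition _ := GRing.isLinear.Build R A G _ gpart gpart_is_linear.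

(* [l - lnorm al] is gauge invariant, hence a fiber coordinate for the levels. *)
Definition lnorm al : R := level_shift (gpart (val al - val (al0 R X))) al.

Lemma lnorm_moved u v : lgauge u v -> v.2 - lnorm v.1 = u.2 - lnorm u.1.
Proof.
move=> /lgauge_equivP[g gb [gm ->]]; rewrite /lnorm.
have mg := moved_gauged gb gm.
rewrite (level_shift_moved (gpart_based _) mg).
have -> : val v.1 - val (al0 R X) =
    pi *: epsop (pullg g) + (val u.1 - val (al0 R X)) by rewrite -gm addrA subrK.
rewrite (linearP gpart) level_shift_lin opprD addrA; congr (_ - _).
rewrite -[RHS]addr0 -addrA; congr (_ + _); apply/eqP; rewrite subr_eq0; apply/eqP.
(* The chosen parameter and [g] move shapes by the same vector, so by [level_shift_ker] they shift
   levels equally. *)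
have E : epsop (pullg (-1 *: (pi *: gpart (epsop (pullg g))) + g)) = 0.
  rewrite (linearP (@pullg R X)) (linearP (@epsop R X)) /= scaleN1r 2!linearZ /= epsop_gpart scalerA.
  rewrite divff ?pi_neq0 // scale1r.
  have -> : epsop (pullg g) = gaugemap g by rewrite /gaugemap interior_based.
  by rewrite ginv_mapK addNr.
have := level_shift_ker u.1 E; rewrite level_shift_lin -[pi *: _]addr0 level_shift_lin.
rewrite (level_shift_ker (g := 0)) ?addr0; last by rewrite (linear0 (@pullg R X)) linear0.
by rewrite mulN1r addrC => /eqP; rewrite subr_eq0 => /eqP.
Qed.

Definition lbase_part x : A := x - gaugemap (ginv_map x).
Fact lbase_part_is_linear : linear lbase_part.
Proof.
move=> k x y; rewrite /lbase_part (linearP ginv_map) (linearP (@gaugemap R X)) scalerBr.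
by rewrite opprD addrACA.
Qed.
HB.instance Definition _ := GRing.isLinear.Build R A A _ lbase_part lbase_part_is_linear.

(** The point of the gauge orbit without gauge part relative to [al0]; with level 0 it defines the
    section [lsec]. *)
Definition lbase al : gshape R X := shiftg (al0 R X) (lbase_part (val al - val (al0 R X))).

Lemma tangent_lbase al : tangent (lbase_part (val al - val (al0 R X))).
Proof. by apply: tangentB; [exact: tangent_sub|exact: tangent_epsop]. Qed.

Lemma lbase_gauge al : gauge al (lbase al).
Proof.
apply/gauge_equivP; rewrite val_shiftg; last exact: tangent_lbase.
rewrite addrAC -[val (al0 R X) - _]opprB /lbase_part addKr.
by apply: gaugedN; eexists.
Qed.

Lemma lbase_moved al be : gauge al be -> lbase al = lbase be.
Proof.
move=> /gauge_equivP[g gE]; congr shiftg.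
have -> : val be - val (al0 R X) = 1 *: gaugemap g + (val al - val (al0 R X)).
  by rewrite scale1r -gE addrA subrK.
rewrite (linearP lbase_part) /= scale1r.
by rewrite [lbase_part (gaugemap g)]/lbase_part ginv_mapK subrr add0r.
Qed.

Lemma lnorm_lbase al : lnorm (lbase al) = 0.
Proof.
apply: level_shift_ker; rewrite epsop_gpart val_shiftg; last exact: tangent_lbase.
rewrite addrC addKr /lbase_part (linearB ginv_map) (linearB (@gaugemap R X)) /=.
by rewrite ginv_mapK subrr scaler0.
Qed.

Definition ltriv (u : LSr R X) : R^o := (crepr u).2 - lnorm (crepr u).1.

Lemma ltrivE al l : ltriv (cpi lgauge (al, l)) = l - lnorm al.
Proof.
rewrite /ltriv -[RHS]/((al, l).2 - lnorm (al, l).1); apply/esym/lnorm_moved/LSr_eq.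
by rewrite cpi_crepr.
Qed.

Definition lsec (x : Sr R X) : LSr R X := cpi lgauge (lbase (crepr x), 0).

Lemma lsecE al : lsec (cpi gauge al) = cpi lgauge (lbase al, 0).
Proof.
by rewrite /lsec (lbase_moved (be := al)) //; apply/gauge_equivP; exact: crepr_Sr.
Qed.

Lemma affine_gpair n (L : 'rV[R]_n -> lgshape R X) :
    affine_map (fun u => ((val (L u).1, (L u).2) : (A * R^o)%type)) ->
  affine_map (fun u => val (L u).1) /\ affine_map (fun u => (L u).2 : R^o).
Proof. by move=> La; split=> t u w; have [] := La t u w. Qed.

Lemma ffun_lin2 (I : finType) (f h : {ffun I -> R^o}) (t s : R) i :
  (t *: f + s *: h) i = t *: f i + s *: h i.
Proof. by rewrite !ffunE. Qed.

(** A quadratic expression: the gauge parameter and the angle defects it multiplies are both affine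
    in the shape. *)
Lemma smooth_lnorm n (L : 'rV[R]_n -> gshape R X) : affine_map (fun u => val (L u)) ->
  Cinfty (fun u => lnorm (L u) : R^o).
Proof.
move=> La; rewrite /lnorm /level_shift; apply: Cinfty_sum => e.
apply: CinftyM.
  apply: Cinfty_affine => t u w; rewrite La.
  have -> : t *: val (L u) + (1 - t) *: val (L w) - val (al0 R X) =
      t *: (val (L u) - val (al0 R X)) + (1 - t) *: (val (L w) - val (al0 R X)).
    rewrite !scalerBr addrACA -opprD -scalerDl [t + _]addrC subrK scale1r //.
  by rewrite (linearD gpart) !(linearZ_LR gpart) ffun_lin2.
apply: Cinfty_sum => a; apply: Cinfty_affine => t u w; rewrite La !ffunE /GRing.scale /=.
by ring.
Qed.

Lemma affine_lbase n (L : 'rV[R]_n -> gshape R X) : affine_map (fun u => val (L u)) ->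
  affine_map (fun u => val (lbase (L u))).
Proof.
move=> La; rewrite (_ : (fun u => _) = fun u =>
  lbase_part (val (L u)) + (val (al0 R X) - lbase_part (val (al0 R X)))).
  exact: affine_comp.
apply/funext => u; rewrite val_shiftg; last exact: tangent_lbase.
by rewrite (linearB lbase_part) addrCA.
Qed.

Lemma level_bundle : affine_bundle (@smooth_LSr R X) (@smooth_Sr R X)
  (@forget R X) (@level_act R X).
Proof.
split.
- by move=> u; have [al [l ->]] := LSr_surj u; rewrite level_actE addr0.
- move=> s t u; have [al [l ->]] := LSr_surj u; rewrite !level_actE.
  by rewrite [s + t]addrC addrA.
- move=> t u; have [al [l ->]] := LSr_surj u. by rewrite level_actE !forgetE.
- move=> u v; have [al [l ->]] := LSr_surj u; have [be [m ->]] := LSr_surj v.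
  rewrite !forgetE => /Sr_eq/gauge_equivP ab.
  have [l' ll'] := lgauge_transport l ab.
  (* After transport to the shape [be] the first level is [l']; the invariant [l - lnorm al] leaves
     no other translation. *)
  exists (m - l'); split.
    rewrite level_actE; apply/LSr_eq/lgauge_sym; have := lgauge_addl (m - l') ll'; rewrite /= [l' + _]addrC subrK.
    by [].
  move=> t; rewrite level_actE => /LSr_eq bt.
  have := lnorm_moved bt; have := lnorm_moved ll'; rewrite /= => h1 h2; lra.
split.
- move=> f fs n L /affine_gpair[La _].
  rewrite (_ : (fun u => _) = fun u => f (cpi gauge (L u).1)); first exact: fs.
  by apply/funext => u; rewrite [L u]surjective_pairing forgetE.
- move=> t f fs n L La.
  rewrite (_ : (fun u => _) = fun u => f (cpi lgauge ((L u).1, (L u).2 + t))); last first.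
    by apply/funext => u; rewrite {1}[L u]surjective_pairing level_actE.
  apply: (fs n (fun u => ((L u).1, (L u).2 + t))) => s u w.
  have [L1 L2] := affine_gpair La; congr (_, _) => /=; first exact: L1.
  rewrite L2 !scalerDr addrACA -scalerDl [s + _]addrC subrK scale1r //.
exists ltriv, lsec; split.
- move=> t u; have [al [l ->]] := LSr_surj u.
  by rewrite level_actE !ltrivE addrA [t + l]addrC.
- move=> k n L La; have [L1 L2] := affine_gpair La.
  rewrite (_ : (fun u => _) = fun u => k (1 : R^o) * ((L u).2 + -1 * lnorm (L u).1)).
    apply: CinftyZ; apply: CinftyD; first exact: Cinfty_affine.
    by apply: CinftyZ; exact: smooth_lnorm.
  apply/funext => u; rewrite {1}[L u]surjective_pairing ltrivE.
  rewrite -[_ - _]mulr1 -[_ * 1]/(_ *: (1 : R^o)) linearZ /= mulN1r mulrC //.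
- move=> u; have [al [l ->]] := LSr_surj u; rewrite forgetE lsecE forgetE ltrivE.
  by split; [apply/Sr_eq/gauge_equivP/gauge_sym/lbase_gauge|rewrite lnorm_lbase subrr].
- move=> f fs n L La.
  rewrite (_ : (fun u => _) = fun u => f (cpi lgauge (lbase (L u), 0))); last first.
    by apply/funext => u; rewrite lsecE.
  apply: (fs n (fun u => (lbase (L u), 0))) => t u w; congr (_, _); last first.
    by rewrite /= !scaler0 addr0.
  exact: affine_lbase.
Qed.

Lemma LSr_posE (u : LSr R X) : @LSr_pos R X u <-> @Sr_pos R X (forget u).
Proof.
split=> [[[al l] /= ap <-]|]; first by rewrite forgetE; exists al.
have [al [l ->]] := LSr_surj u; rewrite forgetE => -[be bp /Sr_eq ba].
have [l' ll'] : exists l', lgauge (al, l) (be, l').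
  by apply: lgauge_transport; apply/gauge_sym/gauge_equivP.
by exists (be, l') => //; apply/LSr_eq/lgauge_sym.
Qed.

End Levels.

(** * The action of cohomology and the bundle of the weight map *)

Section HolonomyAction.
Variables (R : realType) (X : manifold).
Local Notation A := {ffun tedge X -> R^o}.
Local Notation G := {ffun cell1 X -> R^o}.
Local Notation gauge := (@gauge_equiv R X).
Implicit Types (x : A) (g : G) (al be : gshape R X) (v w : H1 R X).

Lemma wtB x (y : A) : wt (x - y) = wt x - wt y.
Proof. exact: linearB. Qed.
Lemma wtD x (y : A) : wt (x + y) = wt x + wt y.
Proof. exact: linearD. Qed.

Definition flatp : {linear A -> A} := sval (cid (flat_proj R X)).

Lemma flatpP x : flat (flatp x) /\ forall m, flat m -> dot (flatp x) m = dot x m.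
Proof. exact: (svalP (cid (flat_proj R X))). Qed.

Definition iota : {linear H1 R X -> A} := sval (cid (h1_angles flatpP)).

Lemma iota_flat v : flat (iota v).
Proof. by have [] := svalP (cid (h1_angles flatpP)). Qed.
Lemma iota_gauged v : gauged (iota v) -> v = 0.
Proof. by have [_ h _ _] := svalP (cid (h1_angles flatpP)); exact: h. Qed.
Lemma iota_onto x : flat x -> exists v, gauged (x - iota v).
Proof. by have [_ _ h _] := svalP (cid (h1_angles flatpP)); exact: h. Qed.
Lemma iota_angles z : gauged (iota (vpi (B1 R X) z) - angles_of flatp (val z)).
Proof. by have [_ _ _ h] := svalP (cid (h1_angles flatpP)); exact: h. Qed.

Lemma iota_tangent v : tangent (iota v). Proof. by have [] := iota_flat v. Qed.

(** [S] lifts weights. Subtracting [S (wt x)] from a tangent [x] leaves a flat vector, which is some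
    [iota v] modulo gauge for a unique [v]; uniqueness makes [tau] linear. *)
Lemma splitting : exists (tau : {linear A -> H1 R X}) (S : {linear G -> A}),
  [/\ forall v, tau (iota v) = v, forall x, gauged x -> tau x = 0,
      forall g, tangent (S g), forall x, tangent x -> wt (S (wt x)) = wt x &
      forall x, tangent x -> tau (S (wt x)) = 0].
Proof.
pose W := linmap (linearP (@wt R X \o @tproj R X)).
have [S1 S1E] := linear_ginv W.
pose S := linmap (linearP (@tproj R X \o S1)).
have St g : tangent (S g) by exact: (tprojP _).1.
have SW x : tangent x -> wt (S (wt x)) = wt x.
  by move=> xt; have := S1E x; rewrite /= (tproj_id xt).
pose K x := tproj R X x - S (wt (tproj R X x)).
have Kf x : flat (K x).
  split; first by apply: tangentB; [exact: (tprojP _).1|exact: St].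
  by rewrite wtB SW ?subrr //; exact: (tprojP _).1.
have KE x : flat x -> K x = x.
  by move=> [xt xw]; rewrite /K tproj_id // xw linear0 subr0.
have K_lin : linear K.
  move=> k x y; rewrite /K (linearP (@tproj R X)) (linearP (@wt R X)) (linearP S).
  by rewrite scalerBr opprD addrACA.
have /choice[tau tauE] : forall x, exists v, gauged (K x - iota v).
  by move=> x; exact: iota_onto.
have tau_uniq x v : gauged (K x - iota v) -> tau x = v.
  move=> xv; apply/eqP; rewrite -subr_eq0; apply/eqP/iota_gauged.
  rewrite (linearB iota) (_ : iota (tau x) - iota v = (K x - iota v) - (K x - iota (tau x))).
    exact: gaugedB.
  by rewrite opprB [RHS]addrC addrA subrK.
have tau_lin : linear tau.
  move=> k x y; apply: tau_uniq; rewrite (linearP iota) K_lin opprD addrACA -scalerBr.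
  exact: gaugedP.
exists (linmap tau_lin), S.
split=> //= [v|x xg|x xt].
- by apply: tau_uniq; rewrite KE ?subrr; [exact: gauged0|exact: iota_flat].
- by apply: tau_uniq; rewrite linear0 subr0 KE //; exact: flat_gauged.
- apply: tau_uniq; rewrite linear0 subr0 /K tproj_id; last exact: St.
  rewrite -[tproj R X (S1 _)]/(S (wt x)) SW // subrr; exact: gauged0.
Qed.

Definition act v (x : Sr R X) : Sr R X := cpi gauge (shiftg (crepr x) (iota v)).

Lemma actE v al : act v (cpi gauge al) = cpi gauge (shiftg al (iota v)).
Proof.
apply/Sr_eq; rewrite !val_shiftg; try exact: iota_tangent.
by rewrite opprD addrACA subrr addr0; exact: crepr_Sr.
Qed.

Lemma act_translations : by_translations act.
Proof.
exists iota => v al; exists (shiftg al (iota v)); last exact: actE.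
by rewrite val_shiftg //; exact: iota_tangent.
Qed.

Lemma actD v w (x : Sr R X) : act (v + w) x = act v (act w x).
Proof.
have [al ->] := Sr_surj x; rewrite !actE; congr cpi; apply: val_inj.
by rewrite /= !(tproj_id (iota_tangent _)) linearD addrAC addrA.
Qed.

Lemma act0 (x : Sr R X) : act 0 x = x.
Proof.
have [al ->] := Sr_surj x; rewrite actE; congr cpi; apply: val_inj.
by rewrite /= !linear0 addr0.
Qed.

Lemma Omega_act v (x : Sr R X) : Omega_r (act v x) = Omega_r x.
Proof.
have [al ->] := Sr_surj x; rewrite actE !Omega_rE val_shiftg; last exact: iota_tangent.
by rewrite wtD; have [_ ->] := iota_flat v; rewrite addr0.
Qed.

Lemma act_trans (x y : Sr R X) : Omega_r x = Omega_r y -> exists v, y = act v x.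
Proof.
have [al ->] := Sr_surj x; have [be ->] := Sr_surj y; rewrite !Omega_rE => wE.
have [v vE] : exists v, gauged (val be - val al - iota v).
  apply: iota_onto; split; first exact: tangent_sub.
  by rewrite wtB wE subrr.
exists v; rewrite actE; apply/esym/Sr_eq; rewrite val_shiftg; last exact: iota_tangent.
by rewrite opprD addrA.
Qed.

Lemma act_free v w (x : Sr R X) : act v x = act w x -> v = w.
Proof.
have [al ->] := Sr_surj x; rewrite !actE => /Sr_eq.
rewrite !val_shiftg; try exact: iota_tangent.
rewrite opprD addrACA subrr add0r -(linearB iota) => /iota_gauged/eqP.
by rewrite subr_eq0 => /eqP.
Qed.

Lemma smooth_SrE (f : Sr R X -> R) :
  smooth_Sr f <-> Cinfty (fun u => f (cpi gauge (chart u)) : R^o).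
Proof. exact: smooth_SE. Qed.

Lemma Omega_bundle : affine_bundle (@smooth_Sr R X) (@smooth_weights R X)
  (@Omega_r R X) act.
Proof.
have [tau [S [tau_iota tau0 St SW tauS]]] := splitting.
split; [exact: act0|exact: actD|exact: Omega_act| |split].
- move=> x y /act_trans[v ->]; exists v; split=> // w; exact: act_free.
- move=> f fs n L La.
  rewrite (_ : (fun u => _) = fun u => f (wt (val (L u)) + 0)).
    by apply: (fs n (fun u => wt (val (L u)) + 0)); exact: affine_comp.
  by apply/funext => u; rewrite Omega_rE addr0.
- move=> v f fs n L La.
  rewrite (_ : (fun u => _) = fun u => f (cpi gauge (shiftg (L u) (iota v)))).
    apply: (fs n (fun u => shiftg (L u) (iota v))).
    rewrite (_ : (fun u => _) = fun u => idfun (val (L u)) + iota v); last first.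
      by apply/funext => u; rewrite val_shiftg //; exact: iota_tangent.
    exact: (@affine_comp R _ _ _ _ (idfun : {linear A -> A})).
  by apply/funext => u; rewrite actE.
pose triv (x : Sr R X) := tau (val (crepr x) - val (al0 R X)).
have trivE al : triv (cpi gauge al) = tau (val al - val (al0 R X)).
  apply/esym/eqP; rewrite -subr_eq0 -(linearB tau); apply/eqP/tau0.
  by rewrite opprB addrA subrK; exact: crepr_Sr.
pose sec (g : G) : Sr R X := cpi gauge (shiftg (al0 R X) (S (g - wt (val (al0 R X))))).
exists triv, sec; split.
- move=> v x; have [al ->] := Sr_surj x; rewrite actE !trivE val_shiftg; last exact: iota_tangent.
  rewrite (_ : _ - _ = iota v + (val al - val (al0 R X))); last by rewrite addrAC addrC.
  by rewrite (linearD tau) tau_iota.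
- move=> l n L La; apply: Cinfty_affine.
  rewrite (_ : (fun u => _) = fun u => (l \o tau) (val (L u)) + - l (tau (val (al0 R X)))).
    exact: (@affine_comp R _ _ R^o _ (l \o tau)).
  by apply/funext => u; rewrite trivE (linearB tau) (linearB l).
- move=> x; have [al ->] := Sr_surj x; rewrite Omega_rE /sec.
  rewrite -wtB Omega_rE trivE val_shiftg; last exact: St.
  have at_ := tangent_sub (al0 R X) al.
  split; last by rewrite addrC addKr tauS.
  by rewrite wtD SW // -wtD addrC subrK.
- move=> f fs n L La.
  apply: (fs n (fun u => shiftg (al0 R X) (S (L u - wt (val (al0 R X)))))).
  rewrite (_ : (fun u => _) = fun u => S (L u) + (val (al0 R X) - S (wt (val (al0 R X))))).
    exact: affine_comp.
  apply/funext => u; rewrite val_shiftg; last exact: St.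
  by rewrite (linearB S) addrCA.
Qed.

End HolonomyAction.

Lemma vpi_lin (R : pzRingType) (V : lmodType R) (B : submodClosed V) k (u v : V) :
  vpi B (k *: u + v) = k *: vpi B u + vpi B v.
Proof. by rewrite vpiD -vpiZ. Qed.
HB.instance Definition _ (R : pzRingType) (V : lmodType R) (B : submodClosed V) :=
  GRing.isLinear.Build R V (vquot B) _ (vpi B) (vpi_lin B).

(** * Poincare-Lefschetz duals of linear functionals *)

Section Duals.
Variables (R : realType) (X : manifold).
Local Notation A := {ffun tedge X -> R^o}.
Local Notation C1 := {ffun flag X -> R^o}.
Implicit Types (x k : A) (c : C1) (z w b : Z1 R X) (v : H1 R X).

Lemma cup_integralC z w : cup_integral z w = - cup_integral w z.
Proof. exact: (pcupC (val z) (val w)). Qed.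

Lemma cup_integralE z w : cup_integral z w = pcup (val z) (val w).
Proof. by []. Qed.

Fact cup_linear z : linear (cup_integral z : Z1 R X -> R^o).
Proof.
move=> k c d; rewrite /cup_integral /GRing.scale /= mulrCA -mulrDr; congr (_ * _).
rewrite mulr_sumr -big_split; apply: eq_bigr => s _ /=.
by rewrite !ffunE /GRing.scale /=; ring.
Qed.
HB.instance Definition _ z :=
  GRing.isLinear.Build R (Z1 R X) R^o _ (cup_integral z) (cup_linear z).

Lemma cup_coboundary b w : b \in B1 R X -> is_relative w -> cup_integral b w = 0.
Proof.
move=> bB wr; have := (coboundary_flat b).1 bB _ (flat_epsop_hop wr).
rewrite dot_epsop_hop_hop; try exact: pcocycle_val; last by left; apply/prelative_val.
move/eqP; rewrite mulf_eq0 oppr_eq0 pnatr_eq0 /= => /eqP h.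
by rewrite cup_integralC cup_integralE h oppr0.
Qed.

Definition is_dual_of (l : Z1 R X -> R) w : Prop :=
  is_relative w /\ forall z, l z = cup_integral z w.

(** Each factor in turn is replaced through the value of its functional, which does not depend on
    the chosen dual. *)
Lemma dual_form l1 l2 w1 w1' w2 w2' : is_dual_of l1 w1 -> is_dual_of l1 w1' ->
  is_dual_of l2 w2 -> is_dual_of l2 w2' -> cup_integral w1 w2 = cup_integral w1' w2'.
Proof.
move=> [_ d1] [_ d1'] [_ d2] [_ d2'].
by rewrite -d2 d2' cup_integralC -d1 d1' cup_integralC opprK.
Qed.

Definition toZ1 : {linear C1 -> Z1 R X} := sval (cid (toZ1_exists R X)).
Lemma toZ1K z : toZ1 (val z) = z.
Proof. by have [] := svalP (cid (toZ1_exists R X)) z 0. Qed.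
Lemma dot_toZ1 c z : dot (val (toZ1 c)) (val z) = dot c (val z).
Proof. by have [] := svalP (cid (toZ1_exists R X)) z c. Qed.

Definition cupvec c : C1 := [ffun s => if positive s
  then 6%:R^-1 * (c (frot s) - c (frot (frot s))) else 0].

Fact cupvec_is_linear : linear cupvec.
Proof.
move=> k c d; apply/ffunP => s; rewrite !ffunE.
by case: ifP => _; rewrite ?scaler0 ?addr0 // /GRing.scale /=; ring.
Qed.
HB.instance Definition _ := GRing.isLinear.Build R C1 C1 _ cupvec cupvec_is_linear.

Lemma dot_cupvec c d : dot (cupvec c) d = pcup d c.
Proof.
rewrite pcupE mulr_sumr [RHS]big_mkcond; apply: eq_bigr => s _; rewrite ffunE.
by case: ifP => _; rewrite ?mul0r //; ring.
Qed.

(** Surjectivity of duality from its injectivity: a vector orthogonal to all functionals given by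
    relative cocycles projects to a coboundary by [pcup_coboundary], and [c] vanishes there. *)
Lemma dual_exists c : (forall b, b \in B1 R X -> dot c (val b) = 0) ->
  exists w, is_dual_of (fun z => dot c (val z)) w.
Proof.
move=> cB; have [Q QE] := cocycle_proj R X true.
pose S := linmap (linearP (val \o toZ1 \o cupvec \o Q)).
have [t tE] : exists t, S t = val (toZ1 c).
  apply: in_range => y yS.
  have sym (d e : C1) : dot (val (toZ1 d)) e = dot d (val (toZ1 e)).
    by rewrite -[RHS](dot_toZ1) dotC -[RHS]dotC -dot_toZ1 dotC.
  rewrite sym; apply: cB; apply: pcup_coboundary => w wr.
  have Qw : Q (val w) = val w.
    have [Qc Qr Qm] := QE (val w).
    apply/eqP; rewrite -subr_eq0; apply/eqP/dot_eq0.
    have Qe e : is_cocycle1 e -> (true -> forall s : flag X, glue (s.1, s.2 pos3) = None -> e s = 0) ->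
      dot (Q (val w) - val w) e = 0 by move=> e1 e2; rewrite dotBl Qm // subrr.
    by rewrite dotBr !Qe ?subrr //; exact: valP.
  by rewrite cup_integralE -dot_cupvec -sym -[in RHS](yS (val w)) /= Qw.
have [Qc Qr _] := QE t; exists (Sub (Q t) Qc : Z1 R X); split.
  by move=> s; exact: Qr.
move=> z; rewrite cup_integralE -dot_cupvec -dot_toZ1 -tE /= dot_toZ1 //.
Qed.

Lemma linear_functional (l : {linear Z1 R X -> R^o}) :
  exists c, forall z, l z = dot c (val z).
Proof.
exists [ffun s => l (toZ1 (ffdelta R s))] => z.
rewrite -{1}(toZ1K z) (linear_sum_delta toZ1) linear_sum.
by apply: eq_bigr => s _; rewrite linearZ ffunE mulrC.
Qed.

Lemma dual_linear (l : {linear Z1 R X -> R^o}) : (forall b, b \in B1 R X -> l b = 0) ->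
  exists w, is_dual_of l w.
Proof.
move=> lB; have [c cE] := linear_functional l.
have [|w [wr wE]] := @dual_exists c; first by move=> b /lB; rewrite cE.
by exists w; split=> // z; rewrite cE wE.
Qed.

Lemma vpi_coboundary b : b \in B1 R X -> vpi (B1 R X) b = 0.
Proof. by move=> bB; rewrite -(vpi0 (B1 R X)); apply/vpi_eq; rewrite subr0. Qed.

(** If [k] is the gradient of a function, this is its derivative along the fiber in the direction of
    the class of [z]. *)
Definition hfun k (z : Z1 R X) : R := dot k (iota R X (vpi (B1 R X) z)).

Lemma hdual_exists k : exists w, is_dual_of (hfun k) w.
Proof.
pose l := dot k \o iota R X \o vpi (B1 R X).
by apply: (dual_linear (l := l)) => b bB; rewrite /l /= (vpi_coboundary bB) linear0 dot0r.
Qed.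

Definition edual (a : tedge X) : Z1 R X := sval (cid (hdual_exists (ffdelta R a))).
(** Duals are chosen for the basis vectors only and extended linearly, so that [PiH] is a constant
    bivector. *)
Definition hdual k : Z1 R X := \sum_a k a *: edual a.

Lemma edualP a : is_dual_of (hfun (ffdelta R a)) (edual a).
Proof. exact: (svalP (cid (hdual_exists (ffdelta R a)))). Qed.

Fact hdual_is_linear : linear hdual.
Proof.
move=> t k l; rewrite /hdual scaler_sumr -big_split; apply: eq_bigr => a _ /=.
by rewrite !ffunE scalerA -scalerDl.
Qed.
HB.instance Definition _ := GRing.isLinear.Build R A (Z1 R X) _ hdual hdual_is_linear.

Lemma val_sum_ffun (I : Type) (r : seq I) (F : I -> Z1 R X) s :
  val (\sum_(i <- r) F i) s = \sum_(i <- r) val (F i) s.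
Proof.
by elim/big_rec2: _ => [|i y u _ <-]; rewrite ?ffunE // [val (_ + _) s]ffunE.
Qed.

Lemma hdualP k : is_dual_of (hfun k) (hdual k).
Proof.
split=> [s sg|z].
  rewrite val_sum_ffun big1 // => a _; have [ar _] := edualP a.
  by rewrite ffunE ar // scaler0.
rewrite /hdual linear_sum /hfun dotC (linear_sum_delta (dot (iota R X (vpi _ z)))).
apply: eq_bigr => a _; rewrite linearZ; congr (_ *: _).
by have [_ h] := edualP a; exact: etrans (dotC _ _) (h z).
Qed.

Definition PiH (a b : tedge X) : R := cup_integral (edual a) (edual b).

Lemma PiHC (a b : tedge X) : PiH a b = - PiH b a.
Proof. exact: cup_integralC. Qed.

Lemma cup_hdual k l : cup_integral (hdual k) (hdual l) =
  \sum_a \sum_b PiH a b * (k a * l b).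
Proof.
have lin z m : cup_integral z (hdual m) = \sum_b m b * cup_integral z (edual b).
  by rewrite /hdual linear_sum; apply: eq_bigr => b _; rewrite linearZ.
rewrite cup_integralC lin -sumrN; apply: eq_bigr => a _.
rewrite -mulrN -cup_integralC lin mulr_sumr.
by apply: eq_bigr => b _; rewrite /PiH; ring.
Qed.

End Duals.

(** * The Neumann-Zagier bracket, its reduction and the cohomological bracket *)

Section Brackets.
Variables (R : realType) (X : manifold).
Local Notation A := {ffun tedge X -> R^o}.
Local Notation gauge := (@gauge_equiv R X).
Local Notation row := ('rV[R]_#|{: tedge X}|).
Implicit Types (x k : A) (al be : gshape R X) (v : H1 R X) (u : row)
  (z w : Z1 R X).

Definition dir (a : tedge X) : row := vecr (ffdelta R a).

Definition grad (F : row -> R^o) u : A := [ffun a => 'D_(dir a) F u].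

Lemma derive_vecr (F : row -> R^o) u x : Cinfty F -> 'D_(vecr x) F u = dot x (grad F u).
Proof.
move=> CF; rewrite (linear_sum_delta (@vecr R X) x) derive_sum_dir //.
by apply: eq_bigr => a _; rewrite ffunE.
Qed.

Lemma epsC (a b : tedge X) : eps R (quad a) (quad b) = - eps R (quad b) (quad a) :> R.
Proof. by rewrite /eps opprB. Qed.

Local Notation Pnz := (fun a b : tedge X => eps R (quad a) (quad b) : R).

Lemma pb_nz (F K : row -> R^o) u :
  pb dir Pnz F K u = dot (grad F u) (epsop (grad K u)).
Proof.
apply: eq_bigr => a _; rewrite [X in _ = _ * X]ffunE mulr_sumr.
by apply: eq_bigr => b _; rewrite [grad F u a]ffunE [grad K u b]ffunE mulrCA.
Qed.

Lemma pb_H (F K : row -> R^o) u :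
  pb dir (@PiH R X) F K u = cup_integral (hdual (grad F u)) (hdual (grad K u)).
Proof.
by rewrite cup_hdual; apply: eq_bigr => a _; apply: eq_bigr => b _; rewrite !ffunE.
Qed.

Definition rchart u : Sr R X := cpi gauge (chart u).
Definition runchart (x : Sr R X) : row := unchart (crepr x).

Lemma runchartK : cancel runchart rchart.
Proof. by move=> x; rewrite /rchart unchartK cpi_crepr. Qed.

Lemma rchart_eq u u' : rchart u = rchart u' <->
  gauged (tproj R X (unvecr u') - tproj R X (unvecr u)).
Proof.
apply: iff_trans (Sr_eq _ _) _; rewrite !val_chart opprD addrACA subrr add0r.
exact: iff_refl.
Qed.

Lemma rchartD u u' (w : row) : rchart u = rchart u' -> rchart (u + w) = rchart (u' + w).
Proof.
move=> /rchart_eq h; apply/rchart_eq.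
by rewrite !(linearD (@unvecr R X)) !(linearD (tproj R X)) opprD addrACA subrr addr0.
Qed.

Lemma rchart_shift u x : rchart (vecr x + u) =
  cpi gauge (shiftg (chart u) x).
Proof.
congr cpi; apply: val_inj; rewrite addrC val_chartD vecrK.
by [].
Qed.

Definition nz : bracket R (gshape R X) := cbr dir Pnz (@chart R X) (@unchart R X).
Definition br : bracket R (Sr R X) := cbr dir Pnz rchart runchart.
Definition brH : bracket R (Sr R X) := cbr dir (@PiH R X) rchart runchart.

Lemma nz_poisson : poisson (@smooth_S R X) nz.
Proof.
apply: cbr_poisson; [exact: epsC|exact: unchartK|exact: chartD|exact: smooth_SE].
Qed.
Lemma br_poisson : poisson (@smooth_Sr R X) br.
Proof.
apply: cbr_poisson; [exact: epsC|exact: runchartK|exact: rchartD|exact: smooth_SrE].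
Qed.
Lemma brH_poisson : poisson (@smooth_Sr R X) brH.
Proof.
apply: cbr_poisson; [exact: PiHC|exact: runchartK|exact: rchartD|exact: smooth_SrE].
Qed.

Lemma nz_angles (a b : tedge X) : nz (fun al => val al a) (fun al => val al b) =
  fun=> eps R (quad a) (quad b).
Proof.
(* The chart projects to tangent vectors, so the gradient of an angle is a projected basis vector;
   [epsop] absorbs the projections. *)
have gradE (c : tedge X) u : grad (fun u => val (chart u) c : R^o) u = tproj R X (ffdelta R c).
  apply/ffunP => d; rewrite ffunE.
  pose l := dot (ffdelta R c) \o tproj R X \o @unvecr R X.
  have -> : (fun u => val (chart u) c : R^o) = fun u => l u + val (al0 R X) c.
    apply/funext => w; rewrite val_chart /l /= dotC dot_delta.
    by rewrite [LHS]ffunE addrC.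
  by rewrite derive_linear /l /= vecrK -dot_tproj dot_delta.
apply/funext => al; rewrite /nz /cbr pb_nz !gradE epsop_tproj dot_tproj.
rewrite tproj_id; last exact: tangent_epsop.
rewrite dotC dot_delta ffunE (bigD1 b) //= ffunE eqxx mulr1 big1 ?addr0 // => c cb.
by rewrite ffunE (negbTE cb) mulr0.
Qed.

Lemma nz_neumann_zagier : neumann_zagier nz.
Proof. split; [exact: nz_poisson|exact: nz_angles]. Qed.

Lemma br_reduction : is_reduction nz br.
Proof.
split; first exact: br_poisson.
move=> f g _ _ al; rewrite -{1}[al]unchartK -[cpi _ _]/(rchart (unchart al)).
exact: (cbrE dir Pnz runchartK rchartD).
Qed.

Section Gradient.
Variables (f : Sr R X -> R).
Hypothesis fs : smooth_Sr f.
Local Notation F := (fun u => f (rchart u) : R^o).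

Lemma dot_grad x u : dot x (grad F u) = 'D_(vecr x) F u.
Proof. by rewrite derive_vecr //; exact/smooth_SrE. Qed.

Lemma grad_gauged x u : gauged x -> dot x (grad F u) = 0.
Proof.
move=> xg; rewrite dot_grad.
have [h|_ ->] := @derive_congr R _ _ F (fun _ : row => f (rchart u) : R^o) u (vecr x) u 0.
  rewrite -(linearZ_LR (@vecr R X)) rchart_shift; congr f.
  apply/esym/Sr_eq; rewrite val_shiftg; first by rewrite addrC addKr; exact: gaugedZ.
  by have [] := flat_gauged (gaugedZ h xg).
by rewrite (@derive_cst _ _ _ (f (rchart u) : R^o)).
Qed.

Lemma act_chart (h : R) v u : act (h *: v) (rchart u) = rchart (h *: vecr (iota R X v) + u).
Proof. by rewrite -(linearZ_LR (@vecr R X)) rchart_shift actE -(linearZ_LR (iota R X)). Qed.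

Lemma grad_linear_on_fiber u (l : R -> R) v :
    (forall h, f (act (h *: v) (rchart u)) = f (rchart u) + h * l 1) ->
  dot (iota R X v) (grad F u) = l 1.
Proof.
move=> fl; rewrite dot_grad.
have [h|_ ->] := @derive_congr R _ R F (fun s : R => s * l 1 + f (rchart u) : R^o) u
   (vecr (iota R X v)) 0 1.
  by rewrite -act_chart fl addr0 /GRing.scale /= mulr1 addrC.
exact: (@derive_val _ _ _ _ _ _ _ (is_derive_affine1 _ _)).
Qed.
End Gradient.

Lemma grad_fiber f f' u v : smooth_Sr f -> smooth_Sr f' ->
    (forall y, Omega_r y = Omega_r (rchart u) -> f y = f' y) ->
  dot (iota R X v) (grad (fun u => f (rchart u) : R^o) u) =
  dot (iota R X v) (grad (fun u => f' (rchart u) : R^o) u).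
Proof.
move=> fs fs' ff; rewrite !dot_grad //.
have [h|_ ->//] := @derive_congr R _ _ (fun u => f (rchart u) : R^o)
  (fun u => f' (rchart u) : R^o) u (vecr (iota R X v)) u (vecr (iota R X v)).
by rewrite -act_chart; apply: ff; rewrite Omega_act.
Qed.

Lemma brHE f g u : brH f g (rchart u) =
  cup_integral (hdual (grad (fun u => f (rchart u) : R^o) u))
               (hdual (grad (fun u => g (rchart u) : R^o) u)).
Proof. by rewrite /brH (cbrE _ _ runchartK rchartD) pb_H. Qed.

Lemma brE f g u : br f g (rchart u) =
  dot (grad (fun u => f (rchart u) : R^o) u)
      (epsop (grad (fun u => g (rchart u) : R^o) u)).
Proof. by rewrite /br (cbrE _ _ runchartK rchartD) pb_nz. Qed.

Lemma cup_hdualE k z : cup_integral z (hdual k) = dot k (iota R X (vpi (B1 R X) z)).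
Proof. by have [_ <-] := hdualP k. Qed.

(** By [cup_hdualE] the bracket meets the gradient of [f] only in a direction [iota v], which is
    tangent to the fiber. *)
Lemma brH_fiber f f' g (x : Sr R X) : smooth_Sr f -> smooth_Sr f' -> smooth_Sr g ->
  (forall y, Omega_r y = Omega_r x -> f y = f' y) -> brH f g x = brH f' g x.
Proof.
rewrite -[x]runchartK => fs fs' gs ff; rewrite !brHE.
rewrite [LHS]cup_integralC [RHS]cup_integralC !cup_hdualE; congr (- _).
by rewrite dotC [RHS]dotC; exact: grad_fiber.
Qed.

(** The Hamiltonian field [epsop l] is flat, hence up to gauge the translation by the class of a
    cocycle [z]. Gradients kill the gauge part, and [key] says that [hdual l] acts in cup products
    as [- z]. *)
Lemma br_closed : closed_manifold X -> forall f g, smooth_Sr f -> smooth_Sr g ->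
  br f g = brH f g.
Proof.
move=> Xc f g fs gs; apply/funext => x; rewrite -[x]runchartK brE brHE.
set u := runchart x; set k := grad _ u; set l := grad _ u.
have kg y : gauged y -> dot k y = 0 by rewrite dotC; exact: (grad_gauged fs).
have lg y : gauged y -> dot l y = 0 by rewrite dotC; exact: (grad_gauged gs).
have lf : flat (epsop l).
  split; first exact: tangent_epsop.
  apply/ffunP => e; rewrite wt_epsop [RHS]ffunE dotC lg ?oppr0 //.
  exact/gauged_based/closed_based.
pose mu : R := (Num.sqrt 2%:R)^-1.
(* One factor [mu] comes from each of the two classes, and 2 from [dot_epsop_hop_hop]. *)
have mu2 : mu * mu * 2%:R = 1.
  have s2 := sqrt2_neq0 R.
  have sq : Num.sqrt 2%:R * Num.sqrt 2%:R = 2%:R :> R by rewrite -expr2 sqr_sqrtr // ler0n.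
  have two : (2%:R : R) != 0 by rewrite pnatr_eq0.
  by rewrite /mu -invfM sq mulVf.
have angE z : angles_of (flatp R X) (val z) = mu *: epsop (hop (val z)).
  by rewrite /angles_of asboolT.
have iotaE m z : (forall y, gauged y -> dot m y = 0) ->
    dot m (iota R X (vpi (B1 R X) z)) = mu * dot m (epsop (hop (val z))).
  move=> mg; have := mg _ (iota_angles z); rewrite dotBr => /eqP.
  by rewrite subr_eq0 => /eqP ->; rewrite angE dotZr.
have [v vg] := iota_onto lf; rewrite -[v]vreprK in vg; set z := vrepr v in vg.
have lE : epsop l = mu *: epsop (hop (val z)) + (epsop l - mu *: epsop (hop (val z))).
  by rewrite addrC subrK.
have rg : gauged (epsop l - mu *: epsop (hop (val z))).
  have := gaugedD vg (iota_angles z); rewrite angE.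
  by rewrite addrA subrK.
rewrite {1}lE dotDr (kg _ rg) addr0 dotZr -(iotaE _ _ kg) -cup_hdualE.
have key w : cup_integral w (hdual l) = cup_integral z w.
  rewrite cup_hdualE (iotaE _ _ lg) -[dot l _]opprK -dot_epsopC lE dotDl.
  rewrite (dot_gauged_hop _ rg) addr0 dotZl dot_epsop_hop_hop; first last.
  - by left; apply/prelative_val/closed_relative.
  - exact: pcocycle_val.
  - exact: pcocycle_val.
  rewrite -cup_integralE; transitivity (mu * mu * 2%:R * cup_integral z w); first by ring.
  by rewrite mu2 mul1r.
by rewrite key.
Qed.

End Brackets.

(** * Cycles, intersection numbers and symplectic leaves *)

Section Cycles.
Variables (R : realType) (X : manifold).
Local Notation A := {ffun tedge X -> R^o}.
Local Notation C1 := {ffun flag X -> R^o}.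
Implicit Types (c : C1) (w b : Z1 R X) (v : H1 R X).

Let src_rel : rel (flag X) := fun x y => glued x y || (y == fflip x).

Let src_sym : connect_sym src_rel.
Proof.
apply: sym_connect_sym => x y; rewrite /src_rel; congr orb; last first.
  by apply/eqP/eqP => ->; rewrite fflipK.
by rewrite !gluedE; apply/eqP/eqP; exact: fglue_sym.
Qed.

Lemma same_source_flip (x : flag X) : same_source (frev x) (frot x).
Proof. by apply: connect1; rewrite -frev_fflip eqxx orbT. Qed.

(** Grouped by 0-cells, each represented by the root of its component, the sum evaluates [f] on the
    boundary of [z]. *)
Lemma cycle_coboundary (z : C1) b : is_cycle1 z -> b \in B1 R X -> dot z (val b) = 0.
Proof.
move=> zc /asboolP[f /'forall_'forall_implyP f0 fb].
have part (g : flag X -> flag X) : \sum_x z x * f (g x) =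
    \sum_r f r * \sum_(x | fingraph.root src_rel (g x) == r) z x.
  rewrite (partition_big (fun x => fingraph.root src_rel (g x)) predT) //=; apply: eq_bigr => r _.
  rewrite mulr_sumr; apply: eq_bigr => x /eqP <-; rewrite mulrC; congr (_ * _).
  by apply/eqP/f0; exact: connect_root.
transitivity (\sum_x z x * f (frev x) - \sum_x z x * f x).
  by rewrite -sumrB; apply: eq_bigr => x _; rewrite fb mulrBr.
rewrite (part (@frev X)) (part id); apply/eqP; rewrite subr_eq0; apply/eqP.
apply: eq_bigr => r _; congr (_ * _).
have [rr|nr] := eqVneq (fingraph.root src_rel r) r; last first.
  by rewrite !big1 // => x /eqP xr; case/eqP: nr; rewrite -xr root_root.
rewrite (eq_bigl (fun x => same_source r (frev x))); last first.
  by move=> x; rewrite -{1}rr eq_sym root_connect.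
rewrite [RHS](eq_bigl (fun x => same_source r x)); last first.
  by move=> x; rewrite -{1}rr eq_sym root_connect.
exact: zc.
Qed.

(** The coboundary of the indicator of a 0-cell reads off the boundary coefficient there. *)
Lemma cycle_of (c : C1) : (forall b, b \in B1 R X -> dot c (val b) = 0) -> is_cycle1 c.
Proof.
move=> cB x0; pose f : C1 := [ffun x => (same_source x0 x)%:R].
have ff x y : same_source x y -> f x = f y.
  move=> xy; rewrite !ffunE; congr (nat_of_bool _)%:R.
  by apply/idP/idP => h; apply: connect_trans h _; rewrite // src_sym.
have fr x : f (frev x) = f (frot x) by apply: ff; exact: same_source_flip.
pose d : C1 := [ffun x => f (frev x) - f x].
have dc : is_cocycle1 d.
  apply/andP; split; first (apply/andP; split).
  - apply/'forall_'forall_implyP => x y xy; rewrite !(ffunE (fun x => f (frev x) - f x)).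
    rewrite (ff x y) ?(ff (frev x) (frev y)) //; last by apply: connect1; rewrite xy.
    apply: connect1; move: xy; rewrite !gluedE => /eqP /fglue_frev ->.
    by rewrite eqxx.
  - by apply/forallP => x; rewrite !(ffunE (fun x => f (frev x) - f x)) frevK opprB.
  - apply/forallP => x; rewrite !(ffunE (fun x => f (frev x) - f x)) !fr frot3.
    by apply/eqP; ring.
have := cB (Sub d dc : Z1 R X); have -> : (Sub d dc : Z1 R X) \in B1 R X.
  apply/asboolP; exists f; last by move=> x; rewrite /= ffunE.
  by apply/'forall_'forall_implyP => x y xy; rewrite (ff x y).
move=> /(_ isT) E; apply/eqP; rewrite -subr_eq0; apply/eqP; rewrite -[RHS]E /dot.
rewrite [X in X - _]big_mkcond [X in _ - X]big_mkcond -sumrB; apply: eq_bigr => x _.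
rewrite /= ffunE /f !ffunE; case: (same_source x0 (frev x)); case: (same_source x0 x) => /=; ring.
Qed.

Lemma pairingE (z : C1) w : is_cycle1 z -> pairing (vpi (B1 R X) w) z = dot z (val w).
Proof.
move=> zc; apply/eqP; rewrite -[pairing _ _]/(dot z (val (vrepr (vpi (B1 R X) w)))).
rewrite -subr_eq0 -dotBr; apply/eqP/(cycle_coboundary (b := vrepr (vpi (B1 R X) w) - w) zc).
by apply/vpi_eq; rewrite vreprK.
Qed.

Lemma is_dualP (z : C1) w : is_cycle1 z ->
  is_dual z w <-> is_dual_of (fun u => dot z (val u)) w.
Proof. by move=> zc; split=> -[wr h]; split=> // u; rewrite -h pairingE. Qed.

Lemma intersectionE (z1 z2 : C1) w1 w2 : is_cycle1 z1 -> is_cycle1 z2 ->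
    is_dual_of (fun u => dot z1 (val u)) w1 -> is_dual_of (fun u => dot z2 (val u)) w2 ->
  intersection z1 z2 = cup_integral w1 w2.
Proof.
move=> zc1 zc2 d1 d2.
have h (z : C1) w : is_cycle1 z -> is_dual_of (fun u => dot z (val u)) w ->
    is_dual_of (fun u => dot z (val u)) (poincare_dual z).
  move=> zc d; apply/(is_dualP _ zc).
  exact: (xgetPex 0 (ex_intro [set c | is_dual z c] w ((is_dualP w zc).2 d))).
exact: (dual_form (h _ _ zc1 d1) d1 (h _ _ zc2 d2) d2).
Qed.

(** The gradient of a function defined by [z] pairs with [iota v] as [z] does with [v], so the dual
    of the gradient is a dual of [z]. *)
Lemma brH_bundle : bundle_poisson (@act R X) (@brH R X).
Proof.
split; [exact: brH_poisson|by move=> f f' g x; exact: brH_fiber|].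
move=> f1 f2 z1 z2 x fs1 fs2 zc1 zc2 l1 l2; rewrite -[x]runchartK brHE.
have dual (f : Sr R X -> R) (z : C1) : smooth_Sr f -> is_cycle1 z ->
    linear_on_fiber (@act R X) f x z ->
    is_dual_of (fun u => dot z (val u))
      (hdual (grad (fun u => f (rchart u) : R^o) (runchart x))).
  move=> fs zc fl; have [wr wE] := hdualP (grad (fun u => f (rchart u) : R^o) (runchart x)).
  split=> // u; rewrite -wE /hfun [RHS]dotC.
  rewrite (grad_linear_on_fiber fs (l := fun t => t * dot z (val u))) ?mul1r // => h.
  rewrite /= ?mul1r runchartK fl; congr (_ + _).
  rewrite -(linearZ_LR (vpi (B1 R X))) pairingE // (linearZ_LR val) dotZr //.
by rewrite (intersectionE zc1 zc2 (dual _ _ fs1 zc1 l1) (dual _ _ fs2 zc2 l2)).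
Qed.

(** Every cocycle [w] is relative here and is itself the dual of a cycle [- c]; intersecting [z]
    with that cycle evaluates [w] on [z] up to sign. *)
Lemma closed_nondegenerate : closed_manifold X -> intersection_nondegenerate R X.
Proof.
move=> Xc z zc zz v; rewrite -[v]vreprK pairingE //; set w := vrepr v.
have [c cE'] := linear_functional (cup_integral w : {linear Z1 R X -> R^o}).
have cE u : cup_integral w u = dot c (val u) by exact: cE'.
have cK b : b \in B1 R X -> dot (- c) (val b) = 0.
  move=> bB; rewrite -scaleN1r dotZl -cE cup_integralC cup_coboundary ?oppr0 ?mulr0 //.
  exact: closed_relative.
have cc := cycle_of cK.
have [w1 d1] : exists w1, is_dual_of (fun u => dot z (val u)) w1.
  by apply: dual_exists => b; exact: cycle_coboundary.
have d2 : is_dual_of (fun u => dot (- c) (val u)) w.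
  split=> [|u]; first exact: closed_relative.
  by rewrite -scaleN1r dotZl -cE cup_integralC mulrN mulN1r opprK.
have := zz _ cc; rewrite (intersectionE zc cc d1 d2) cup_integralC.
have [_ ->] := d1; by move/eqP; rewrite oppr_eq0 => /eqP.
Qed.

(** A weight is constant on fibers, so [brH_fiber] replaces it by a constant: it is a Casimir, and
    the mean value theorem keeps it fixed along the curve. *)
Lemma hamiltonian_step_Omega (x y : Sr R X) :
  hamiltonian_step (@smooth_Sr R X) (@brH R X) x y -> Omega_r x = Omega_r y.
Proof.
move=> [f [c [fs c0 c1 cd]]]; apply/ffunP => e.
pose g (y : Sr R X) : R := Omega_r y e.
have gs : smooth_Sr g.
  move=> n L La; apply: Cinfty_affine.
  rewrite (_ : (fun u => _) = fun u => (dot (ffdelta R e) \o @wt R X) (val (L u)) + 0).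
    exact: (@affine_comp R _ _ R^o _ (dot (ffdelta R e) \o @wt R X)).
  by apply/funext => u; rewrite /g Omega_rE addr0 /= dotC dot_delta.
have br0 t : brH g f (c t) = 0.
  have ks : smooth_Sr (fun _ : Sr R X => g (c t)).
    by move=> n L La; exact: Cinfty_cst.
  rewrite (brH_fiber (f' := fun _ => g (c t)) gs ks fs); last by move=> w ew; rewrite /g ew.
  rewrite -[c t]runchartK brHE.
  have -> : grad (fun _ => g (rchart (runchart (c t))) : R^o) (runchart (c t)) = 0.
    by apply/ffunP => a; rewrite ffunE [RHS]ffunE (@derive_cst _ _ _ (_ : R^o)).
  by rewrite linear0 cup_integralC linear0 oppr0.
have gd (t : R) : t \in `[0, 1] -> is_derive t (1 : R) (fun s : R => g (c s) : R^o) 0.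
  by rewrite in_itv /= => t01; have := cd g gs t t01; rewrite br0.
have gc : {within `[(0 : R), 1], continuous (fun s : R => g (c s))}.
  by apply: derivable_within_continuous => t /gd tg; exact: (@ex_derive _ _ _ _ _ _ _ tg).
have [t tI] := @MVT_segment R (fun s => g (c s)) (fun=> 0) 0 1 ler01
  (fun t tI => gd t (subset_itv_oo_cc tI)) gc.
by rewrite mul0r c0 c1 => /eqP; rewrite subr_eq0 => /eqP.
Qed.

(** Nondegeneracy gives a [k] whose dual class is [- v]. A function with fiber gradient [k], linear
    through [tau], generates the translations by [t *: v]; the minus sign compensates the
    antisymmetry of the cup product. *)
Lemma act_hamiltonian v (x : Sr R X) : intersection_nondegenerate R X ->
  hamiltonian_step (@smooth_Sr R X) (@brH R X) x (act v x).
Proof.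
move=> nd; have [tau [S [tau_iota tau0 _ _ _]]] := splitting R X.
pose T := linmap (linearP (iota R X \o vpi (B1 R X) \o @hdual R X)).
have [k kE] : exists k, T k = - iota R X v.
  apply: in_range => y yT; rewrite -scaleN1r dotZl; apply/eqP; rewrite mulf_eq0 oppr_eq0 oner_eq0 /=.
  apply/eqP.
  have [c cE] := linear_functional (dot y \o iota R X \o vpi (B1 R X)).
  have cc : is_cycle1 c.
    by apply: cycle_of => b bB; rewrite -cE /= (vpi_coboundary bB) linear0 dot0r.
  have dc : is_dual_of (fun u => dot c (val u)) (hdual y).
    by have [yr yE] := hdualP y; split=> // u; rewrite -cE -yE.
  rewrite dotC -[v]vreprK -[dot _ _]/((dot y \o iota R X \o vpi (B1 R X)) (vrepr v)) cE.
  rewrite -pairingE // vreprK; apply: nd => // z' zc'.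
  (* A vector whose pairing with [iota u] is that of [u] with [z']; so every cycle has a dual of the
     form [hdual m]. *)
  pose m : A := [ffun a => pairing (tau (ffdelta R a)) z'].
  have pl : linear (fun u : H1 R X => pairing u z' : R^o).
    move=> t p q; rewrite -[p]vreprK -[q]vreprK -vpi_lin !pairingE //.
    by rewrite (linearP val) dotDr dotZr.
  pose pll := linmap pl.
  have mE u : dot m (iota R X u) = pairing u z'.
    rewrite -[in RHS](tau_iota u) -[pairing _ _]/((pll \o tau) (iota R X u)).
    rewrite (linear_sum_delta (pll \o tau)) dotC; apply: eq_bigr => a _.
    by rewrite ffunE.
  have dm : is_dual_of (fun u => dot z' (val u)) (hdual m).
    have [mr mh] := hdualP m; split=> // u.
    by rewrite -mh /hfun mE pairingE.
  rewrite (intersectionE cc zc' dc dm) cup_integralC cup_hdualE.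
  by rewrite dotC -[dot _ _]/(dot (T m) y) yT oppr0.
have kv : vpi (B1 R X) (hdual k) = - v.
  apply/eqP; rewrite -subr_eq0; apply/eqP/iota_gauged.
  rewrite (linearB (iota R X)) (linearN (iota R X)) -[iota R X (vpi _ _)]/(T k) kE subrr.
  exact: gauged0.
pose f (x : Sr R X) : R := dot k (iota R X (tau (val (crepr x) - val (al0 R X)))).
have fE al : f (cpi _ al) = dot k (iota R X (tau (val al - val (al0 R X)))).
  rewrite /f; congr (dot k (iota R X _)).
  apply/esym/eqP; rewrite -subr_eq0 -(linearB tau); apply/eqP/tau0.
  by rewrite opprB addrA subrK; exact: crepr_Sr.
have fs : smooth_Sr f.
  move=> n L La; apply: Cinfty_affine.
  rewrite (_ : (fun u => _) = fun u => (dot k \o iota R X \o tau) (val (L u)) +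
     - dot k (iota R X (tau (val (al0 R X))))).
    exact: (@affine_comp R _ _ R^o _ (dot k \o iota R X \o tau)).
  by apply/funext => u; rewrite fE (linearB tau) (linearB (iota R X)) dotBr.
exists f, (fun t => act (t *: v) x); split=> //; [by rewrite scale0r act0|by rewrite scale1r|].
move=> g gs t _.
have fact h (w : H1 R X) (al : gshape R X) : f (act (h *: w) (cpi _ al)) = f (cpi _ al) + h * dot k (iota R X w).
  rewrite actE !fE val_shiftg; last exact: iota_tangent.
  rewrite (_ : _ - _ = iota R X (h *: w) + (val al - val (al0 R X))); last by rewrite addrAC addrC.
  by rewrite (linearD tau) tau_iota linearD dotDr (linearZ_LR (iota R X)) dotZr addrC.
set u := runchart x.
have actx s : act (s *: v) x = rchart (s *: vecr (iota R X v) + u).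
  by rewrite -act_chart runchartK.
rewrite actx brHE; set u' := t *: _ + u.
set p := grad _ u'; set q := grad _ u'.
have -> : cup_integral (hdual p) (hdual q) = dot (iota R X v) p.
  have qE z : dot q (iota R X (vpi (B1 R X) z)) = dot k (iota R X (vpi (B1 R X) z)).
    rewrite dotC (grad_linear_on_fiber fs (l := fun t => t * dot k (iota R X (vpi (B1 R X) z)))) ?mul1r //.
    by move=> h /=; rewrite ?mul1r; exact: fact.
  rewrite cup_hdualE qE -cup_hdualE cup_integralC cup_hdualE kv.
  by rewrite (linearN (iota R X)) (linearN (dot p)) opprK dotC.
rewrite (_ : (fun s => _) = fun s => g (rchart (u + s *: vecr (iota R X v)))); last first.
  by apply/funext => s; rewrite actx addrC.
rewrite dot_grad // /u' addrC.
apply: (@derivable_line R _ (fun w : 'rV[R]_#|{: tedge X}| => g (rchart w) : R^o)).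
by apply: Cinfty_derivable; exact/smooth_SrE.
Qed.

Lemma leaves_are_fibers : closed_manifold X \/ intersection_nondegenerate R X ->
  forall x y : Sr R X, same_leaf (@smooth_Sr R X) (@brH R X) x y <-> Omega_r x = Omega_r y.
Proof.
move=> cn x y; split=> [|/act_trans[v ->]].
  by elim=> [u w /hamiltonian_step_Omega //|//|u w _ -> //|u w z _ -> _ ->].
apply: rst_step; apply: act_hamiltonian.
by case: cn => // /closed_nondegenerate.
Qed.

End Cycles.

(** * Inverses of cellular isomorphisms *)

Section InverseIso.
Variables (X Y : manifold) (h : iso X Y).

Fact iso_tet_inverse : exists g, cancel (iso_tet h) g /\ cancel g (iso_tet h).
Proof. by case: (iso_bij h) => g gK Kg; exists g. Qed.

Definition inv_tet : tet Y -> tet X := sval (cid iso_tet_inverse).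
Lemma iso_tetK : cancel (iso_tet h) inv_tet.
Proof. exact: (svalP (cid iso_tet_inverse)).1. Qed.
Lemma inv_tetK : cancel inv_tet (iso_tet h).
Proof. exact: (svalP (cid iso_tet_inverse)).2. Qed.

Definition inv_vert (T : tet Y) : 'S_4 := (iso_vert h (inv_tet T))^-1%g.

Fact inv_bij_tet : bijective inv_tet.
Proof. by exists (iso_tet h); [exact: inv_tetK|exact: iso_tetK]. Qed.

Fact inv_glued (T T' : tet Y) (s s' : 'S_4) :
  glued (inv_tet T, (s * inv_vert T)%g) (inv_tet T', (s' * inv_vert T')%g) =
  glued (T, s) (T', s').
Proof. by rewrite -(iso_glued h) !inv_tetK /inv_vert !mulgKV. Qed.

Fact inv_orient T : odd_perm (inv_vert T) = neg T (+) neg (inv_tet T).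
Proof. by rewrite /inv_vert odd_permV iso_orient inv_tetK addbC. Qed.

Definition iso_inv : iso Y X := Iso inv_bij_tet inv_glued inv_orient.

Lemma iso_flagK : cancel (iso_flag h) (iso_flag iso_inv).
Proof. by case=> T s; rewrite /iso_flag /= /inv_vert iso_tetK mulgK. Qed.
Lemma iso_flagVK : cancel (iso_flag iso_inv) (iso_flag h).
Proof. by case=> T s; rewrite /iso_flag /= inv_tetK /inv_vert mulgKV. Qed.

Lemma edge_mapK (s t : 'S_4) : (s * t = 1)%g -> cancel (edge_map s) (edge_map t).
Proof.
move=> st e; apply: val_inj => /=; rewrite -imset_comp (eq_imset (g := id)) ?imset_id //.
by move=> k /=; rewrite -permM st perm1.
Qed.

Lemma iso_tedgeK : cancel (iso_tedge h) (iso_tedge iso_inv).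
Proof.
by case=> T e; rewrite /iso_tedge /= iso_tetK /inv_vert iso_tetK edge_mapK ?mulgV.
Qed.
Lemma iso_tedgeVK : cancel (iso_tedge iso_inv) (iso_tedge h).
Proof.
by case=> T e; rewrite /iso_tedge /= inv_tetK edge_mapK /inv_vert ?mulVg.
Qed.

End InverseIso.

(** * Isomorphisms on flags, edges and faces *)

Section PullCombinatorics.
Variables (X Y : manifold) (h : iso X Y).
Implicit Types (s : flag X).

Lemma iso_flag_frot s : iso_flag h (frot s) = frot (iso_flag h s).
Proof. by rewrite /iso_flag /frot /= mulgA. Qed.
Lemma iso_flag_fswap s : iso_flag h (fswap s) = fswap (iso_flag h s).
Proof. by rewrite /iso_flag /fswap /= mulgA. Qed.
Lemma iso_flag_frev s : iso_flag h (frev s) = frev (iso_flag h s).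
Proof. by rewrite /iso_flag /frev /= mulgA. Qed.
Lemma iso_flag_fturn s : iso_flag h (fturn s) = fturn (iso_flag h s).
Proof. by rewrite /fturn !iso_flag_frot iso_flag_fswap. Qed.

Lemma pos_iso_flag s : positive (iso_flag h s) = positive s.
Proof.
rewrite /positive /= odd_permM iso_orient.
by case: (odd_perm _); case: (neg _); case: (neg _).
Qed.

Lemma fedge_iso_flag s : fedge (iso_flag h s) = iso_tedge h (fedge s).
Proof.
by apply: fedgeP => //=; rewrite !permM imsetU1 imset_set1.
Qed.

Lemma iso_flag_bij : bijective (iso_flag h).
Proof. by exists (iso_flag (iso_inv h)); [exact: iso_flagK|exact: iso_flagVK]. Qed.
Lemma iso_tedge_bij : bijective (iso_tedge h).
Proof. by exists (iso_tedge (iso_inv h)); [exact: iso_tedgeK|exact: iso_tedgeVK]. Qed.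

Lemma fglue_iso_some s t : fglue s = Some t -> fglue (iso_flag h s) = Some (iso_flag h t).
Proof.
move=> /eqP; rewrite -gluedE => st; apply/eqP; rewrite -gluedE.
by case: s t st => [T s] [T' s'] st; rewrite /iso_flag iso_glued.
Qed.

End PullCombinatorics.

Section PullCombinatorics2.
Variables (X Y : manifold) (h : iso X Y).
Implicit Types (s : flag X).

Lemma fglue_iso_none s : fglue s = None -> fglue (iso_flag h s) = None.
Proof.
case E: (fglue (iso_flag h s)) => [t|//]; have := fglue_iso_some (iso_inv h) E.
by rewrite iso_flagK => ->.
Qed.

Lemma fcross_iso s : fcross (iso_flag h s) = iso_flag h (fcross s).
Proof.
rewrite /fcross; case E: (fglue s) => [t|]; last by rewrite fglue_iso_none.
by rewrite (fglue_iso_some h E) iso_flag_frev.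
Qed.

Lemma fglue_iso_neq s : (fglue (iso_flag h s) != None) = (fglue s != None).
Proof.
by case E: (fglue s) => [t|]; rewrite ?(fglue_iso_some h E) ?(fglue_iso_none E).
Qed.

Lemma phi31_iso (a b : tedge X) : phi31 a = phi31 b ->
  phi31 (iso_tedge h a) = phi31 (iso_tedge h b).
Proof.
move=> /eqP; rewrite fpi_eq; last exact: tedge_glued_sym.
case/connectP => p pp ->; elim: p a pp => //= c p IH a /andP[ac pp].
rewrite -(IH _ pp); apply/eqP; rewrite fpi_eq; last exact: tedge_glued_sym.
apply: connect1; case/tedge_gluedP: ac => s [t [sp st <- <-]]; apply/tedge_gluedP.
exists (iso_flag h s), (iso_flag h t).
by rewrite pos_iso_flag !fedge_iso_flag (fglue_iso_some h st).
Qed.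

Lemma closed_fglue : closed_manifold X <-> forall s, fglue s <> None.
Proof.
split=> [Xc s /eqP|Xs [T i]]; first by rewrite fglue_none => /eqP; exact: Xc.
move=> /eqP E; apply: (Xs (T, tperm pos3 i)); apply/eqP.
by rewrite fglue_none /= tpermL.
Qed.

End PullCombinatorics2.

(** Ensures that [angles_of] takes the same branch on both sides. *)
Lemma closed_iso (X Y : manifold) : iso X Y -> closed_manifold X -> closed_manifold Y.
Proof.
move=> h /closed_fglue Xc; apply/closed_fglue => s sn.
by apply: (Xc (iso_flag (iso_inv h) s)); exact: fglue_iso_none.
Qed.

(** * Pullback of angles, cocycles and cohomology classes *)

Section Pull.
Variables (R : realType) (X Y : manifold) (h : iso X Y).
Local Notation AX := {ffun tedge X -> R^o}.
Local Notation AY := {ffun tedge Y -> R^o}.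
Implicit Types (x y : AY).

Definition pullA x : AX := [ffun a => x (iso_tedge h a)].
Fact pullA_is_linear : linear pullA.
Proof. by move=> k x y; apply/ffunP => a; rewrite !ffunE. Qed.
HB.instance Definition _ := GRing.isLinear.Build R AY AX _ pullA pullA_is_linear.

Definition pullC (c : {ffun flag Y -> R^o}) : {ffun flag X -> R^o} :=
  [ffun s => c (iso_flag h s)].

Lemma pullA_fedge x s : pullA x (fedge s) = x (fedge (iso_flag h s)).
Proof. by rewrite ffunE fedge_iso_flag. Qed.

(** Vertex orders need not be preserved, but [epsopE] only involves moves of positive flags, which
    [iso_flag] respects. *)
Lemma pullA_epsop x : pullA (epsop x) = epsop (pullA x).
Proof.
apply/ffunP => a; have [s sp <-] := fedge_surj a.
rewrite pullA_fedge !epsopE ?pos_iso_flag // !pullA_fedge.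
by rewrite !(iso_flag_frot, iso_flag_fswap, iso_flag_fturn).
Qed.

Lemma pullA_hop c : pullA (hop c) = hop (pullC c).
Proof.
apply/ffunP => a; have [s sp <-] := fedge_surj a.
rewrite pullA_fedge !hopE ?pos_iso_flag // !ffunE.
by rewrite !(iso_flag_frot, iso_flag_fswap, iso_flag_fturn).
Qed.

Lemma dot_pullA x y : dot (pullA x) (pullA y) = dot x y.
Proof.
rewrite /dot [RHS](reindex (iso_tedge h)); last exact/onW_bij/iso_tedge_bij.
by apply: eq_bigr => a _; rewrite !ffunE.
Qed.

Lemma tangent_pullA x : tangent x -> tangent (pullA x).
Proof.
move=> xt s sp; rewrite !pullA_fedge !iso_flag_frot; apply: xt.
by rewrite pos_iso_flag.
Qed.

Lemma pullA_pullg (g : {ffun cell1 Y -> R^o}) : exists g' : {ffun cell1 X -> R^o},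
  pullA (pullg g) = pullg g' /\ (based g -> based g').
Proof.
have [|g' g'E] := fquot_lift (@tedge_glued_sym X) (0 : R^o)
    (f := fun a => g (phi31 (iso_tedge h a))).
  move=> a b ab; congr (g _); apply: phi31_iso; apply/eqP.
  by rewrite fpi_eq; [exact: connect1|exact: tedge_glued_sym].
have E : pullA (pullg g) = pullg g' by apply/ffunP => a; rewrite !ffunE -g'E.
exists g'; split=> // gb; apply: (vanish_based (f := pullg g')); first by move=> a; rewrite ffunE.
move=> s sp sg; rewrite -E pullA_fedge.
by apply: (based_vanish gb); [rewrite pos_iso_flag|exact: fglue_iso_none].
Qed.

Lemma gauged_pullA x : gauged x -> gauged (pullA x).
Proof.
move=> [g ->]; rewrite /gaugemap pullA_epsop.
have [g' [-> gb]] := pullA_pullg (interior_part g).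
exact/gauged_based/gb/based_interior.
Qed.

Lemma wt_pullA x a : wt (pullA x) (phi31 a) = wt x (phi31 (iso_tedge h a)).
Proof.
rewrite !ffunE [RHS](reindex (iso_tedge h)); last exact/onW_bij/iso_tedge_bij.
apply: eq_big => [b|b _]; last by rewrite ffunE.
apply/eqP/eqP => [|E]; first exact: phi31_iso.
by have := phi31_iso (iso_inv h) E; rewrite !iso_tedgeK.
Qed.

Lemma flat_pullA x : flat x -> flat (pullA x).
Proof.
move=> [xt xw]; split; first exact: tangent_pullA.
apply/ffunP => e; have [a <-] := fpi_surj e.
by rewrite -[fpi _ a]/(phi31 a) wt_pullA xw !ffunE.
Qed.

Lemma pcup_pullC c d : pcup (pullC c) (pullC d) = pcup c d.
Proof.
rewrite /pcup; congr (_ * _); rewrite [RHS](reindex (iso_flag h)); last exact/onW_bij/iso_flag_bij.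
apply: eq_big => [s|s _]; first by rewrite pos_iso_flag.
by rewrite !ffunE !iso_flag_frot.
Qed.

Lemma val_Z1_pull (z : Z1 R Y) : val (Z1_pull h z) = pullC (val z).
Proof. by []. Qed.

Lemma cup_Z1_pull (z w : Z1 R Y) :
  cup_integral (Z1_pull h z) (Z1_pull h w) = cup_integral z w.
Proof. exact: pcup_pullC. Qed.

Lemma relative_Z1_pull (z : Z1 R Y) : is_relative z -> is_relative (Z1_pull h z).
Proof.
move=> /prelative_val zr; apply/prelative_val => s sp sg; rewrite ffunE.
by apply: zr; [rewrite pos_iso_flag|exact: fglue_iso_none].
Qed.

Fact Z1_pull_is_linear : linear (Z1_pull h : Z1 R Y -> Z1 R X).
Proof. by move=> k z w; apply: val_inj; apply/ffunP => s; rewrite !ffunE. Qed.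
HB.instance Definition _ := GRing.isLinear.Build R (Z1 R Y) (Z1 R X) _
  (Z1_pull h : Z1 R Y -> Z1 R X) Z1_pull_is_linear.

Lemma coboundary_Z1_pull (z : Z1 R Y) : z \in B1 R Y -> Z1_pull h z \in B1 R X.
Proof.
move=> /is_coboundaryP[f [fz fi]]; apply/is_coboundaryP; exists (fun s => f (iso_flag h s)).
split=> s sp; first by rewrite ffunE fz ?pos_iso_flag // iso_flag_frot.
by move=> sg; rewrite fi ?pos_iso_flag ?fglue_iso_neq // fcross_iso iso_flag_frot.
Qed.

Lemma H1_pullE (z : Z1 R Y) : H1_pull h (vpi (B1 R Y) z) = vpi (B1 R X) (Z1_pull h z).
Proof.
apply/vpi_eq; rewrite -linearB; apply: coboundary_Z1_pull.
by apply/vpi_eq; rewrite vreprK.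
Qed.

Lemma H1_pull_linear : linear (@H1_pull R X Y h).
Proof.
move=> k v w; rewrite -[v]vreprK -[w]vreprK -vpi_lin !H1_pullE.
by rewrite (linearP (Z1_pull h : Z1 R Y -> Z1 R X)) vpi_lin.
Qed.

End Pull.

(** * Naturality of the action, the brackets and the levels *)

Section PullInverse.
Variables (R : realType) (X Y : manifold) (h : iso X Y).
Local Notation AX := {ffun tedge X -> R^o}.
Local Notation AY := {ffun tedge Y -> R^o}.
Local Notation gaugeX := (@gauge_equiv R X).
Local Notation gaugeY := (@gauge_equiv R Y).

Lemma pullAK : cancel (pullA h : AY -> AX) (pullA (iso_inv h)).
Proof. by move=> x; apply/ffunP => a; rewrite !ffunE iso_tedgeVK. Qed.
Lemma pullAVK : cancel (pullA (iso_inv h) : AX -> AY) (pullA h).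
Proof. by move=> x; apply/ffunP => a; rewrite !ffunE iso_tedgeK. Qed.

Lemma dot_pullAl (x : AY) (y : AX) : dot (pullA h x) y = dot x (pullA (iso_inv h) y).
Proof. by rewrite -{1}[y]pullAVK dot_pullA. Qed.

Lemma Z1_pullK : cancel (@Z1_pull R X Y h) (@Z1_pull R Y X (iso_inv h)).
Proof. by move=> z; apply: val_inj; apply/ffunP => s; rewrite !ffunE iso_flagVK. Qed.
Lemma Z1_pullVK : cancel (@Z1_pull R Y X (iso_inv h)) (@Z1_pull R X Y h).
Proof. by move=> z; apply: val_inj; apply/ffunP => s; rewrite !ffunE iso_flagK. Qed.

Lemma H1_pull_bij : bijective (@H1_pull R X Y h).
Proof.
by exists (@H1_pull R Y X (iso_inv h)) => v; rewrite -[v]vreprK !H1_pullE;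
  rewrite ?Z1_pullK ?Z1_pullVK.
Qed.

(** [pullA] is an isometry that preserves flat vectors in both directions, so it commutes with the
    orthogonal projection. *)
Lemma flatp_pullA (x : AY) : flatp R X (pullA h x) = pullA h (flatp R Y x).
Proof.
have [f1 m1] := flatpP (pullA h x); have [f2 m2] := flatpP x.
apply/eqP; rewrite -subr_eq0; apply/eqP/dot_eq0.
have f3 := flat_pullA h f2.
by rewrite dotBl m1 ?(dot_pullAl (flatp R Y x)) ?m2 -?dot_pullAl ?subrr //;
  [exact/flat_pullA/flatB|exact: flatB].
Qed.

Lemma tproj_pullA (x : AY) : tproj R X (pullA h x) = pullA h (tproj R Y x).
Proof.
have [t2 m2] := tprojP x; apply: tproj_unique => [|m mt]; first exact: tangent_pullA.
by rewrite !dot_pullAl m2 //; exact: tangent_pullA.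
Qed.

Lemma angles_pull (z : Z1 R Y) : angles_of (flatp R X) (val (Z1_pull h z)) =
  pullA h (angles_of (flatp R Y) (val z)).
Proof.
rewrite val_Z1_pull /angles_of; case: asboolP => Xc; case: asboolP => Yc.
- by rewrite linearZ /= pullA_epsop pullA_hop.
- by case: Yc; exact: closed_iso Xc.
- by case: Xc; exact: closed_iso (iso_inv h) Yc.
- by rewrite -pullA_hop flatp_pullA.
Qed.

(** The gauge complement in [iota] is a choice, so equality is only modulo gauge directions; this is
    enough on [Sr]. *)
Lemma iota_pull (v : H1 R Y) : gauged (iota R X (H1_pull h v) - pullA h (iota R Y v)).
Proof.
rewrite -[v]vreprK H1_pullE; set z := vrepr v.
have h1 := iota_angles (Z1_pull h z); have h2 := gauged_pullA h (iota_angles z).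
have := gaugedB h1 h2; rewrite (linearB (pullA h)) angles_pull.
by rewrite opprB addrA subrK.
Qed.

Lemma val_gshape_pull (al : gshape R Y) : val (gshape_pull h al) = pullA h (val al).
Proof. by []. Qed.

Lemma gshape_pull_shift (al : gshape R Y) x :
  gshape_pull h (shiftg al x) = shiftg (gshape_pull h al) (pullA h x).
Proof.
by apply: val_inj; rewrite val_gshape_pull /= (linearD (pullA h)) tproj_pullA.
Qed.

Lemma gauge_pull (al be : gshape R Y) : gaugeY al be ->
  gaugeX (gshape_pull h al) (gshape_pull h be).
Proof.
move=> /gauge_equivP ab; apply/gauge_equivP; rewrite !val_gshape_pull -(linearB (pullA h)).
exact: gauged_pullA.
Qed.

Lemma Sr_pullE (al : gshape R Y) : Sr_pull h (cpi gaugeY al) = cpi gaugeX (gshape_pull h al).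
Proof.
apply/Sr_eq/gauge_equivP/gauge_pull/gauge_equivP; exact: crepr_Sr.
Qed.

Lemma act_pull (v : H1 R Y) (x : Sr R Y) :
  Sr_pull h (act v x) = act (H1_pull h v) (Sr_pull h x).
Proof.
have [al ->] := Sr_surj x; rewrite actE !Sr_pullE actE gshape_pull_shift.
apply: gauged_tproj; last exact: iota_tangent.
  by rewrite -opprB; apply/gaugedN/iota_pull.
exact/tangent_pullA/iota_tangent.
Qed.

Lemma Omega_pull (x : Sr R Y) (a : tedge X) :
  Omega_r (Sr_pull h x) (phi31 a) = Omega_r x (phi31 (iso_tedge h a)).
Proof.
by have [al ->] := Sr_surj x; rewrite Sr_pullE !Omega_rE val_gshape_pull wt_pullA.
Qed.

Lemma affine_pull n (L : 'rV[R]_n -> gshape R Y) : affine_map (fun u => val (L u)) ->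
  affine_map (fun u => val (gshape_pull h (L u))).
Proof.
by move=> La t u w; rewrite !val_gshape_pull La (linearD (pullA h)) !(linearZ_LR (pullA h)).
Qed.

Lemma smooth_Sr_pull (f : Sr R X -> R) : smooth_Sr f -> smooth_Sr (fun x => f (Sr_pull h x)).
Proof.
move=> fs n L La; rewrite (_ : (fun u => _) = fun u => f (cpi gaugeX (gshape_pull h (L u)))).
  by apply: fs; exact: affine_pull.
by apply/funext => u; rewrite Sr_pullE.
Qed.

Lemma gshape_pullK : cancel (@gshape_pull R X Y h) (@gshape_pull R Y X (iso_inv h)).
Proof. by move=> al; apply: val_inj; exact: (pullAK (val al)). Qed.

Definition rowmap (u : 'rV[R]_#|{: tedge Y}|) : 'rV[R]_#|{: tedge X}| :=
  vecr (pullA h (unvecr u)).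

Lemma al0_pull : gshape_pull h (al0 R Y) = al0 R X.
Proof. by apply: val_inj; apply/ffunP => a; rewrite !ffunE. Qed.

Lemma chart_rowmap u : chart (rowmap u) = gshape_pull h (chart u).
Proof.
by rewrite /chart gshape_pull_shift al0_pull /rowmap vecrK.
Qed.

Lemma rchart_rowmap u : Sr_pull h (rchart u) = rchart (rowmap u).
Proof. by rewrite Sr_pullE /rchart chart_rowmap. Qed.

Lemma grad_pull (f : Sr R X -> R) u : smooth_Sr f ->
  grad (fun w => f (rchart w) : R^o) (rowmap u) =
  pullA h (grad (fun w => f (Sr_pull h (rchart w)) : R^o) u).
Proof.
move=> fs; apply/ffunP => a; rewrite -dot_delta dotC dot_grad // [RHS]ffunE [RHS]ffunE.
have [k|_ ->//] := @derive_congr R _ _ (fun w => f (rchart w) : R^o)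
  (fun w => f (Sr_pull h (rchart w)) : R^o) (rowmap u) (vecr (ffdelta R a)) u
  (dir R (iso_tedge h a)).
rewrite rchart_rowmap; congr (f (rchart _)).
rewrite /rowmap (linearD (@unvecr R Y)) (linearD (pullA h)) (linearD (@vecr R X)).
rewrite (linearZ_LR (@unvecr R Y)) (linearZ_LR (pullA h)) (linearZ_LR (@vecr R X)).
congr (_ *: _ + _); rewrite /= /dir vecrK; congr vecr; apply/ffunP => b; rewrite !ffunE.
by rewrite (bij_eq (iso_tedge_bij h)).
Qed.

Lemma br_pull : poisson_morphism (@smooth_Sr R X) (@br R X) (@br R Y) (@Sr_pull R X Y h).
Proof.
move=> f g fs gs x; rewrite -[x]runchartK rchart_rowmap !brE !grad_pull //.
by rewrite -pullA_epsop dot_pullA.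
Qed.

(** The chosen duals need not correspond under [h], but the pulled back one is another dual of the
    same functional, and [dual_form] compares the cup products. *)
Lemma hdual_pull (f : Sr R X -> R) u : smooth_Sr f ->
  is_dual_of (hfun (grad (fun w => f (rchart w) : R^o) (rowmap u)))
    (Z1_pull h (hdual (grad (fun w => f (Sr_pull h (rchart w)) : R^o) u))).
Proof.
move=> fs; set k := grad _ u; have [kr kE] := hdualP k.
split=> [|z]; first exact: relative_Z1_pull.
rewrite -[z]Z1_pullVK; set z' := Z1_pull _ z.
rewrite cup_Z1_pull -kE /hfun -H1_pullE.
have := grad_gauged fs (rowmap u) (iota_pull (vpi (B1 R Y) z')).
rewrite dotBl => /eqP; rewrite subr_eq0 dotC => /eqP ->.
by rewrite grad_pull // dot_pullA dotC.
Qed.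

Lemma brH_pull : poisson_morphism (@smooth_Sr R X) (@brH R X) (@brH R Y) (@Sr_pull R X Y h).
Proof.
move=> f g fs gs x; rewrite -[x]runchartK rchart_rowmap !brHE.
rewrite (dual_form (hdualP _) (hdual_pull _ fs) (hdualP _) (hdual_pull _ gs)).
exact: cup_Z1_pull.
Qed.

Lemma lgauge_pull (u v : lgshape R Y) : lgauge_equiv u v ->
  lgauge_equiv (gshape_pull h u.1, u.2) (gshape_pull h v.1, v.2).
Proof.
move=> /lgauge_equivP[g gb [gm gl]]; have [g' [g'E g'b]] := pullA_pullg h g.
apply/lgauge_equivP; exists g'; first exact: g'b.
split; first by rewrite !val_gshape_pull -(linearB (pullA h)) gm -g'E -pullA_epsop linearZ.
rewrite /= gl !level_shiftE -al0_pull !val_gshape_pull -(linearB (pullA h)) -g'E.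
by rewrite dot_pullA.
Qed.

Lemma LSr_pullE (al : lgshape R Y) :
  LSr_pull h (cpi (@lgauge_equiv R Y) al) = cpi (@lgauge_equiv R X) (gshape_pull h al.1, al.2).
Proof.
by apply/LSr_eq/lgauge_pull/LSr_eq; rewrite cpi_crepr.
Qed.

Lemma smooth_LSr_pull (f : LSr R X -> R) : smooth_LSr f ->
  smooth_LSr (fun x => f (LSr_pull h x)).
Proof.
move=> fs n L La; have [L1 L2] := affine_gpair La.
rewrite (_ : (fun u => _) = fun u => f (cpi (@lgauge_equiv R X) (gshape_pull h (L u).1, (L u).2))).
  apply: (fs n (fun u => (gshape_pull h (L u).1, (L u).2))) => t u w.
  congr (_, _); [exact: (affine_pull L1)|exact: L2].
by apply/funext => u; rewrite LSr_pullE.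
Qed.

Lemma Sr_pos_pull (x : Sr R Y) : @Sr_pos R Y x -> @Sr_pos R X (Sr_pull h x).
Proof.
move=> [al ap <-]; rewrite Sr_pullE; exists (gshape_pull h al) => // a.
by rewrite val_gshape_pull ffunE; exact: ap.
Qed.

Lemma LSr_pos_pull (x : LSr R Y) : @LSr_pos R Y x -> @LSr_pos R X (LSr_pull h x).
Proof.
move=> [[al l] ap <-]; rewrite LSr_pullE; exists (gshape_pull h al, l) => // a.
by rewrite val_gshape_pull ffunE; exact: ap.
Qed.

End PullInverse.

Section PullEquivalences.
Variables (R : realType) (X Y : manifold) (h : iso X Y).

Lemma Sr_pullK : cancel (@Sr_pull R X Y h) (@Sr_pull R Y X (iso_inv h)).
Proof.
by move=> x; have [al ->] := Sr_surj x; rewrite !Sr_pullE gshape_pullK.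
Qed.
Lemma Sr_pullVK : cancel (@Sr_pull R Y X (iso_inv h)) (@Sr_pull R X Y h).
Proof.
move=> x; have [al ->] := Sr_surj x; rewrite !Sr_pullE; congr cpi.
by apply: val_inj; exact: (pullAVK h (val al)).
Qed.

Lemma LSr_pullK : cancel (@LSr_pull R X Y h) (@LSr_pull R Y X (iso_inv h)).
Proof.
by move=> u; have [al [l ->]] := LSr_surj u; rewrite !LSr_pullE /= gshape_pullK.
Qed.
Lemma LSr_pullVK : cancel (@LSr_pull R Y X (iso_inv h)) (@LSr_pull R X Y h).
Proof.
move=> u; have [al [l ->]] := LSr_surj u; rewrite !LSr_pullE; congr (cpi _ (_, _)).
by apply: val_inj; exact: (pullAVK h (val al)).
Qed.

Lemma smooth_iso_Sr : smooth_iso (@smooth_Sr R X) (@smooth_Sr R Y) (@Sr_pull R X Y h).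
Proof.
split; first by exists (Sr_pull (iso_inv h)); [exact: Sr_pullK|exact: Sr_pullVK].
move=> f; split=> [|/(smooth_Sr_pull (iso_inv h))]; first exact: smooth_Sr_pull.
by rewrite (_ : (fun x => _) = f) //; apply/funext => x; rewrite Sr_pullVK.
Qed.

Lemma smooth_iso_LSr : smooth_iso (@smooth_LSr R X) (@smooth_LSr R Y) (@LSr_pull R X Y h).
Proof.
split; first by exists (LSr_pull (iso_inv h)); [exact: LSr_pullK|exact: LSr_pullVK].
move=> f; split=> [|/(smooth_LSr_pull (iso_inv h))]; first exact: smooth_LSr_pull.
by rewrite (_ : (fun x => _) = f) //; apply/funext => x; rewrite LSr_pullVK.
Qed.

Lemma Sr_pos_image : [set Sr_pull h x | x in @Sr_pos R Y] = @Sr_pos R X.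
Proof.
apply/seteqP; split=> [x [y yp <-]|x xp]; first exact: Sr_pos_pull.
by exists (Sr_pull (iso_inv h) x); [exact: Sr_pos_pull|exact: Sr_pullVK].
Qed.

Lemma LSr_pos_image : [set LSr_pull h u | u in @LSr_pos R Y] = @LSr_pos R X.
Proof.
apply/seteqP; split=> [x [y yp <-]|x xp]; first exact: LSr_pos_pull.
by exists (LSr_pull (iso_inv h) x); [exact: LSr_pos_pull|exact: LSr_pullVK].
Qed.

End PullEquivalences.

Theorem theorem1 (R : realType) :
  exists (act : forall X : manifold, H1 R X -> Sr R X -> Sr R X)
         (nz : forall X : manifold, bracket R (gshape R X))
         (br : forall X : manifold, bracket R (Sr R X))
         (brH : forall X : manifold, bracket R (Sr R X)),
    (forall X : manifold,
      [/\ affine_bundle (@smooth_Sr R X) (@smooth_weights R X)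
            (@Omega_r R X) (act X)
          /\ by_translations (act X),
          neumann_zagier (nz X) /\ is_reduction (nz X) (br X),
          bundle_poisson (act X) (brH X),
          (closed_manifold X ->
             forall f g, smooth_Sr f -> smooth_Sr g -> br X f g = brH X f g)
          /\ (closed_manifold X \/ intersection_nondegenerate R X ->
             forall x y, same_leaf (@smooth_Sr R X) (brH X) x y <->
                         Omega_r x = Omega_r y) &
          affine_bundle (@smooth_LSr R X) (@smooth_Sr R X)
            (@forget R X) (@level_act R X)
          /\ forall u : LSr R X, @LSr_pos R X u <-> @Sr_pos R X (forget u)])
  /\
    (forall (X Y : manifold) (h : iso X Y),
      [/\ [/\ forall al : gshape R Y,
                Sr_pull h (cpi _ al) = cpi _ (gshape_pull h al),
              smooth_iso (@smooth_Sr R X) (@smooth_Sr R Y) (@Sr_pull R X Y h),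
              poisson_morphism (@smooth_Sr R X) (br X) (br Y)
                (@Sr_pull R X Y h) &
              poisson_morphism (@smooth_Sr R X) (brH X) (brH Y)
                (@Sr_pull R X Y h)],
          [/\ linear (@H1_pull R X Y h), bijective (@H1_pull R X Y h),
              forall (v : H1 R Y) (x : Sr R Y),
                Sr_pull h (act Y v x) = act X (H1_pull h v) (Sr_pull h x) &
              forall (x : Sr R Y) (a : tedge X),
                Omega_r (Sr_pull h x) (phi31 a) =
                Omega_r x (phi31 (iso_tedge h a))],
          [set Sr_pull h x | x in @Sr_pos R Y] = @Sr_pos R X,
          [/\ forall al : lgshape R Y,
                LSr_pull h (cpi _ al) = cpi _ (gshape_pull h al.1, al.2),
              smooth_iso (@smooth_LSr R X) (@smooth_LSr R Y)
                (@LSr_pull R X Y h),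
              forall (t : R) (u : LSr R Y),
                LSr_pull h (level_act t u) = level_act t (LSr_pull h u) &
              forall u : LSr R Y,
                forget (LSr_pull h u) = Sr_pull h (forget u)] &
          [set LSr_pull h u | u in @LSr_pos R Y] = @LSr_pos R X]).
Proof.
exists (@act R), (@nz R), (@br R), (@brH R); split=> [X|X Y h]; split.
- by split; [exact: Omega_bundle|exact: act_translations].
- by split; [exact: nz_neumann_zagier|exact: br_reduction].
- exact: brH_bundle.
- by split; [exact: br_closed|exact: leaves_are_fibers].
- by split; [exact: level_bundle|exact: LSr_posE].
- split; [exact: Sr_pullE|exact: smooth_iso_Sr|exact: br_pull|exact: brH_pull].
- split; [exact: H1_pull_linear|exact: H1_pull_bij|exact: act_pull|exact: Omega_pull].
- exact: Sr_pos_image.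
- split; [exact: LSr_pullE|exact: smooth_iso_LSr| |].
    by move=> t u; have [al [l ->]] := LSr_surj u; rewrite level_actE !LSr_pullE level_actE.
  by move=> u; have [al [l ->]] := LSr_surj u; rewrite LSr_pullE !forgetE Sr_pullE.
- exact: LSr_pos_image.
Qed.
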